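(* Fix $\rho>-2$ and $x_0>0$, and let $\alpha(\rho)=\frac{2+\rho}{4+\rho}$. Let $\gamma\in\mathcal X^C_{x_0}$ and suppose that $I^C_{\rho,x_0}(\gamma)<\infty$. Then for each $0<\alpha_-<\alpha(\rho)<\alpha_+<1$ there is an $R>0$ such that $\gamma\setminus B(0,R)\subset C(\alpha_-,\alpha_+)$, where $$C(\alpha_-,\alpha_+)=\{re^{i\theta}:r>0,\ \theta\in(\alpha_-\pi,\alpha_+\pi)\}.$$
   Context: $\mathbb H$ is the upper half-plane. Simple curves $\gamma:(0,T)\to\mathbb H$, $T\in(0,\infty]$, with $\gamma(0+)=0$ are parametrized by half-plane capacity: with $\gamma_t=\gamma((0,t])$, $g_t:\mathbb H\setminus\gamma_t\to\mathbb H$ is the conformal map with $g_t(z)=z+2t/z+o(1/z)$ at $\infty$; $W_t=g_t(\gamma(t))$ is the driving function and $x_t=g_t(x_0)$. $\mathcal X^C_{x_0}$ is the class of such curves which are maximal in the sense that $T=\tau_{0+}:=\lim_{\varepsilon\to0+}\tau_\varepsilon$, $\tau_\varepsilon=\inf\{t\in(0,T):|W_t-x_t|\le\varepsilon\}$ ($T=\infty$ allowed). The $\rho$-Loewner energy is $$I^C_{\rho,x_0}(\gamma)=\frac12\int_0^T\Big(\dot W_t-\frac{\rho}{W_t-x_t}\Big)^2dt$$ if $W$ is absolutely continuous on compact subintervals of $[0,T)$, and $\infty$ otherwise. $B(0,R)$ is the disk of radius $R$ centered at $0$. *)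

(* Defs.v *)
From HB Require Import structures.
From mathcomp Require Import all_boot all_order all_algebra.
From mathcomp Require Import all_classical all_reals all_analysis.
From mathcomp Require Export complex.

Set Implicit Arguments.
Unset Strict Implicit.
Unset Printing Implicit Defensive.

Import Order.TTheory GRing.Theory Num.Theory.
Import numFieldNormedType.Exports.
Local Open Scope classical_set_scope.
Local Open Scope ring_scope.
Local Open Scope complex_scope.

(* [R[i]^o] is the complex plane as a normed module over itself, so that
   [derivable f z 1] for [f : R[i]^o -> R[i]^o] is complex differentiability.
   The norm of [R[i]] takes its values in [R[i]]. *)

Definition upper_half_plane (R : realType) : set R[i]^o :=
  [set z | 0 < complex.Im z].

(* (0, T) with T possibly infinite *)
Definition times (R : realType) (T : \bar R) : set R :=
  [set t | 0 < t /\ (t%:E < T)%E].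

Definition curve_hull (R : realType) (gamma : R -> R[i]^o) (t : R) :
    set R[i]^o :=
  gamma @` `]0, t].

(* [g] maps [H \ K] conformally onto [H], with
   g(z) = z + 2 t / z + o(1/z) as z tends to infinity in [H \ K]. *)
Record mapping_out (R : realType) (K : set R[i]^o) (t : R)
    (g : R[i]^o -> R[i]^o) : Prop := MappingOut {
  mapping_out_holomorphic :
    forall z, (@upper_half_plane R `\` K) z -> derivable g z 1 ;
  mapping_out_bij :
    set_bij (@upper_half_plane R `\` K) (@upper_half_plane R) g ;
  mapping_out_expansion :
    forall e : R, 0 < e -> exists M : R, forall z : R[i],
      (@upper_half_plane R `\` K) z -> M%:C < `|z| ->
      `|(g z : R[i]) - (z + (2 * t)%:C / z)| <= e%:C * `|z^-1| }.

(* Simple curves in [H] started at 0 and parametrized by half-plane capacity,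
   together with their conformal maps [g t], driving function [W] and the
   images [x t] of the boundary point [x0].  The values of [g t] at the
   boundary points [gamma t] and [x0] of [H \ gamma (0, t]] are boundary
   limits; [W 0 = 0] is the value given by g_0 = id and gamma(0+) = 0. *)
Record loewner_curve (R : realType) (x0 : R) (T : \bar R)
    (gamma : R -> R[i]^o) (g : R -> R[i]^o -> R[i]^o) (W x : R -> R) : Prop :=
  LoewnerCurve {
  loewner_curve_T_gt0 : (0 < T)%E ;
  loewner_curve_in_H : forall t, times T t -> upper_half_plane (gamma t) ;
  loewner_curve_continuous : {within times T, continuous gamma} ;
  loewner_curve_simple : set_inj (times T) gamma ;
  loewner_curve_start : gamma t @[t --> 0^'+] --> (0 : R[i]^o) ;
  loewner_curve_maps : forall t, times T t ->
    mapping_out (curve_hull gamma t) t (g t) ;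
  loewner_curve_driving0 : W 0 = 0 ;
  loewner_curve_driving : forall t, times T t ->
    g t z @[z --> within (@upper_half_plane R `\` curve_hull gamma t)
                         (nbhs (gamma t))] --> ((W t)%:C : R[i]^o) ;
  loewner_curve_marked0 : x 0 = x0 ;
  loewner_curve_marked : forall t, times T t ->
    g t z @[z --> within (@upper_half_plane R `\` curve_hull gamma t)
                         (nbhs (x0%:C : R[i]^o))] --> ((x t)%:C : R[i]^o) }.

(* The infimum is taken in [\bar R], so [tau T W x e = +oo] when the distance
   |W_t - x_t| stays above [e] on (0, T). *)
Definition tau (R : realType) (T : \bar R) (W x : R -> R) (e : R) : \bar R :=
  ereal_inf (EFin @` [set t | times T t /\ `|W t - x t| <= e]).

Record class_XC (R : realType) (x0 : R) (T : \bar R)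
    (gamma : R -> R[i]^o) (g : R -> R[i]^o -> R[i]^o) (W x : R -> R) : Prop :=
  ClassXC {
  class_XC_curve : loewner_curve x0 T gamma g W x ;
  class_XC_maximal : tau T W x e @[e --> 0^'+] --> T }.

Definition abs_continuous (R : realType) (a b : R) (f : R -> R) : Prop :=
  forall e : R, 0 < e -> exists2 d : R, 0 < d &
    forall (n : nat) (u v : 'I_n -> R),
      (forall i, a <= u i /\ u i <= v i /\ v i <= b) ->
      trivIset setT (fun i => [set` `]u i, v i[]) ->
      \sum_(i < n) (v i - u i) < d ->
      \sum_(i < n) `|f (v i) - f (u i)| < e.

(* [derive1 W] is the true derivative almost everywhere in the first branch; its
   values at the other points do not affect the integral. *)
Definition rho_loewner_energy (R : realType) (rho : R) (T : \bar R)
    (W x : R -> R) : \bar R :=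
  if `[< forall a b : R, 0 <= a -> a <= b -> (b%:E < T)%E ->
           abs_continuous a b W >]
  then ((2^-1)%:E * \int[@lebesgue_measure R]_(t in times T)
          ((derive1 W t - rho / (W t - x t)) ^+ 2)%:E)%E
  else +oo%E.

Definition cone (R : realType) (am ap : R) : set R[i]^o :=
  [set z | exists r theta : R,
    [/\ 0 < r, am * pi < theta, theta < ap * pi
      & z = r%:C * (cos theta +i* sin theta)] ].

(* Main.v *)
Require Import Defs.
From HB Require Import structures.
From mathcomp Require Import all_boot all_order all_algebra.
From mathcomp Require Import all_classical all_reals all_analysis.
From mathcomp Require Import complex.
From mathcomp Require Import ring lra.
Import Order.TTheory GRing.Theory Num.Theory.
Import numFieldNormedType.Exports.
Local Open Scope classical_set_scope.
Local Open Scope ring_scope.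
Local Open Scope complex_scope.
Local Notation Re := complex.Re.
Local Notation Im := complex.Im.

(** Write $y_t=x_t-W_t$, $a=2/(2+\rho)$ and $v_t=W_t-a y_t$. At zero energy $\dot W=-\rho/y$, and
    then $\dot v=2/(v-W)$: the point $v_t$ is carried by the Loewner flow, just like $x_t$. For
    fixed $z$ put $\theta_1=\arg(g_r(z)-x_r)$ and $\theta_2=\arg(g_r(z)-v_r)$. A computation shows
    that $N_r=(2+\rho)(\theta_1-\pi)+2\theta_2$ is then constant in $r$. Take $z=\gamma(t)$. As
    $r\uparrow t$ the difference $g_r(z)-W_r$ tends to 0, so $\theta_1\to\pi$, $\theta_2\to 0$ and
    $N_r\to 0$. Hence $N_s=0$ at every earlier time $s$. If $z$ is far away, both angles at time $s$
    are close to $\arg z$, so $(4+\rho)\arg z$ is close to $(2+\rho)\pi$, which is the claim.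

    For finite energy, choose $s$ so late that little energy remains after it, and let $f=\dot
    W-\rho/(W-x)$. Three functions change in a controlled way. In each case the derivative is a term
    linear in $f$ plus a term of good sign that absorbs it by AM-GM ([quad_ge]), at the cost of a
    constant times $f^2$; [ac_ge] integrates such bounds for absolutely continuous $W$. From $\ln y$
    ([ln_gap]) one gets a positive lower bound for $y$ ([marked_lower]). From a truncation of
    $|g_r(z)-v_r|^2/y_r^2$ ([relu2_gap]) one gets $|g_r(z)-v_r|\ge (a/4)y_r$ before the tip is
    reached. From $\pm N-\beta\theta_2$ with small $\beta>0$ ([angle_gap]) one gets that $|N_s|$ is
    small, uniformly over all later tips ([angle_small]). A comparison of arguments of far points
    ([angle_near]) concludes.

    The definition of the curve gives conformal maps with an expansion at infinity, so Loewner's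
    differential equation has to be derived. Goursat's theorem in log-polar coordinates gives a mean
    value inequality and a maximum principle. These give the Schwarz-Pick inequality between a
    proper injective map and an arbitrary map into the half-plane ([schwarz_pick]). Letting its base
    point go to infinity along the imaginary axis gives two forms of Julia's lemma ([julia_id],
    [julia_decay]). Applied to two maps of the chain, to a Joukowski map and to auxiliary products,
    they yield the one-step estimate [lp_increment], and from it the right derivative [gmap_rderiv].
    The behaviour at the tip ([tip]) and at the marked boundary point ([marked_local]) follows by
    following nearby interior points. *)

(** * Modulus and coordinates of complex numbers *)

Definition cabs {R : realType} (z : R[i]) : R := ComplexField.Normc.normc z.


Lemma normE {R : realType} (z : R[i]) : `|z| = (cabs z)%:C.
Proof. by rewrite normc_def; case: z. Qed.

Lemma cabs_ge0 {R : realType} (z : R[i]) : 0 <= cabs z.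
Proof. by case: z => a b; exact: sqrtr_ge0. Qed.

Lemma cabsM {R : realType} (z w : R[i]) : cabs (z * w) = cabs z * cabs w.
Proof. exact: ComplexField.Normc.normcM. Qed.

Lemma cabsV {R : realType} (z : R[i]) : cabs z^-1 = (cabs z)^-1.
Proof. exact: ComplexField.Normc.normcV. Qed.

Lemma cabsD {R : realType} (z w : R[i]) : cabs (z + w) <= cabs z + cabs w.
Proof. exact: le_normcD. Qed.

Lemma cabsN {R : realType} (z : R[i]) : cabs (- z) = cabs z.
Proof. by case: z => a b; rewrite /cabs/= !sqrrN. Qed.

Lemma cabsB {R : realType} (z w : R[i]) : cabs (z - w) <= cabs z + cabs w.
Proof. by rewrite -(cabsN w) cabsD. Qed.

Lemma cabsC {R : realType} (z w : R[i]) : cabs (z - w) = cabs (w - z).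
Proof. by rewrite -cabsN opprB. Qed.

Lemma cabs0 {R : realType} : cabs (0 : R[i]) = 0.
Proof. exact: ComplexField.Normc.normc0. Qed.

Lemma cabs_eq0 {R : realType} (z : R[i]) : (cabs z == 0) = (z == 0).
Proof.
by apply/eqP/eqP => [/ComplexField.Normc.eq0_normc//|->]; rewrite cabs0.
Qed.

Lemma cabs_gt0 {R : realType} (z : R[i]) : (0 < cabs z) = (z != 0).
Proof. by rewrite lt0r cabs_eq0 cabs_ge0 andbT. Qed.

Lemma cabs_sqr {R : realType} (z : R[i]) : cabs z ^+ 2 = Re z ^+ 2 + Im z ^+ 2.
Proof. by case: z => a b; rewrite sqr_sqrtr// addr_ge0// sqr_ge0. Qed.

Lemma cabs_real {R : realType} (a : R) : cabs a%:C = `|a|.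
Proof. by rewrite /cabs/= expr0n/= addr0 sqrtr_sqr. Qed.

Lemma Re_le_cabs {R : realType} (z : R[i]) : `|Re z| <= cabs z.
Proof.
rewrite -[leLHS]sqrtr_sqr; case: z => a b /=.
by rewrite ler_wsqrtr// lerDl sqr_ge0.
Qed.

Lemma Im_le_cabs {R : realType} (z : R[i]) : `|Im z| <= cabs z.
Proof.
rewrite -[leLHS]sqrtr_sqr; case: z => a b /=.
by rewrite ler_wsqrtr// lerDr sqr_ge0.
Qed.

Lemma cabs_le_ReIm {R : realType} (z : R[i]) : cabs z <= `|Re z| + `|Im z|.
Proof.
rewrite -(@ler_pXn2r _ 2%N)// ?nnegrE ?cabs_ge0 ?addr_ge0// cabs_sqr.
rewrite sqrrD !real_normK ?num_real// lerD2r lerDl.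
by rewrite mulrn_wge0// mulr_ge0.
Qed.

Lemma cabs_leD {R : realType} (z w : R[i]) : cabs z <= cabs w + cabs (z - w).
Proof. by rewrite (le_trans _ (cabsD _ _))// addrC subrK. Qed.

Lemma le_cabsB {R : realType} (z w : R[i]) : cabs z - cabs w <= cabs (z - w).
Proof. by rewrite lerBlDl cabs_leD. Qed.

Lemma cabs_trans {R : realType} (u z w : R[i]) :
  cabs (z - w) <= cabs (z - u) + cabs (u - w).
Proof. by rewrite (le_trans _ (cabsD _ _))// addrA subrK. Qed.

Lemma cReM {R : realType} (z w : R[i]) : Re (z * w) = Re z * Re w - Im z * Im w.
Proof. by case: z w => a b [c d]. Qed.

Lemma cImM {R : realType} (z w : R[i]) : Im (z * w) = Re z * Im w + Im z * Re w.
Proof. by case: z w => a b [c d]. Qed.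

Lemma cReV {R : realType} (z : R[i]) : Re z^-1 = Re z / cabs z ^+ 2.
Proof. by rewrite cabs_sqr; case: z => a b. Qed.

Lemma cImV {R : realType} (z : R[i]) : Im z^-1 = - Im z / cabs z ^+ 2.
Proof. by rewrite cabs_sqr; case: z => a b /=; rewrite mulNr. Qed.

Lemma complexP {R : realType} (z w : R[i]) :
  Re z = Re w -> Im z = Im w -> z = w.
Proof. by case: z w => a b [c d] /= -> ->. Qed.

Lemma cReD {R : realType} (z w : R[i]) : Re (z + w) = Re z + Re w.
Proof. by case: z w => a b []. Qed.

Lemma cImD {R : realType} (z w : R[i]) : Im (z + w) = Im z + Im w.
Proof. by case: z w => a b []. Qed.

Lemma cReN {R : realType} (z : R[i]) : Re (- z) = - Re z.
Proof. by case: z. Qed.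

Lemma cImN {R : realType} (z : R[i]) : Im (- z) = - Im z.
Proof. by case: z. Qed.

Lemma cReB {R : realType} (z w : R[i]) : Re (z - w) = Re z - Re w.
Proof. by rewrite cReD cReN. Qed.

Lemma cImB {R : realType} (z w : R[i]) : Im (z - w) = Im z - Im w.
Proof. by rewrite cImD cImN. Qed.

(** * Epsilon-delta continuity and integrals over segments *)

Definition econt {R : realType} (A : set R) (f : R -> R) :=
  forall x, A x -> forall e, 0 < e -> exists2 d, 0 < d &
    forall y, A y -> `|y - x| < d -> `|f y - f x| < e.

Lemma econtP {R : realType} (A : set R) (f : R -> R) :
  {within A, continuous f} <-> econt A f.
Proof.
rewrite subspace_continuousP; split=> [cf x Ax e e0|cf x Ax].
  move/cvgrPdist_lt : (cf x Ax) => /(_ e e0); rewrite near_withinE.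
  move=> /nbhs_ballP[d /= d0 xd]; exists d => // y Ay yx.
  by rewrite distrC; apply: xd => //; rewrite /ball/= distrC.
apply/cvgrPdist_lt => e e0; rewrite near_withinE.
have [d d0 xd] := cf x Ax e e0.
apply/nbhs_ballP; exists d => //= y; rewrite /ball/= => xy Ay.
by rewrite distrC; apply: xd => //; rewrite distrC.
Qed.

Lemma econtB {R : realType} (A : set R) (f g : R -> R) :
  econt A f -> econt A g -> econt A (fun x => f x - g x).
Proof.
move=> cf cg x Ax e e0; have e20 : 0 < e / 2 by rewrite divr_gt0.
have [d d0 fd] := cf x Ax _ e20; have [d' d'0 gd] := cg x Ax _ e20.
exists (Num.min d d') => [|y Ay]; first by rewrite lt_min d0.
rewrite lt_min => /andP[/(fd _ Ay) h1 /(gd _ Ay) h2].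
rewrite (_ : _ - _ = (f y - f x) - (g y - g x)); last by ring.
by rewrite (le_lt_trans (ler_normB _ _))// (splitr e) ltrD.
Qed.

Lemma econtS {R : realType} (A B : set R) (f : R -> R) :
  B `<=` A -> econt A f -> econt B f.
Proof.
move=> BA cf x Bx e e0; have [d d0 fd] := cf x (BA _ Bx) e e0.
by exists d => // y By; apply: fd; exact: BA.
Qed.

Definition integ {R : realType} (a b : R) (f : R -> R) : R :=
  \int[@lebesgue_measure R]_(x in `[a, b]) f x.

Lemma econt_integrable {R : realType} (a b : R) (f : R -> R) :
  econt `[a, b] f ->
  (@lebesgue_measure R).-integrable `[a, b] (EFin \o f).
Proof.
move=> /econtP cf; apply: continuous_compact_integrable => //.
exact: segment_compact.
Qed.

Lemma integB {R : realType} (a b : R) (f g : R -> R) :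
  econt `[a, b] f -> econt `[a, b] g ->
  integ a b (fun x => f x - g x) = integ a b f - integ a b g.
Proof. by move=> cf cg; rewrite /integ RintegralB//; exact: econt_integrable. Qed.

Lemma integ_cat {R : realType} (a b c : R) (f : R -> R) :
  a <= b -> b <= c -> econt `[a, c] f ->
  integ a c f = integ a b f + integ b c f.
Proof.
move=> ab bc cf; have iac := econt_integrable _ _ _ cf.
have := @Rintegral_itvB R f (BLeft a) (BRight c) b iac.
rewrite !bnd_simp => /(_ ab bc) e.
rewrite /integ -[in X in _ + X]Rintegral_itv_obnd_cbnd; last first.
  apply: (integrableS _ _ _ iac) => //; rewrite ?bnd_simp.
  by apply: subset_itvr; rewrite bnd_simp.
by rewrite -e addrC subrK.
Qed.

Lemma integ_cst {R : realType} (a b c : R) : a <= b ->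
  integ a b (fun=> c) = c * (b - a).
Proof.
move=> ab; rewrite /integ Rintegral_cst//= lebesgue_measure_itv/= lte_fin.
by case: ltgtP ab => //= -> _; rewrite subrr.
Qed.

Lemma integ_le {R : realType} (a b : R) (f g : R -> R) :
  econt `[a, b] f -> econt `[a, b] g ->
  (forall x, a <= x <= b -> f x <= g x) -> integ a b f <= integ a b g.
Proof.
move=> cf cg fg; apply: le_Rintegral => //; do ?exact: econt_integrable.
Qed.

Lemma econt_cst {R : realType} (A : set R) (c : R) : econt A (fun=> c).
Proof. by move=> x _ e e0; exists 1 => // y _ _; rewrite subrr normr0. Qed.

Lemma integ_dist {R : realType} (a b c M : R) (f : R -> R) : a <= b ->
  econt `[a, b] f -> (forall x, a <= x <= b -> `|f x - c| <= M) ->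
  `|integ a b f - c * (b - a)| <= M * (b - a).
Proof.
move=> ab cf fM; rewrite ler_distl -mulrBl -mulrDl.
rewrite -(integ_cst a b (c - M) ab) -(integ_cst a b (c + M) ab).
apply/andP; split; apply: integ_le => //; try exact: econt_cst;
  by move=> x /fM; rewrite ler_distl => /andP[].
Qed.

(** * Goursat's theorem on rectangles *)

(** Real differentiability of $P+iQ$ whose linear part is multiplication by $\alpha+i\beta$: the
    Cauchy-Riemann equations are built into its shape. *)
Definition cr_at {R : realType} (P Q : R -> R -> R) (s t : R) :=
  exists alpha beta : R, forall e, 0 < e -> exists2 d, 0 < d &
    forall s' t', `|s' - s| < d -> `|t' - t| < d ->
    `|P s' t' - P s t - (alpha * (s' - s) - beta * (t' - t))| <=
      e * (`|s' - s| + `|t' - t|) /\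
    `|Q s' t' - Q s t - (beta * (s' - s) + alpha * (t' - t))| <=
      e * (`|s' - s| + `|t' - t|).

Lemma cr_at_cont {R : realType} (P Q : R -> R -> R) (s t : R) :
  cr_at P Q s t -> forall e, 0 < e -> exists2 d, 0 < d &
    forall s' t', `|s' - s| < d -> `|t' - t| < d ->
    `|P s' t' - P s t| < e /\ `|Q s' t' - Q s t| < e.
Proof.
move=> [al [be /(_ 1 ltr01)[d d0 H]]] e e0.
pose M := `|al| + `|be| + 1.
have M0 : 0 < M by rewrite ltr_wpDl// addr_ge0.
exists (Num.min d (e / (2 * M))) => [|s' t'].
  by rewrite lt_min d0 divr_gt0// mulr_gt0.
rewrite !lt_min => /andP[sd sM] /andP[td tM].
move: sM tM; rewrite !ltr_pdivlMr ?mulr_gt0// => sM tM.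
have [h1 h2] := H _ _ sd td.
have hM : M * (`|s' - s| + `|t' - t|) < e by lra.
have a1 : `|al * (s' - s)| <= `|al| * (`|s' - s| + `|t' - t|).
  by rewrite normrM ler_wpM2l// lerDl.
have a2 : `|be * (t' - t)| <= `|be| * (`|s' - s| + `|t' - t|).
  by rewrite normrM ler_wpM2l// lerDr.
have a3 : `|be * (s' - s)| <= `|be| * (`|s' - s| + `|t' - t|).
  by rewrite normrM ler_wpM2l// lerDl.
have a4 : `|al * (t' - t)| <= `|al| * (`|s' - s| + `|t' - t|).
  by rewrite normrM ler_wpM2l// lerDr.
split; apply: le_lt_trans hM.
- rewrite -[X in `|X|](subrK (al * (s' - s) - be * (t' - t))).
  rewrite (le_trans (ler_normD _ _))//.
  have := ler_normB (al * (s' - s)) (be * (t' - t)); rewrite /M; lra.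
- rewrite -[X in `|X|](subrK (be * (s' - s) + al * (t' - t))).
  rewrite (le_trans (ler_normD _ _))//.
  have := ler_normD (be * (s' - s)) (al * (t' - t)); rewrite /M; lra.
Qed.

Definition cr_rect {R : realType} (P Q : R -> R -> R) (s1 s2 t1 t2 : R) :=
  forall s t, s1 <= s <= s2 -> t1 <= t <= t2 -> cr_at P Q s t.

Lemma cr_rect_contP {R : realType} (P Q : R -> R -> R) (s1 s2 t1 t2 s : R) :
  cr_rect P Q s1 s2 t1 t2 -> s1 <= s <= s2 -> econt `[t1, t2] (P s).
Proof.
move=> H hs t; rewrite /= in_itv/= => ht e e0.
have [d d0 D] := cr_at_cont _ _ _ _ (H _ _ hs ht) _ e0.
exists d => // t' _ tt'; by apply: (D s t' _ tt').1; rewrite subrr normr0.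
Qed.

Lemma cr_rect_contQ {R : realType} (P Q : R -> R -> R) (s1 s2 t1 t2 t : R) :
  cr_rect P Q s1 s2 t1 t2 -> t1 <= t <= t2 -> econt `[s1, s2] (Q ^~ t).
Proof.
move=> H ht s; rewrite /= in_itv/= => hs e e0.
have [d d0 D] := cr_at_cont _ _ _ _ (H _ _ hs ht) _ e0.
exists d => // s' _ ss'; by apply: (D s' t ss' _).2; rewrite subrr normr0.
Qed.

Lemma cr_rectS {R : realType} (P Q : R -> R -> R) (s1 s2 t1 t2 s3 s4 t3 t4 : R) :
  cr_rect P Q s1 s2 t1 t2 -> s1 <= s3 -> s4 <= s2 -> t1 <= t3 -> t4 <= t2 ->
  cr_rect P Q s3 s4 t3 t4.
Proof.
move=> H a b c d s t /andP[u v] /andP[x y]; apply: H.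
  by rewrite (le_trans a)// (le_trans v).
by rewrite (le_trans c)// (le_trans y).
Qed.

(** The imaginary part of the counterclockwise contour integral of $(P+iQ)(ds+i\,dt)$ around the
    rectangle. *)
Definition bdry {R : realType} (P Q : R -> R -> R) (s1 s2 t1 t2 : R) :=
  integ t1 t2 (fun t => P s2 t - P s1 t) - integ s1 s2 (fun s => Q s t2 - Q s t1).

Lemma bdry_splits {R : realType} (P Q : R -> R -> R) (s1 s s2 t1 t2 : R) :
  s1 <= s -> s <= s2 -> t1 <= t2 -> cr_rect P Q s1 s2 t1 t2 ->
  bdry P Q s1 s2 t1 t2 = bdry P Q s1 s t1 t2 + bdry P Q s s2 t1 t2.
Proof.
move=> a b c H; rewrite /bdry (integ_cat s1 s s2)//; last first.
  by apply: econtB; apply: cr_rect_contQ H _; rewrite lexx ?c.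
have k x : s1 <= x <= s2 -> econt `[t1, t2] (P x).
  by move=> hx; apply: cr_rect_contP H _.
rewrite (integB t1 t2 (P s2) (P s1)) ?(integB t1 t2 (P s) (P s1)).
  rewrite (integB t1 t2 (P s2) (P s)); first by ring.
all: by apply: k; rewrite ?lexx ?a ?b ?(le_trans a b).
Qed.

Lemma bdry_splitt {R : realType} (P Q : R -> R -> R) (s1 s2 t1 t t2 : R) :
  s1 <= s2 -> t1 <= t -> t <= t2 -> cr_rect P Q s1 s2 t1 t2 ->
  bdry P Q s1 s2 t1 t2 = bdry P Q s1 s2 t1 t + bdry P Q s1 s2 t t2.
Proof.
move=> c a b H; rewrite /bdry (integ_cat t1 t t2)//; last first.
  by apply: econtB; apply: cr_rect_contP H _; rewrite lexx ?c.
have k x : t1 <= x <= t2 -> econt `[s1, s2] (Q^~ x).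
  by move=> hx; apply: cr_rect_contQ H _.
rewrite (integB s1 s2 (Q^~ t2) (Q^~ t1)) ?(integB s1 s2 (Q^~ t) (Q^~ t1)).
  rewrite (integB s1 s2 (Q^~ t2) (Q^~ t)); first by ring.
all: by apply: k; rewrite ?lexx ?a ?b ?(le_trans a b).
Qed.

(** The linear parts contribute $\alpha ST$ to both integrals and cancel; what remains is the
    differentiability error times the side lengths. *)
Lemma bdry_small {R : realType} (P Q : R -> R -> R) (s t e : R) :
  0 < e -> cr_at P Q s t -> exists2 d, 0 < d &
  forall s1 s2 t1 t2, s1 <= s <= s2 -> t1 <= t <= t2 -> s2 - s1 < d ->
    t2 - t1 < d -> cr_rect P Q s1 s2 t1 t2 ->
    `|bdry P Q s1 s2 t1 t2| <= e * ((s2 - s1) + (t2 - t1)) ^+ 2.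
Proof.
move=> e0 [al [be H]]; have [|d d0 D] := H (e / 2); first by rewrite divr_gt0.
exists d => // s1 s2 t1 t2 /andP[h1 h2] /andP[h3 h4] h5 h6 H'.
have s12 : s1 <= s2 by exact: le_trans h2.
have t12 : t1 <= t2 by exact: le_trans h4.
have near s' t' : s1 <= s' <= s2 -> t1 <= t' <= t2 ->
    [/\ `|s' - s| < d, `|t' - t| < d &
    e / 2 * (`|s' - s| + `|t' - t|) <= e / 2 * ((s2 - s1) + (t2 - t1))].
  move=> /andP[a1 a2] /andP[a3 a4].
  have b1 : `|s' - s| <= s2 - s1 by rewrite ler_norml; lra.
  have b2 : `|t' - t| <= t2 - t1 by rewrite ler_norml; lra.
  split; [exact: le_lt_trans h5 | exact: le_lt_trans h6 |].
  by rewrite ler_wpM2l ?lerD// divr_ge0// ltW.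
set S := s2 - s1 in near *; set T := t2 - t1 in near *.
have S0 : 0 <= S by rewrite subr_ge0.
have T0 : 0 <= T by rewrite subr_ge0.
have i1 : `|integ t1 t2 (fun t => P s2 t - P s1 t) - al * S * T| <=
    e * (S + T) * T.
  apply: integ_dist => //.
    by apply: econtB; apply: cr_rect_contP H' _; rewrite lexx ?s12.
  move=> x hx.
  have [||n1 n2 n3] := near s1 x; rewrite ?lexx ?s12 ?hx//.
  have [||n4 n5 n6] := near s2 x; rewrite ?lexx ?s12 ?hx//.
  have [+ _] := D _ _ n1 n2; have [+ _] := D _ _ n4 n5.
  rewrite (_ : al * S = al * (s2 - s) - al * (s1 - s)); last by rewrite /S; ring.
  rewrite !ler_norml => /andP[? ?] /andP[? ?]; apply/andP; split; lra.
have i2 : `|integ s1 s2 (fun s => Q s t2 - Q s t1) - al * T * S| <=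
    e * (S + T) * S.
  apply: integ_dist => //.
    by apply: econtB; apply: cr_rect_contQ H' _; rewrite lexx ?t12.
  move=> x hx.
  have [||n1 n2 n3] := near x t1; rewrite ?lexx ?t12 ?hx//.
  have [||n4 n5 n6] := near x t2; rewrite ?lexx ?t12 ?hx//.
  have [_ +] := D _ _ n1 n2; have [_ +] := D _ _ n4 n5.
  rewrite (_ : al * T = al * (t2 - t) - al * (t1 - t)); last by rewrite /T; ring.
  rewrite !ler_norml => /andP[? ?] /andP[? ?]; apply/andP; split; lra.
rewrite /bdry; move: i1 i2; rewrite !ler_norml.
by move=> /andP[? ?] /andP[? ?]; apply/andP; split; lra.
Qed.

Lemma half_expn_small {R : realType} (d : R) : 0 < d ->
  exists n, 2^-1 ^+ n < d.
Proof.
move=> d0; have [n nd] : exists n, d^-1 < n%:R.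
  by exists (Num.bound d^-1); rewrite archi_boundP// invr_ge0 ltW.
exists n; rewrite exprVn -[ltRHS]invrK ltf_pV2 ?posrE ?invr_gt0 ?exprn_gt0//.
by rewrite (lt_le_trans nd)// -natrX ler_nat ltnW// ltn_expl.
Qed.

Lemma nested_intervals {R : realType} (a l : nat -> R) :
  (forall n, 0 <= l n) -> (forall n, a n <= a n.+1) ->
  (forall n, a n.+1 + l n.+1 <= a n + l n) ->
  exists x, forall n, a n <= x <= a n + l n.
Proof.
move=> l0 a1 al.
have ai n m : (n <= m)%N -> a n <= a m.
  by move=> /subnK <-; elim: (m - n)%N => // k ih; exact: le_trans (a1 _).
have bi n m : (n <= m)%N -> a m + l m <= a n + l n.
  by move=> /subnK <-; elim: (m - n)%N => // k; exact: le_trans (al _).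
have ub n m : a m <= a n + l n.
  have [/ai nm|/ltnW/bi nm] := leqP m n.
    by rewrite (le_trans nm)// lerDl.
  by rewrite (le_trans _ nm)// lerDl.
exists (sup (range a)) => n; apply/andP; split.
  apply: ub_le_sup; last by exists n.
  by exists (a 0%N + l 0%N) => _ [m _ <-].
apply: ge_sup; first by exists (a 0%N), 0%N.
by move=> _ [m _ <-].
Qed.

(** Bisection: if the contour integral is not 0, one of four quarters keeps the ratio of integral to
    area above [k]. The nested quarters shrink to a point where [bdry_small] contradicts this
    ratio. *)
Lemma goursat {R : realType} (P Q : R -> R -> R) (s1 s2 t1 t2 : R) :
  s1 < s2 -> t1 < t2 -> cr_rect P Q s1 s2 t1 t2 -> bdry P Q s1 s2 t1 t2 = 0.
Proof.
move=> s12 t12 H; apply/eqP; rewrite -normr_eq0; apply/negPn/negP => bN0.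
have b0 : 0 < `|bdry P Q s1 s2 t1 t2| by rewrite lt0r bN0 normr_ge0.
pose S := s2 - s1; pose T := t2 - t1; pose c n : R := 2^-1 ^+ n.
have S0 : 0 < S by rewrite subr_gt0.
have T0 : 0 < T by rewrite subr_gt0.
have c0 n : 0 < c n by rewrite exprn_gt0.
have cS n : c n = c n.+1 + c n.+1 by rewrite /c exprS; lra.
(* The factor 2 makes the invariant strict for the initial rectangle. *)
pose k := `|bdry P Q s1 s2 t1 t2| / (2 * (S * T)).
have k0 : 0 < k by rewrite divr_gt0// !mulr_gt0.
pose inv n (p : R * R) := [/\ s1 <= p.1, p.1 + S * c n <= s2, t1 <= p.2,
  p.2 + T * c n <= t2 & k * ((S * c n) * (T * c n)) <
    `|bdry P Q p.1 (p.1 + S * c n) p.2 (p.2 + T * c n)|].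
pose nxt n (p q : R * R) := [/\ p.1 <= q.1, q.1 + S * c n.+1 <= p.1 + S * c n,
  p.2 <= q.2 & q.2 + T * c n.+1 <= p.2 + T * c n].
have step n p : inv n p -> exists q, inv n.+1 q /\ nxt n p q.
  case: p => s t [/= i1 i2 i3 i4 i5].
  set l := S * c n.+1; set h := T * c n.+1.
  have l0 : 0 < l by rewrite mulr_gt0.
  have h0 : 0 < h by rewrite mulr_gt0.
  have El : S * c n = l + l by rewrite /l cS mulrDr.
  have Eh : T * c n = h + h by rewrite /h cS mulrDr.
  rewrite El in i2 i5; rewrite Eh in i4 i5.
  have HR : cr_rect P Q s (s + (l + l)) t (t + (h + h)) by exact: cr_rectS H _ _ _ _.
  have E : bdry P Q s (s + (l + l)) t (t + (h + h)) =
     (bdry P Q s (s + l) t (t + h) + bdry P Q s (s + l) (t + h) (t + h + h)) +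
     (bdry P Q (s + l) (s + l + l) t (t + h) +
      bdry P Q (s + l) (s + l + l) (t + h) (t + h + h)).
    rewrite (bdry_splits _ _ s (s + l))//; try lra.
    rewrite (bdry_splitt _ _ s (s + l) t (t + h))//; try lra; last first.
      by apply: cr_rectS HR _ _ _ _ => //; lra.
    rewrite (bdry_splitt _ _ (s + l) _ t (t + h))//; try lra; last first.
      by apply: cr_rectS HR _ _ _ _ => //; lra.
    by rewrite !addrA.
  apply: contrapT => no.
  have small u v : (u = s \/ u = s + l) -> (v = t \/ v = t + h) ->
      `|bdry P Q u (u + l) v (v + h)| <= k * (l * h).
    move=> hu hv; rewrite leNgt; apply/negP => bad; apply: no.
    exists (u, v); split; last first.
      rewrite /nxt /= -/l -/h El Eh.
      by case: hu => ->; case: hv => ->; split; lra.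
    rewrite /inv /= -/l -/h.
    by case: hu => Eu; case: hv => Ev; split=> //; rewrite ?Eu ?Ev; lra.
  have := small s t (or_introl erefl) (or_introl erefl).
  have := small s (t + h) (or_introl erefl) (or_intror erefl).
  have := small (s + l) t (or_intror erefl) (or_introl erefl).
  have := small (s + l) (t + h) (or_intror erefl) (or_intror erefl).
  move: i5; rewrite E.
  set x1 := bdry _ _ _ _ _ _; set x2 := bdry _ _ _ _ _ _.
  set x3 := bdry _ _ _ _ _ _; set x4 := bdry _ _ _ _ _ _.
  have := ler_normD (x1 + x2) (x3 + x4).
  have := ler_normD x1 x2; have := ler_normD x3 x4.
  have -> : k * ((l + l) * (h + h)) = 4 * (k * (l * h)) by ring.
  lra.
(* The default [p] is never taken along the sequence, since [step] supplies a successor. *)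
pose f n p := if pselect (exists q, inv n.+1 q /\ nxt n p q) is left e
  then sval (cid e) else p.
pose u := fix u n := if n is m.+1 then f m (u m) else (s1, t1).
have invu n : inv n (u n).
  elim: n => [|n ih].
    rewrite /inv /= /c expr0 !mulr1 /S /T !(addrC _ (_ - _)) !subrK; split=> //.
    rewrite /k -/S -/T -mulrA -[ltRHS]mulr1 ltr_pM2l// invfM -mulrA mulVf.
      by rewrite mulr1 invf_lt1// ltr1n.
    by rewrite mulf_neq0// gt_eqF.
  rewrite /= /f; case: pselect => [e|]; first by case: (cid e) => q [].
  by move=> /(_ (step _ _ ih)).
have nxtu n : nxt n (u n) (u n.+1).
  rewrite /= /f; case: pselect => [e|]; first by case: (cid e) => q [].
  by move=> /(_ (step _ _ (invu n))).
have [x hx] := nested_intervals (fun n => (u n).1) (fun n => S * c n)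
  (fun n => ltW (mulr_gt0 S0 (c0 n))) (fun n => let: And4 a _ _ _ := nxtu n in a)
  (fun n => let: And4 _ a _ _ := nxtu n in a).
have [y hy] := nested_intervals (fun n => (u n).2) (fun n => T * c n)
  (fun n => ltW (mulr_gt0 T0 (c0 n))) (fun n => let: And4 _ _ a _ := nxtu n in a)
  (fun n => let: And4 _ _ _ a := nxtu n in a).
have cxy : cr_at P Q x y.
  have := hx 0%N; have := hy 0%N; rewrite /= /c expr0 !mulr1 => h1 h2.
  by apply: H; [move: h2|move: h1]; rewrite /S /T addrC subrK.
have ST0 : 0 < S + T by rewrite addr_gt0.
have e0 : 0 < k * (S * T) / (S + T) ^+ 2.
  exact: divr_gt0 (mulr_gt0 k0 (mulr_gt0 S0 T0)) (exprn_gt0 _ ST0).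
have [d d0 D] := bdry_small _ _ _ _ _ e0 cxy.
have [n nd] := half_expn_small (d / (S + T)) (divr_gt0 d0 ST0).
rewrite ltr_pdivlMr// -/(c n) in nd.
have [i1 i2 i3 i4] := invu n; apply/negP; rewrite -leNgt.
have cS0 := mulr_gt0 S0 (c0 n); have cT0 := mulr_gt0 T0 (c0 n).
have HR : cr_rect P Q (u n).1 ((u n).1 + S * c n) (u n).2 ((u n).2 + T * c n).
  exact: (cr_rectS _ _ _ _ _ _ _ _ _ _ H i1 i2 i3 i4).
have E1 : (u n).1 + S * c n - (u n).1 = S * c n by rewrite addrC addKr.
have E2 : (u n).2 + T * c n - (u n).2 = T * c n by rewrite addrC addKr.
have := D _ _ _ _ (hx n) (hy n); rewrite E1 E2 => D'.
apply: (le_trans (D' _ _ HR)); [lra|lra|].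
by rewrite le_eqVlt; apply/orP; left; apply/eqP; field; lra.
Qed.

(** * Complex derivatives, the exponential and a mean value inequality *)

Lemma is_derive_eps {R : realType} (f : R -> R) (x d : R) :
  is_derive x 1 f d -> forall e, 0 < e -> exists2 r, 0 < r &
    forall h, `|h| < r -> `|f (x + h) - f x - d * h| <= e * `|h|.
Proof.
move=> [df <-] e e0.
have : h^-1 *: (f (h *: 1 + x) - f x) @[h --> 0^'] --> 'D_1 f x by [].
move/cvgrPdist_le => /(_ e e0)/nbhs_ballP[r /= r0 H].
exists r => // h hr; have [->|h0] := eqVneq h 0.
  by rewrite addr0 subrr mulr0 subr0 normr0 mulr0.
have /H : ball 0 r h by rewrite /ball/= sub0r normrN.
rewrite h0 => /(_ isT) /=; rewrite distrC [h%:A]mulr1 (addrC h) => H'.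
rewrite -ler_pdivrMr ?normr_gt0// -normfV -normrM.
rewrite (_ : _ * h^-1 = h^-1 *: (f (x + h) - f x) - 'D_1 f x)//.
by rewrite mulrBl mulfK// (mulrC _ h^-1).
Qed.

Definition cdiff {R : realType} (f : R[i] -> R[i]) (z d : R[i]) :=
  forall e : R, 0 < e -> exists2 r : R, 0 < r &
    forall w, cabs (w - z) < r ->
      cabs (f w - f z - d * (w - z)) <= e * cabs (w - z).

Definition ccont {R : realType} (f : R[i] -> R[i]) (z : R[i]) :=
  forall e : R, 0 < e -> exists2 r : R, 0 < r &
    forall w, cabs (w - z) < r -> cabs (f w - f z) < e.

Lemma cdiff_lip {R : realType} (f : R[i] -> R[i]) (z d : R[i]) : cdiff f z d ->
  exists2 r : R, 0 < r & forall w, cabs (w - z) < r ->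
    cabs (f w - f z) <= (cabs d + 1) * cabs (w - z).
Proof.
move=> /(_ 1 ltr01)[r r0 H]; exists r => // w /H h.
rewrite -[X in cabs X](subrK (d * (w - z))) (le_trans (cabsD _ _))//.
by rewrite cabsM mulrDl addrC lerD2l.
Qed.

Lemma cdiff_cont {R : realType} (f : R[i] -> R[i]) (z d : R[i]) :
  cdiff f z d -> ccont f z.
Proof.
move=> /cdiff_lip[r r0 H] e e0.
have c0 : 0 < cabs d + 1 by rewrite ltr_wpDl// cabs_ge0.
exists (Num.min r (e / (cabs d + 1))) => [|w].
  by rewrite lt_min r0 divr_gt0.
rewrite lt_min => /andP[/H h1]; rewrite ltr_pdivlMr// mulrC.
exact: le_lt_trans.
Qed.

Definition cexp {R : realType} (s t : R) : R[i] :=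
  (expR s * cos t) +i* (expR s * sin t).

Lemma cexpD {R : realType} (s t u v : R) :
  cexp (s + u) (t + v) = cexp s t * cexp u v.
Proof.
rewrite /cexp expRD cosD sinD; apply: complexP => /=; ring.
Qed.

Lemma cabs_cexp {R : realType} (s t : R) : cabs (cexp s t) = expR s.
Proof.
apply/eqP; rewrite -(@eqrXn2 _ 2%N)// ?cabs_ge0 ?expR_ge0//.
by rewrite cabs_sqr/= !exprMn -mulrDr cos2Dsin2 mulr1.
Qed.

Lemma cexp_near0 {R : realType} (e : R) : 0 < e -> exists2 r : R, 0 < r &
  forall u v, `|u| < r -> `|v| < r ->
    cabs (cexp u v - 1 - (u +i* v)) <= e * (`|u| + `|v|).
Proof.
move=> e0; have [k [k0 ke k1]] : exists k, [/\ 0 < k, k <= e / 10 & k <= 1].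
  exists (Num.min (e / 10) 1); rewrite lt_min divr_gt0//= ltr01.
  by rewrite !ge_min !lexx orbT.
have [r1 r10 H1] := is_derive_eps _ _ _ (is_derive_expR (0 : R)) _ k0.
have [r2 r20 H2] := is_derive_eps _ _ _ (is_derive_cos (0 : R)) _ k0.
have [r3 r30 H3] := is_derive_eps _ _ _ (is_derive_sin (0 : R)) _ k0.
exists (Num.min k (Num.min r1 (Num.min r2 r3))) => [|u v].
  by rewrite !lt_min k0 r10 r20.
rewrite !lt_min => /and4P[uk u1 _ _] /and4P[vk _ v2 v3].
have := H1 _ u1; have := H2 _ v2; have := H3 _ v3.
rewrite !add0r expR0 cos0 sin0 oppr0 mul0r subr0 !mul1r addr0.
set a := expR u - 1 - u; set b := cos v - 1; set c := sin v - v => hc hb ha.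
have v1 : `|v| <= k by exact: ltW.
have a1 : `|a| <= 1.
  have : k * `|u| <= k * 1 by rewrite ler_pM2l//; lra.
  lra.
have ua : `|1 + u + a| <= 3.
  rewrite (le_trans (ler_normD _ _))//.
  by have := ler_normD 1 u; rewrite normr1; lra.
have ua' : `|u + a| <= 2 * k.
  rewrite (le_trans (ler_normD _ _))//.
  have : k * `|u| <= k * 1 by rewrite ler_pM2l//; lra.
  lra.
have -> : cexp u v - 1 - (u +i* v) =
    (a + b * (1 + u + a)) +i* (c * (1 + u + a) + v * (u + a)).
  by apply: complexP; rewrite /= /a /b /c; ring.
rewrite (le_trans (cabs_le_ReIm _))//=.
have := ler_normD a (b * (1 + u + a)).
have := ler_normD (c * (1 + u + a)) (v * (u + a)).
rewrite !normrM.
have := ler_pM (normr_ge0 _) (normr_ge0 _) hb ua.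
have := ler_pM (normr_ge0 _) (normr_ge0 _) hc ua.
have := ler_wpM2l (normr_ge0 v) ua'.
have : k * `|u| <= e / 10 * `|u| by rewrite ler_wpM2r.
have : k * `|v| <= e / 10 * `|v| by rewrite ler_wpM2r.
have : 0 <= e * `|u| by rewrite mulr_ge0// ltW.
have : 0 <= e * `|v| by rewrite mulr_ge0// ltW.
lra.
Qed.

(** Chain rule for $f(a+e^{s+it})$, whose derivative is $d\,e^{s+it}$. In these log-polar
    coordinates a rectangle of height $2\pi$ covers an annulus around $a$. *)
Lemma cr_cexp {R : realType} (f : R[i] -> R[i]) (a d : R[i]) (s t : R) :
  cdiff f (a + cexp s t) d ->
  cr_at (fun s t => Re (f (a + cexp s t))) (fun s t => Im (f (a + cexp s t))) s t.
Proof.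
move=> df; pose D := d * cexp s t.
exists (Re D), (Im D) => e e0.
pose M := expR s * 2; have M0 : 0 < M by rewrite mulr_gt0// expR_gt0.
have cd0 : 0 <= cabs d := cabs_ge0 _.
pose k := e / (2 * (cabs d + 1) * M).
have k0 : 0 < k.
  by apply: divr_gt0 => //; apply: mulr_gt0 => //; apply: mulr_gt0 => //; lra.
have [k2 [k20 k2k k21]] : exists k2, [/\ 0 < k2, k2 <= k & k2 <= 1].
  exists (Num.min k 1); rewrite lt_min k0 ltr01.
  by rewrite !ge_min !lexx orbT.
have e20 : 0 < e / (2 * M) by rewrite divr_gt0// mulr_gt0.
have [r r0 H] := df _ e20; have [r' r'0 H'] := cexp_near0 _ k20.
exists (Num.min r' (r / (2 * M))) => [|s' t'].
  by rewrite lt_min r'0 divr_gt0// mulr_gt0.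
rewrite !lt_min => /andP[s1 s2] /andP[t1 t2].
have M20 : 0 < 2 * M by apply: mulr_gt0.
move: s2 t2; rewrite !(ltr_pdivlMr _ _ M20) => s2 t2.
set u := s' - s in s1 s2 *; set v := t' - t in t1 t2 *.
have := H' _ _ s1 t1; set E := cexp u v - 1 - _ => hE.
have Ew : a + cexp s' t' - (a + cexp s t) = cexp s t * (u +i* v + E).
  have -> : u +i* v + E = cexp u v - 1 by rewrite /E addrC subrK.
  have -> : cexp s' t' = cexp s t * cexp u v.
    by rewrite -cexpD /u /v (addrC s) (addrC t) !subrK.
  by ring.
set h := a + cexp s' t' - (a + cexp s t) in Ew.
have uvn : cabs (u +i* v) <= `|u| + `|v| by rewrite (le_trans (cabs_le_ReIm _)).
have uv0 : 0 <= `|u| + `|v| by rewrite addr_ge0.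
have hn : cabs h <= M * (`|u| + `|v|).
  rewrite Ew cabsM cabs_cexp /M -mulrA ler_pM2l ?expR_gt0//.
  rewrite (le_trans (cabsD _ _))//.
  have : k2 * (`|u| + `|v|) <= 1 * (`|u| + `|v|) by rewrite ler_wpM2r.
  lra.
have hr : cabs h < r by apply: (le_lt_trans hn); lra.
have := H _ hr; rewrite -/h => h1.
have fE : f (a + cexp s' t') - f (a + cexp s t) - D * (u +i* v) =
   (f (a + cexp s' t') - f (a + cexp s t) - d * h) + D * E.
  by rewrite Ew /D; ring.
have bound : cabs (f (a + cexp s' t') - f (a + cexp s t) - D * (u +i* v)) <=
    e * (`|u| + `|v|).
  rewrite fE (le_trans (cabsD _ _))//.
  have b1 : e / (2 * M) * cabs h <= e / 2 * (`|u| + `|v|).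
    rewrite (le_trans (ler_wpM2l (ltW e20) hn))// le_eqVlt; apply/orP; left.
    by apply/eqP; field; rewrite gt_eqF.
  have b2 : cabs (D * E) <= e / 2 * (`|u| + `|v|).
    rewrite cabsM /D cabsM cabs_cexp.
    apply: (@le_trans _ _ (cabs d * expR s * (k * (`|u| + `|v|)))).
      rewrite ler_wpM2l ?mulr_ge0 ?expR_ge0// (le_trans hE)//.
      by rewrite ler_wpM2r.
    rewrite mulrA ler_wpM2r// /k /M.
    have es0 := expR_gt0 s; have ed : 0 < cabs d + 1 by lra.
    rewrite (_ : cabs d * expR s * _ = e / 2 * (cabs d / (2 * (cabs d + 1)))).
      2: by field; rewrite !gt_eqF.
    rewrite ler_piMr ?divr_ge0 ?ltW// ltr_pdivrMr ?mulr_gt0 ?ltr_wpDl//.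
    by rewrite mul1r; lra.
  lra.
split; apply: le_trans bound.
- rewrite (_ : _ - _ - _ = Re (f (a + cexp s' t') - f (a + cexp s t) -
    D * (u +i* v))); first exact: Re_le_cabs.
  by rewrite !cReB (cReM D).
- rewrite (_ : _ - _ - _ = Im (f (a + cexp s' t') - f (a + cexp s t) -
    D * (u +i* v))); first exact: Im_le_cabs.
  by rewrite !cImB (cImM D)/= (addrC (Re D * _)).
Qed.

(** In log-polar coordinates the two [Q] sides of Goursat's identity cancel by periodicity, so the
    mean of Re f over a circle does not depend on the radius. Letting the inner circle shrink to
    [a], the mean over the outer one cannot stay below Re f(a). Continuity at the centre is enough,
    so a removable singularity may sit there. *)
Lemma circle_max_ge {R : realType} (f : R[i] -> R[i]) (a : R[i]) (r0 r : R) :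
  0 < r -> r < r0 -> ccont f a ->
  (forall z, 0 < cabs (z - a) -> cabs (z - a) < r0 -> exists d, cdiff f z d) ->
  exists z, cabs (z - a) = r /\ Re (f a) <= Re (f z).
Proof.
move=> r_gt0 rr0 fa df.
pose P s t := Re (f (a + cexp s t)); pose Q s t := Im (f (a + cexp s t)).
have aE s t : cabs (a + cexp s t - a) = expR s by rewrite addrC addKr cabs_cexp.
have crs s t : expR s < r0 -> cr_at P Q s t.
  move=> sr; have [||d dd] := df (a + cexp s t); rewrite ?aE ?expR_gt0//.
  exact: cr_cexp dd.
have pi2 : 0 < pi + pi :> R by rewrite addr_gt0 ?pi_gt0.
pose s2 := ln r; have s2E : expR s2 = r by rewrite lnK// posrE.
have crr s1 : s1 < s2 -> cr_rect P Q s1 s2 0 (pi + pi).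
  move=> s12 s t /andP[_ ss] _; apply: crs; apply: le_lt_trans rr0.
  by rewrite -s2E ler_expR.
have cP2 : econt `[0, pi + pi] (P s2).
  by apply: (cr_rect_contP _ _ _ _ _ _ _ (crr (s2 - 1) _)); lra.
have [t0 _ tmax] := EVT_max (ltW pi2) ((econtP _ _).2 cP2).
have [|lt] := leP (Re (f a)) (P s2 t0).
  by move=> h; exists (a + cexp s2 t0); rewrite aE.
pose e := (Re (f a) - P s2 t0) / 2; have e0 : 0 < e by rewrite /e; lra.
have [r1 r10 H1] := fa _ e0.
(* On this inner circle Re f stays within [e], half of the supposed deficit, of its value at [a]. *)
pose s1 := Num.min (s2 - 1) (ln (r1 / 2)).
have s12 : s1 < s2 by rewrite gt_min; apply/orP; left; lra.
have s1r : expR s1 < r1.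
  apply: (@le_lt_trans _ _ (expR (ln (r1 / 2)))).
    by rewrite ler_expR ge_min lexx orbT.
  by rewrite lnK ?posrE ?divr_gt0//; lra.
have cP1 : econt `[0, pi + pi] (P s1).
  by apply: (cr_rect_contP _ _ _ _ _ _ _ (crr s1 s12)); rewrite lexx ltW.
have := goursat _ _ _ _ _ _ s12 pi2 (crr s1 s12).
rewrite /bdry (_ : (fun s => Q s (pi + pi) - Q s 0) = cst 0); last first.
  apply/funext => s; rewrite /Q (_ : cexp s (pi + pi) = cexp s 0) ?subrr//.
  rewrite /cexp cosD sinD cos0 sin0 cospi sinpi.
  by apply: complexP => /=; ring.
rewrite (integ_cst _ _ _ (ltW s12)) mul0r subr0 integB// => /eqP; rewrite subr_eq0 => /eqP E.
have : integ 0 (pi + pi) (P s2) <= integ 0 (pi + pi) (fun=> P s2 t0).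
  apply: integ_le => //; first exact: econt_cst.
have : integ 0 (pi + pi) (fun=> Re (f a) - e) <= integ 0 (pi + pi) (P s1).
  apply: integ_le => //; first exact: econt_cst.
  move=> x _; have := H1 (a + cexp s1 x); rewrite aE => /(_ s1r) h.
  have := le_lt_trans (Re_le_cabs _) h; rewrite cReB -/(P s1 x).
  by rewrite ltr_norml => /andP[+ _]; lra.
rewrite E !(integ_cst _ _ _ (ltW pi2)) !subr0.
have : (Re (f a) - e - P s2 t0) * (pi + pi) > 0 by rewrite mulr_gt0// /e; lra.
by rewrite mulrBl; lra.
Qed.

(** * The maximum principle *)

Definition copen {R : realType} (D : set R[i]) :=
  forall z, D z -> exists2 r : R, 0 < r & forall w, cabs (w - z) < r -> D w.

Definition rcont {R : realType} (u : R[i] -> R) (z : R[i]) :=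
  forall e : R, 0 < e -> exists2 r : R, 0 < r &
    forall w, cabs (w - z) < r -> `|u w - u z| < e.

(* Harmonicity enters the maximum principle only through this one-sided, affinely
   perturbed form of the mean value property. *)
Definition weak_sub {R : realType} (D : set R[i]) (u : R[i] -> R) (a : R[i]) :=
  exists2 r0 : R, 0 < r0 & forall r, 0 < r -> r < r0 -> forall c : R[i],
    exists z, [/\ D z, cabs (z - a) = r & u a <= u z + Re (c * (z - a))].

Definition qcont {R : realType} (P : set (R * R)) (q : R * R -> R[i]) :=
  forall p, P p -> forall e : R, 0 < e -> exists2 d : R, 0 < d &
    forall p', P p' -> `|p'.1 - p.1| < d -> `|p'.2 - p.2| < d ->
      cabs (q p' - q p) < e.

Lemma compact_max {R : realType} (P : set (R * R)) (F : R * R -> R) :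
  compact P -> P !=set0 ->
  (forall p, P p -> forall e, 0 < e -> exists2 d, 0 < d & forall p', P p' ->
    `|p'.1 - p.1| < d -> `|p'.2 - p.2| < d -> `|F p' - F p| < e) ->
  exists2 p, P p & forall p', P p' -> F p' <= F p.
Proof.
move=> cP P0 cF; have [|p pP pmax] := @compact_EVT_max _ R F P P0 cP.
  rewrite subspace_continuousP => p Pp; apply/cvgrPdist_lt => e e0.
  rewrite near_withinE; have [d d0 H] := cF p Pp e e0.
  apply/nbhs_ballP; exists d => // p' -[/= b1 b2] Pp'.
  by rewrite distrC; apply: H => //; rewrite distrC.
by exists p; [exact/set_mem|move=> p' Pp'; exact/pmax/mem_set].
Qed.

(* [D] is exhausted by compact sets off which [u <= m + e]. *)
Definition exhausted {R : realType} (D : set R[i]) (u : R[i] -> R) (m : R) :=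
  forall e, 0 < e -> exists (P : set (R * R)) (q : R * R -> R[i]),
    [/\ compact P, (forall p, P p -> D (q p)), qcont P q &
        forall z, D z -> u z <= m + e \/ exists2 p, P p & q p = z].

(** Adding $k|z|^2$ makes the weak property strict. At a maximum [b] of the sum over the compact
    set, some point at distance [r] has a value larger by $kr^2$. It lies either in the compact set,
    against maximality, or where $u\le m+e$, where the sum is too small. *)
Lemma max_principle {R : realType} (D : set R[i]) (u : R[i] -> R) (m : R) :
  (forall z, D z -> rcont u z) -> (forall z, D z -> weak_sub D u z) ->
  exhausted D u m -> forall z, D z -> u z <= m.
Proof.
move=> cu su ex a Da; rewrite leNgt; apply/negP => ma.
(* Of the excess [3 e], one [e] goes to the exhaustion, one to the quadratic term, and the third
   keeps the contradiction strict. *)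
pose e := (u a - m) / 3; have e0 : 0 < e by rewrite /e; lra.
have [P [q [cP PD cq H]]] := ex e e0.
have [pa Pa qa] : exists2 p, P p & q p = a.
  by case: (H a Da) => //; rewrite /e; lra.
have P0 : P !=set0 by exists pa.
have cabsq p : P p -> forall e, 0 < e -> exists2 d, 0 < d & forall p', P p' ->
    `|p'.1 - p.1| < d -> `|p'.2 - p.2| < d -> `|cabs (q p') - cabs (q p)| < e.
  move=> Pp e1 e10; have [d d0 h] := cq p Pp e1 e10.
  exists d => // p' Pp' a1 a2; apply: le_lt_trans (h p' Pp' a1 a2).
  by rewrite ler_norml le_cabsB andbT lerNl opprB cabsC le_cabsB.
have [pB _ hB] := compact_max _ (fun p => cabs (q p)) cP P0 cabsq.
have [B BE] : exists B, B = cabs (q pB) + 1 by exists (cabs (q pB) + 1).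
have B1 : 1 <= B by rewrite BE lerDr cabs_ge0.
have B0 : 0 < B by lra.
have [k k0 kB] : exists2 k, 0 < k & k * B ^+ 2 = e.
  exists (e / B ^+ 2); first by rewrite divr_gt0 ?exprn_gt0.
  by rewrite divfK// expf_neq0// gt_eqF.
pose G z := u z + k * cabs z ^+ 2.
have [|p Pp pmax] := compact_max _ (fun p => G (q p)) cP P0.
  move=> p Pp e1 e10.
  have e20 : 0 < e1 / 2 by rewrite divr_gt0.
  have [r r0 hu] := cu _ (PD _ Pp) _ e20; have [d1 d10 h1] := cq p Pp r r0.
  have e30 : 0 < e1 / 2 / (k * (B + B)).
    by rewrite divr_gt0// mulr_gt0// addr_gt0.
  have [d2 d20 h2] := cabsq p Pp _ e30.
  exists (Num.min d1 d2) => [|p' Pp']; first by rewrite lt_min d10.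
  rewrite !lt_min => /andP[a1 a2] /andP[b1 b2].
  have := hu _ (h1 _ Pp' a1 b1); have := h2 _ Pp' a2 b2.
  rewrite ltr_pdivlMr ?mulr_gt0 ?addr_gt0// => i2 i1.
  rewrite /G (_ : _ - _ = (u (q p') - u (q p)) +
    k * ((cabs (q p') - cabs (q p)) * (cabs (q p') + cabs (q p)))); last by ring.
  rewrite (le_lt_trans (ler_normD _ _))// (splitr e1) ltr_leD//.
  apply: le_trans (ltW i2); rewrite !normrM (gtr0_norm k0) mulrCA.
  rewrite ler_wpM2l ?normr_ge0// ler_pM2l//.
  rewrite ger0_norm ?addr_ge0 ?cabs_ge0// lerD//.
    by rewrite (le_trans (hB _ Pp'))// BE lerDl.
  by rewrite (le_trans (hB _ Pp))// BE lerDl.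
set b := q p in pmax; have Db : D b := PD _ Pp.
have [r0 r00 Hs] := su b Db.
pose r := Num.min r0 1 / 2.
have [r_gt0 rr0 r1] : [/\ 0 < r, r < r0 & r <= 1].
  have : Num.min r0 1 <= r0 by rewrite ge_min lexx.
  have : Num.min r0 1 <= 1 by rewrite ge_min lexx orbT.
  have : 0 < Num.min r0 1 by rewrite lt_min r00 ltr01.
  by rewrite /r; set x := Num.min _ _; split; lra.
(* The slope is chosen from $|z|^2=|b|^2+2\,\mathrm{Re}(\bar b(z-b))+|z-b|^2$, so it cancels against
   the linear part of the quadratic term at [b]. *)
have [z [Dz zr uz]] := Hs r r_gt0 rr0 ((2 * k)%:C * b^*).
have Gz : G b + k * r ^+ 2 <= G z.
  move: uz; rewrite /G -zr !cabs_sqr !cReM !cImM /= !cReB !cImB.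
  by case: (b) (z) => b1 b2 [z1 z2] /=; lra.
have kr : 0 < k * r ^+ 2 by rewrite mulr_gt0// exprn_gt0.
have bB : cabs z <= B.
  by rewrite (le_trans (cabs_leD z b))// zr BE lerD// hB.
have Ga : G a <= G b by rewrite -qa; exact: pmax.
case: (H z Dz) => [zm|[p' Pp' pz]].
  have : k * cabs z ^+ 2 <= e.
    by rewrite -kB ler_pM2l// ler_sqr ?nnegrE ?cabs_ge0// ltW.
  have : 0 <= k * cabs a ^+ 2 by rewrite mulr_ge0 ?sqr_ge0 ?ltW.
  by move: Ga Gz; rewrite /G /e in zm *; lra.
by have := pmax _ Pp'; rewrite pz; lra.
Qed.

(* A wrapper that keeps unification from unfolding [derivable]. *)
Variant hol_at {R : realType} (f : R[i] -> R[i]) (z : R[i]) : Prop :=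
  HolAt of derivable (f : R[i]^o -> R[i]^o) z 1.

(** * Holomorphic functions, and the weak mean value property of their real parts and moduli *)

Lemma hol_cst {R : realType} (c z : R[i]) : hol_at (fun=> c) z.
Proof. by constructor; exact: (@derivable_cst _ R[i]^o R[i]^o). Qed.

Lemma hol_id {R : realType} (z : R[i]) : hol_at id z.
Proof. by constructor; exact: (@derivable_id _ R[i]^o). Qed.

Lemma holD {R : realType} (f g : R[i] -> R[i]) (z : R[i]) :
  hol_at f z -> hol_at g z -> hol_at (fun w => f w + g w) z.
Proof. by move=> [df] [dg]; constructor; exact: (@derivableD _ R[i]^o R[i]^o f g _ _ df dg). Qed.

Lemma holB {R : realType} (f g : R[i] -> R[i]) (z : R[i]) :
  hol_at f z -> hol_at g z -> hol_at (fun w => f w - g w) z.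
Proof. by move=> [df] [dg]; constructor; exact: (@derivableB _ R[i]^o R[i]^o f g _ _ df dg). Qed.

Lemma holM {R : realType} (f g : R[i] -> R[i]) (z : R[i]) :
  hol_at f z -> hol_at g z -> hol_at (fun w => f w * g w) z.
Proof. by move=> [df] [dg]; constructor; exact: (@derivableM _ R[i]^o f g _ _ df dg). Qed.

Lemma holV {R : realType} (f : R[i] -> R[i]) (z : R[i]) :
  f z != 0 -> hol_at f z -> hol_at (fun w => (f w)^-1) z.
Proof. by move=> f0 [df]; constructor; exact: (@derivableV _ R[i]^o f _ _ f0 df). Qed.

Lemma hol_cdiff {R : realType} (f : R[i] -> R[i]) (z : R[i]) :
  hol_at f z -> exists d, cdiff f z d.
Proof.
move=> [df]; exists ('D_1 (f : R[i]^o -> R[i]^o) z) => e e0.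
have := df; rewrite /derivable => /cvgrPdist_le /(_ e%:C).
rewrite ltcR => /(_ e0) /nbhs_ballP[r /=]; case: r => r1 r2.
rewrite ltcE/= => /andP[/eqP->] r0 H; exists r1 => // w.
have [->|wz] := eqVneq w z.
  by rewrite !subrr mulr0 subr0 cabs0 mulr0.
move=> wr; have : ball (0 : R[i]^o) (r1%:C) (w - z).
  by rewrite /ball/= sub0r normrN normE ltcR.
move=> /H; rewrite subr_eq0 wz => /(_ isT) /=.
rewrite [_%:A]mulr1 subrK distrC normE lecR => h.
have wz0 : w - z != 0 by rewrite subr_eq0.
rewrite -ler_pdivrMr ?cabs_gt0// -cabsV -cabsM.
by rewrite mulrBl mulfK// (mulrC _ (w - z)^-1).
Qed.

Lemma ccontP {R : realType} (f : R[i] -> R[i]) (z : R[i]) :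
  ccont f z <-> {for z, continuous (f : R[i]^o -> R[i]^o)}.
Proof.
split=> [cf|/cvgrPdist_lt cf e e0].
  apply/(@cvgrPdist_lt _ R[i]^o _ (nbhs (z : R[i]^o))) => e; case: e => e1 e2; rewrite ltcE/= => /andP[/eqP->] e0.
  have [r r0 H] := cf e1 e0; apply/nbhs_ballP; exists r%:C; first by rewrite /= ltcR.
  move=> w; rewrite /ball/= normE ltcR cabsC => /H.
  by rewrite normE ltcR cabsC.
have := cf e%:C; rewrite ltcR => /(_ e0)/nbhs_ballP[r /=]; case: r => r1 r2.
rewrite ltcE/= => /andP[/eqP->] r0 H; exists r1 => // w wr.
have /H : ball (z : R[i]^o) r1%:C w by rewrite /ball/= normE ltcR cabsC.
by rewrite /= normE ltcR cabsC.
Qed.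

Lemma ccontB {R : realType} (f g : R[i] -> R[i]) (z : R[i]) :
  ccont f z -> ccont g z -> ccont (fun w => f w - g w) z.
Proof. by move=> /ccontP cf /ccontP cg; apply/ccontP; exact: (cvgB cf cg). Qed.

Lemma ccontD {R : realType} (f g : R[i] -> R[i]) (z : R[i]) :
  ccont f z -> ccont g z -> ccont (fun w => f w + g w) z.
Proof. by move=> /ccontP cf /ccontP cg; apply/ccontP; exact: (cvgD cf cg). Qed.

Lemma ccontM {R : realType} (f g : R[i] -> R[i]) (z : R[i]) :
  ccont f z -> ccont g z -> ccont (fun w => f w * g w) z.
Proof. by move=> /ccontP cf /ccontP cg; apply/ccontP; exact: (cvgM cf cg). Qed.

Lemma ccontV {R : realType} (f : R[i] -> R[i]) (z : R[i]) :
  f z != 0 -> ccont f z -> ccont (fun w => (f w)^-1) z.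
Proof. by move=> f0 /ccontP cf; apply/ccontP; exact: (cvgV f0 cf). Qed.

Lemma ccont_cst {R : realType} (c z : R[i]) : ccont (fun=> c) z.
Proof. by move=> e e0; exists 1 => // w _; rewrite subrr cabs0. Qed.

Lemma hol_cont {R : realType} (f : R[i] -> R[i]) (z : R[i]) :
  hol_at f z -> ccont f z.
Proof. by move=> /hol_cdiff[d]; exact: cdiff_cont. Qed.

Lemma cabs_dist {R : realType} (z w : R[i]) :
  `|cabs z - cabs w| <= cabs (z - w).
Proof. by rewrite ler_norml le_cabsB andbT lerNl opprB cabsC le_cabsB. Qed.

Lemma ccont_cabs {R : realType} (f : R[i] -> R[i]) (z : R[i]) :
  ccont f z -> rcont (cabs \o f) z.
Proof.
move=> cf e e0; have [r r0 H] := cf e e0; exists r => // w /H.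
exact/le_lt_trans/cabs_dist.
Qed.

Lemma ccont_Re {R : realType} (f : R[i] -> R[i]) (z : R[i]) :
  ccont f z -> rcont (fun w => Re (f w)) z.
Proof.
move=> cf e e0; have [r r0 H] := cf e e0; exists r => // w /H.
by apply: le_lt_trans; rewrite -cReB Re_le_cabs.
Qed.

Definition punctured_cdiff {R : realType} (f : R[i] -> R[i]) (a : R[i]) :=
  exists2 r : R, 0 < r &
    forall z, 0 < cabs (z - a) -> cabs (z - a) < r -> exists d, cdiff f z d.

Lemma cdiffZ {R : realType} (f : R[i] -> R[i]) (k z d : R[i]) :
  cdiff f z d -> cdiff (fun w => k * f w) z (k * d).
Proof.
move=> df e e0; have k0 : 0 < cabs k + 1 by rewrite ltr_wpDl// cabs_ge0.
have [r r0 H] := df _ (divr_gt0 e0 k0); exists r => // w /H h.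
rewrite -mulrA -mulrBr -mulrBr cabsM.
have := cabs_ge0 k; move: h; rewrite mulrAC ler_pdivlMr//.
set x := cabs _; set y := cabs _ => h kk.
have x0 : 0 <= x := cabs_ge0 _.
by rewrite (le_trans _ h)// mulrC ler_wpM2l// lerDl.
Qed.

Lemma cdiffDl {R : realType} (f : R[i] -> R[i]) (c a z d : R[i]) :
  cdiff f z d -> cdiff (fun w => f w + c * (w - a)) z (d + c).
Proof.
move=> df e e0; have [r r0 H] := df _ e0; exists r => // w /H.
by rewrite (_ : f w + _ - _ - _ = f w - f z - d * (w - z))//; ring.
Qed.

Lemma weak_sub_Re {R : realType} (D : set R[i]) (f : R[i] -> R[i]) (k a : R[i]) :
  copen D -> D a -> ccont f a -> punctured_cdiff f a ->
  weak_sub D (fun z => Re (k * f z)) a.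
Proof.
move=> oD Da cf [r1 r10 df]; have [r2 r20 aD] := oD a Da.
exists (Num.min r1 r2) => [|r r0]; first by rewrite lt_min r10.
rewrite lt_min => /andP[rr1 rr2] c.
have [||z [zr h]] := circle_max_ge (fun z => k * f z + c * (z - a)) a _ _ r0 rr1.
- apply: ccontD; first exact/ccontM/cf/ccont_cst.
  apply: ccontM; first exact: ccont_cst.
  by apply: hol_cont; apply: holB; [exact: hol_id|exact: hol_cst].
- move=> z z0 zr; have [d dd] := df z z0 zr.
  by exists (k * d + c); exact/cdiffDl/cdiffZ.
exists z; split => //; first by apply: aD; rewrite zr.
by move: h; rewrite subrr mulr0 addr0 cReD.
Qed.

(** Multiplying by the conjugate phase of f(a) gives a function whose real part equals |f| at [a]
    and is at most |f| elsewhere. If f(a) = 0, it is enough that the affine term is nonnegative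
    somewhere on the circle. *)
Lemma weak_sub_cabs {R : realType} (D : set R[i]) (f : R[i] -> R[i]) (a : R[i]) :
  copen D -> D a -> ccont f a -> punctured_cdiff f a ->
  weak_sub D (cabs \o f) a.
Proof.
move=> oD Da cf df; have [fa0|fa0] := eqVneq (f a) 0.
  have [r0 r00 H] := weak_sub_Re D f 0 a oD Da cf df; exists r0 => // r rg0 rr c.
  have [z [Dz zr]] := H r rg0 rr c; rewrite !mul0r add0r => h.
  by exists z; split => //=; rewrite fa0 cabs0 addr_ge0 ?cabs_ge0.
pose k := (f a)^* * ((cabs (f a))^-1)%:C.
have [r0 r00 H] := weak_sub_Re D f k a oD Da cf df; exists r0 => // r rg0 rr c.
have [z [Dz zr h]] := H r rg0 rr c; exists z; split => //=.
have f0 : 0 < cabs (f a) by rewrite cabs_gt0.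
have ka : Re (k * f a) = cabs (f a).
  have : cabs (f a) = cabs (f a) ^+ 2 / cabs (f a).
    by rewrite expr2 mulfK// gt_eqF.
  move=> ->; rewrite cabs_sqr /k; case: (f a) => x y /=; ring.
have kz : Re (k * f z) <= cabs (f z).
  rewrite (le_trans (ler_norm _))// (le_trans (Re_le_cabs _))//.
  rewrite /k !cabsM cabs_real gtr0_norm ?invr_gt0//.
  rewrite (_ : cabs (f a)^* = cabs (f a)) ?divff ?mul1r ?gt_eqF//.
  by case: (f a) => x y; rewrite /cabs/= sqrrN.
by rewrite ka in h; rewrite (le_trans h)// lerD2r.
Qed.

(** * Real induction and the open mapping property *)

(** The supremum of the points up to which [Pr] holds is attained by the limit clause, and the step
    clause moves it on to [b]. This drives all continuation arguments below. *)
Lemma real_induction {R : realType} (a b : R) (Pr : R -> Prop) : Pr a ->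
  (forall x, a <= x -> x < b -> (forall y, a <= y -> y <= x -> Pr y) ->
    exists2 d, 0 < d & forall y, x < y -> y < x + d -> y <= b -> Pr y) ->
  (forall x, a < x -> x <= b -> (forall y, a <= y -> y < x -> Pr y) -> Pr x) ->
  forall x, a <= x -> x <= b -> Pr x.
Proof.
move=> Pa step lim x ax xb; have ab := le_trans ax xb.
pose S := [set x | [/\ a <= x, x <= b & forall y, a <= y -> y <= x -> Pr y]].
have Sa : S a.
  by split => // y ay ya; have -> : y = a by apply/eqP; rewrite eq_le ya.
have bS : has_sup S by split; [exists a|exists b => y []].
pose c := sup S; have ac : a <= c by apply: ub_le_sup => //; exact: bS.2.
have cb : c <= b by apply: ge_sup; [exact: bS.1|move=> y []].
have below y : a <= y -> y < c -> Pr y.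
  move=> ay /(sup_gt bS.1)[s [_ _ H] ys]; exact/H/ltW.
have Pc : Pr c.
  by move: ac; rewrite le_eqVlt => /predU1P[<-//|ac]; exact: lim.
have upto y : a <= y -> y <= c -> Pr y.
  by move=> ay; rewrite le_eqVlt => /predU1P[->//|]; exact: below.
suff cE : c = b by apply: upto => //; rewrite cE.
apply/eqP; rewrite eq_le cb leNgt; apply/negP => cltb.
have [d d0 H] := step c ac cltb upto.
pose y := Num.min b (c + d / 2).
have cy : c < y by rewrite lt_min cltb ltrDl divr_gt0.
have yd : y < c + d.
  have : y <= c + d / 2 by rewrite ge_min lexx orbT.
  by lra.
have : y <= c.
  apply: ub_le_sup; first exact: bS.2.
  split; [exact: le_trans (ltW cy)|by rewrite ge_min lexx|].
  move=> w aw wy; have [wc|cw] := leP w c; first exact: upto.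
  apply: H => //; first exact: le_lt_trans yd.
  by rewrite (le_trans wy)// ge_min lexx.
by rewrite leNgt cy.
Qed.

(** If the derivative vanished on a whole disc, [j] would be constant along a horizontal segment in
    it, against injectivity. The lemma lets [schwarz_pick] reach every base point by continuity. *)
Lemma noncritical_dense {R : realType} (D : set R[i]) (j : R[i] -> R[i]) (z : R[i])
    (e : R) : copen D -> (forall w, D w -> hol_at j w) ->
  {in D &, injective j} -> D z -> 0 < e ->
  exists w d, [/\ D w, cabs (w - z) < e, cdiff j w d & d != 0].
Proof.
move=> oD hj ij Dz e0; apply: contrapT => no.
have [r r0 zD] := oD z Dz.
have [h [h0 he hr]] : exists h, [/\ 0 < h, h < e & h < r].
  exists (Num.min e r / 2).
  have : Num.min e r <= e by rewrite ge_min lexx.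
  have : Num.min e r <= r by rewrite ge_min lexx orbT.
  have : 0 < Num.min e r by rewrite lt_min e0 r0.
  by set x := Num.min _ _; split; lra.
have flat w : cabs (w - z) <= h -> cdiff j w 0.
  move=> wh; have Dw : D w by apply: zD; exact: le_lt_trans hr.
  have [d dd] := hol_cdiff _ _ (hj w Dw).
  suff d0 : d = 0 by rewrite -d0.
  apply/eqP/negPn/negP => dn0; apply: no; exists w, d; split => //.
  exact: le_lt_trans he.
pose p t := z + t%:C.
have pE s t : p s - p t = (s - t)%:C.
  by apply: complexP; rewrite /p !(cReB, cImB, cReD, cImD)/=; ring.
have pz t : 0 <= t -> t <= h -> cabs (p t - z) <= h.
  by move=> t0 th; rewrite /p addrC addKr cabs_real ger0_norm.
have loc k x : 0 < k -> 0 <= x -> x <= h -> exists2 d, 0 < d &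
    forall y, `|y - x| < d -> cabs (j (p y) - j (p x)) <= k * `|y - x|.
  move=> k0 x0 xh; have [d d0 H] := flat _ (pz x x0 xh) _ k0.
  exists d => // y yx; have := H (p y); rewrite pE cabs_real => /(_ yx).
  by rewrite mul0r subr0.
have all k : 0 < k -> cabs (j (p h) - j (p 0)) <= k * h.
  move=> k0; move: h {he hr flat pz} h0 loc => h h0 loc.
  apply: (real_induction 0 h (fun t => cabs (j (p t) - j (p 0)) <= k * t)).
  - by rewrite subrr cabs0 mulr0.
  - move=> x x0 xh /(_ x x0 (lexx _)) Px.
    have [d d0 H] := loc k x k0 x0 (ltW xh); exists d => // y xy yd _.
    have := H y; rewrite gtr0_norm ?subr_gt0// ltrBlDl => /(_ yd) h1.
    by rewrite (le_trans (cabs_trans (j (p x)) _ _))//; lra.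
  - move=> x x0 xh Py; have [d d0 H] := loc k x k0 (ltW x0) xh.
    pose y := Num.max 0 (x - d / 2).
    have y0 : 0 <= y by rewrite le_max lexx.
    have yx : y < x by rewrite gt_max x0 /=; lra.
    have xyd : `|y - x| < d.
      have : x - d / 2 <= y by rewrite le_max lexx orbT.
      by rewrite ltr0_norm ?subr_lt0//; lra.
    have := H y xyd; have := Py y y0 yx; rewrite ltr0_norm ?subr_lt0//.
    by have := cabs_trans (j (p y)) (j (p x)) (j (p 0));
      rewrite (cabsC (j (p x)) (j (p y))); lra.
  - exact: ltW.
  - exact: lexx.
have jE : j (p h) = j (p 0).
  apply/eqP; rewrite -subr_eq0 -cabs_eq0 eq_le cabs_ge0 andbT leNgt.
  apply/negP => c0; have := all (cabs (j (p h) - j (p 0)) / (2 * h)).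
  rewrite divr_gt0 ?mulr_gt0// => /(_ isT).
  rewrite (_ : _ / _ * h = cabs (j (p h) - j (p 0)) / 2); last first.
    by field; rewrite gt_eqF.
  by move: c0; set x := cabs _; lra.
have Dp t : 0 <= t -> t <= h -> D (p t).
  by move=> t0 th; apply: zD; exact: le_lt_trans (pz _ t0 th) hr.
have := ij _ _ (mem_set (Dp h (ltW h0) (lexx _)))
  (mem_set (Dp 0 (lexx _) (ltW h0))) jE.
move=> /eqP; rewrite -subr_eq0 pE subr0 => /eqP[] /eqP.
by rewrite gt_eqF.
Qed.

Lemma compact_rect {R : realType} (M : R) (C : set (R * R)) :
  (forall p, ~ C p -> exists2 d : R, 0 < d & forall p' : R * R,
     `|p'.1 - p.1| < d -> `|p'.2 - p.2| < d -> ~ C p') ->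
  compact [set p : R * R | [/\ `|p.1| <= M, `|p.2| <= M & C p]].
Proof.
move=> oC; have clC : closed C.
  rewrite -(setCK C); apply: open_closedC; rewrite openE => p /= Cp.
  have [d d0 H] := oC p Cp; apply/nbhs_ballP; exists d => // p' [/= b1 b2].
  by apply: H; rewrite distrC.
rewrite (_ : [set p | _] = (`[- M, M] `*` `[- M, M]) `&` C).
  by apply: compact_closedI => //; apply: compact_setX; exact: segment_compact.
apply/seteqP; split => [p [h1 h2 h3]|p [[/= + +] h3]].
  by split => //; split; rewrite /= in_itv/= -ler_norml.
by rewrite !in_itv/= -!ler_norml.
Qed.

Lemma circle_cabs_ge {R : realType} (f : R[i] -> R[i]) (a : R[i]) (r0 r : R) :
  0 < r -> r < r0 -> ccont f a ->
  (forall z, 0 < cabs (z - a) -> cabs (z - a) < r0 -> exists d, cdiff f z d) ->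
  exists z, cabs (z - a) = r /\ cabs (f a) <= cabs (f z).
Proof.
move=> r_gt0 rr0 cf df.
have [||z [zr h]] := circle_max_ge (fun z => (f a)^* * f z) a _ _ r_gt0 rr0.
- exact/ccontM/cf/ccont_cst.
- by move=> z z0 zr; have [d dd] := df z z0 zr; exists ((f a)^* * d); exact: cdiffZ.
exists z; split=> //; have [->|fa0] := eqVneq (f a) 0; first by rewrite cabs0 cabs_ge0.
have f0 : 0 < cabs (f a) by rewrite cabs_gt0.
rewrite -(ler_pM2l f0) -expr2 cabs_sqr.
rewrite (_ : _ + _ = Re ((f a)^* * f a)); last by case: (f a) => x y /=; ring.
rewrite (le_trans h)// (le_trans (ler_norm _))// (le_trans (Re_le_cabs _))//.
rewrite cabsM ler_wpM2r ?cabs_ge0//.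
by case: (f a) => x y; rewrite /cabs/= sqrrN.
Qed.

(** Let [m] be the minimum of |j - j(z0)| on a small circle, positive by injectivity. If a value [w]
    within m/2 of j(z0) were omitted, 1/(j - w) would be holomorphic in the disc, with modulus above
    2/m at the centre and below 2/m on the circle. *)
Lemma open_mapping {R : realType} (D : set R[i]) (j : R[i] -> R[i]) (z0 : R[i])
    (e : R) : copen D -> (forall w, D w -> hol_at j w) ->
  {in D &, injective j} -> D z0 -> 0 < e ->
  exists2 d : R, 0 < d & forall w, cabs (w - j z0) < d ->
    exists z, [/\ D z, cabs (z - z0) < e & j z = w].
Proof.
move=> oD hj ij Dz0 e0; have [r1 r10 Dr1] := oD z0 Dz0.
have [r0 [r00 r0e r0r1]] : exists r0, [/\ 0 < r0, r0 <= e & r0 <= r1].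
  by exists (Num.min e r1); rewrite lt_min e0 r10 !ge_min !lexx orbT.
pose r := r0 / 2; have r_gt0 : 0 < r by rewrite divr_gt0.
have rr0 : r < r0 by rewrite /r; lra.
pose P := [set p : R * R | [/\ `|p.1| <= r, `|p.2| <= r &
  p.1 ^+ 2 + p.2 ^+ 2 = r ^+ 2]].
have cP : compact P.
  apply: compact_rect => p pr.
  have cf : {for p, continuous (fun p : R * R => p.1 ^+ 2 + p.2 ^+ 2)}.
    by apply: cvgD; rewrite expr2; apply: cvgM; (exact: cvg_fst || exact: cvg_snd).
  have k0 : 0 < `|p.1 ^+ 2 + p.2 ^+ 2 - r ^+ 2|.
    by rewrite normr_gt0 subr_eq0; apply/eqP.
  move/cvgrPdist_lt : cf => /(_ _ k0)/nbhs_ballP[d /= d0 H].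
  exists d => // p' b1 b2 E.
  have : ball p d p' by split; rewrite /= /ball/= distrC.
  by move=> /H /=; rewrite E ltxx.
pose q (p : R * R) : R[i] := z0 + (p.1 +i* p.2).
have qz p : P p -> cabs (q p - z0) = r.
  move=> [_ _ E]; rewrite /q addrC addKr.
  apply/eqP; rewrite -(@eqrXn2 _ 2%N)// ?cabs_ge0 ?ltW//.
  by rewrite cabs_sqr/= E.
have PD p : P p -> D (q p).
  by move=> /qz h; apply: Dr1; rewrite h; lra.
have P0 : P !=set0.
  exists (r, 0); split => /=; rewrite ?normr0 ?ger0_norm ?(ltW r_gt0)//.
  by rewrite expr0n addr0.
have [|p Pp pmin] := compact_max P (fun p => - cabs (j (q p) - j z0)) cP P0.
  move=> p Pp k k0.
  have [d d0 H] := hol_cont _ _ (hj _ (PD _ Pp)) k k0.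
  exists (d / 2) => [|p' Pp' a1 a2]; first by rewrite divr_gt0.
  rewrite -opprD normrN (le_lt_trans (cabs_dist _ _))//.
  rewrite (_ : _ - _ - _ = j (q p') - j (q p)); last by ring.
  apply: H; rewrite (_ : _ - _ = (p'.1 - p.1) +i* (p'.2 - p.2)).
    by rewrite (le_lt_trans (cabs_le_ReIm _))//= (splitr d) ltrD.
  by apply: complexP; rewrite /q !(cReB, cImB, cReD, cImD)/=; ring.
pose m := cabs (j (q p) - j z0).
have m0 : 0 < m.
  rewrite cabs_gt0 subr_eq0; apply/eqP => E.
  have := ij _ _ (mem_set (PD _ Pp)) (mem_set Dz0) E => qE.
  by have := qz _ Pp; rewrite qE subrr cabs0 => E0; rewrite -E0 ltxx in r_gt0.
have circ z : cabs (z - z0) = r -> m <= cabs (j z - j z0).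
  move=> zr; have := pmin (Re (z - z0), Im (z - z0)); rewrite lerN2.
  rewrite (_ : q (_, _) = z); last first.
    by rewrite /q; case: (z) (z0) => a b [c d]; apply: complexP => /=; ring.
  apply; split => /=; last by rewrite -cabs_sqr zr.
    by rewrite -zr Re_le_cabs.
  by rewrite -zr Im_le_cabs.
exists (m / 2) => [|w wm]; first by rewrite divr_gt0.
apply: contrapT => no.
pose B := [set z | cabs (z - z0) < r0].
have BD z : B z -> D z by move=> Bz; apply: Dr1; exact: lt_le_trans r0r1.
have oB : copen B.
  move=> z Bz; exists (r0 - cabs (z - z0)) => [|v]; first by rewrite subr_gt0.
  by rewrite ltrBrDr; apply: le_lt_trans; exact: cabs_trans.
have jw z : B z -> j z - w != 0.
  move=> Bz; rewrite subr_eq0; apply/eqP => E; apply: no; exists z; split => //.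
    exact: BD.
  exact: lt_le_trans r0e.
have hF z : B z -> hol_at (fun z => (j z - w)^-1) z.
  move=> Bz; apply: holV; first exact: jw.
  by apply: holB; [exact/hj/BD|exact: hol_cst].
have Bz0 : B z0 by rewrite /B/= subrr cabs0.
have [||z [zr h]] := circle_cabs_ge (fun z => (j z - w)^-1) z0 _ _ r_gt0 rr0.
- exact/hol_cont/hF.
- by move=> z _ zr; exact/hol_cdiff/hF.
have Bz : B z by rewrite /B/= zr.
move: h; rewrite !cabsV lef_pV2 ?posrE ?cabs_gt0 ?jw// => h.
have := circ z zr; have := cabs_trans w (j z) (j z0).
by move: wm; rewrite (cabsC w) (cabsC (j z0) w) in h *; lra.
Qed.

(** * The Schwarz-Pick inequality *)

(** Expresses that [j] tends to the real line or to infinity as [z] leaves the compact subsets of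
    [D]. Compact sets are presented by continuous parametrizations, in the form that [exhausted]
    asks for. *)
Definition proper_to_H {R : realType} (D : set R[i]) (j : R[i] -> R[i]) :=
  forall eta M : R, 0 < eta -> exists (P : set (R * R)) (q : R * R -> R[i]),
    [/\ compact P, (forall p, P p -> D (q p)), qcont P q &
        forall z, D z -> eta <= Im (j z) -> cabs (j z) <= M ->
          exists2 p, P p & q p = z].

Definition quot {R : realType} (f : R[i] -> R[i]) (a d z : R[i]) :=
  if z == a then d else (f z - f a) / (z - a).

Lemma quot_cont {R : realType} (f : R[i] -> R[i]) (a d : R[i]) :
  cdiff f a d -> ccont (quot f a d) a.
Proof.
move=> df e e0; have [r r0 H] := df _ (divr_gt0 e0 (ltr0n _ 2)).
exists r => // w wr; rewrite /quot eqxx; have [_|wa] := eqVneq w a.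
  by rewrite subrr cabs0.
have wa0 : 0 < cabs (w - a) by rewrite cabs_gt0 subr_eq0.
rewrite (_ : _ / _ - d = (f w - f a - d * (w - a)) / (w - a)); last first.
  by field; rewrite subr_eq0.
rewrite cabsM cabsV ltr_pdivrMr// (le_lt_trans (H _ wr))//.
by rewrite ltr_pM2r//; lra.
Qed.

Lemma hol_ext {R : realType} (f g : R[i] -> R[i]) (z : R[i]) (r : R) :
  0 < r -> (forall w, cabs (w - z) < r -> f w = g w) -> hol_at f z -> hol_at g z.
Proof.
move=> r0 fg [df]; constructor; apply: near_eq_derivable df; apply/nbhs_ballP.
exists r%:C => [|w]; first by rewrite /= ltcR.
by rewrite /ball/= normE ltcR cabsC => /fg.
Qed.

Lemma quot_hol {R : realType} (f : R[i] -> R[i]) (a d z : R[i]) :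
  z != a -> hol_at f z -> hol_at (quot f a d) z.
Proof.
move=> za hf; have za0 : 0 < cabs (z - a) by rewrite cabs_gt0 subr_eq0.
apply: (@hol_ext _ (fun w => (f w - f a) / (w - a)) _ _ _ za0).
  move=> w wz; rewrite /quot; case: eqP => // wa.
  by move: wz; rewrite wa cabsC ltxx.
apply: holM; first by apply: holB => //; exact: hol_cst.
apply: holV; first by rewrite subr_eq0.
by apply: holB; [exact: hol_id|exact: hol_cst].
Qed.

(** Turns the quotient $|z-w|/|z-\bar w|$ of hyperbolic geometry into the polynomial form in which
    Schwarz-Pick is stated. *)
Lemma conj_gap {R : realType} (z w : R[i]) :
  cabs (z - w^*) ^+ 2 = cabs (z - w) ^+ 2 + 4 * Im z * Im w.
Proof. by rewrite !cabs_sqr; case: z w => a b [c d] /=; ring. Qed.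

Lemma ler_of_sqr {R : realType} (x y : R) : 0 <= y -> x ^+ 2 <= y ^+ 2 -> x <= y.
Proof.
move=> y0 xy; have [x0|/ltW x0] := leP 0 x; last exact: le_trans y0.
by rewrite -(ler_sqr x0 y0).
Qed.

Lemma neq_conj {R : realType} (z w : R[i]) : 0 < Im z -> 0 < Im w -> z - w^* != 0.
Proof.
move=> z0 w0; apply/eqP => /(congr1 (@complex.Im R)); rewrite cImB.
by case: w w0 => c d /=; lra.
Qed.

(** [F] is the Cayley transform of [f] based at f(a) divided by that of [j] based at j(a). Since dj
    is not 0, dividing both by z - a makes [F] continuous at [a]. Towards the boundary of [D] the
    transform of [j] has modulus tending to 1 while that of [f] is at most 1, so the maximum
    principle gives $|F|\le 1$. *)
Lemma schwarz_pick_noncritical {R : realType} (D : set R[i])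
    (j f : R[i] -> R[i]) (a dj z : R[i]) :
  copen D -> (forall w, D w -> hol_at j w) -> (forall w, D w -> hol_at f w) ->
  {in D &, injective j} -> (forall w, D w -> 0 < Im (j w)) ->
  (forall w, D w -> 0 < Im (f w)) -> proper_to_H D j ->
  D a -> cdiff j a dj -> dj != 0 -> D z ->
  cabs (f z - f a) ^+ 2 * (Im (j z) * Im (j a)) <=
  cabs (j z - j a) ^+ 2 * (Im (f z) * Im (f a)).
Proof.
move=> oD hj hf ij j0 f0 pj Da dja dj0 Dz.
have [df dfa] := hol_cdiff _ _ (hf a Da).
pose num z := quot f a df z * (j z - (j a)^*).
pose den z := (f z - (f a)^*) * quot j a dj z.
pose F z := num z / den z.
have qj0 w : D w -> quot j a dj w != 0.
  move=> Dw; rewrite /quot; have [//|wa] := eqVneq w a.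
  rewrite mulf_neq0 ?invr_neq0 ?subr_eq0//; apply: contraNneq wa => E.
  by apply/eqP; apply: ij => //; exact/mem_set.
have den0 w : D w -> den w != 0.
  by move=> Dw; rewrite mulf_neq0 ?qj0// neq_conj ?f0.
have hF w : D w -> w != a -> hol_at F w.
  move=> Dw wa; apply: holM; first apply: holM; first exact/quot_hol/hf.
    by apply: holB; [exact: hj|exact: hol_cst].
  apply: holV; first exact: den0.
  apply: holM; last exact/quot_hol/hj.
  by apply: holB; [exact: hf|exact: hol_cst].
have cF w : D w -> ccont F w.
  move=> Dw; have [->|wa] := eqVneq w a; last exact/hol_cont/hF.
  apply: ccontM; first apply: ccontM; first exact: quot_cont.
    by apply: ccontB; [exact/hol_cont/hj|exact: ccont_cst].
  apply: ccontV; first exact: den0.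
  apply: ccontM; last exact: quot_cont.
  by apply: ccontB; [exact/hol_cont/hf|exact: ccont_cst].
have FE w : D w -> w != a -> cabs (F w) ^+ 2 * (cabs (f w - (f a)^*) ^+ 2 *
    cabs (j w - j a) ^+ 2) = cabs (f w - f a) ^+ 2 * cabs (j w - (j a)^*) ^+ 2.
  move=> Dw wa; have wa0 : w - a != 0 by rewrite subr_eq0.
  have jwa : j w - j a != 0.
    rewrite subr_eq0; apply: contraNneq wa => E.
    by apply/eqP; apply: ij => //; exact/mem_set.
  have fwa := neq_conj _ _ (f0 w Dw) (f0 a Da).
  rewrite -!exprMn -!cabsM; congr (cabs _ ^+ 2).
  by rewrite /F /num /den /quot (negbTE wa); field; rewrite wa0 jwa fwa.
have Ja0 := j0 a Da.
(* By [conj_gap], the premise says that the squared modulus of the Cayley transform of [j] at [v] is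
   at least 1/(1 + e). *)
have Fbound e v : 0 < e -> D v -> v != a ->
    4 * Im (j v) * Im (j a) <= e * cabs (j v - j a) ^+ 2 -> cabs (F v) <= 1 + e.
  move=> e0 Dv va h; have := FE v Dv va; rewrite !conj_gap.
  have jva : 0 < cabs (j v - j a).
    rewrite cabs_gt0 subr_eq0; apply: contraNneq va => E.
    by apply/eqP; apply: ij => //; exact/mem_set.
  have B0 : 0 < cabs (j v - j a) ^+ 2 by rewrite exprn_gt0.
  move: B0 h; set B := cabs (j v - j a) ^+ 2; set A := cabs (f v - f a) ^+ 2.
  have A0 : 0 <= A by rewrite sqr_ge0.
  have fv : 0 < 4 * Im (f v) * Im (f a) by rewrite !mulr_gt0 ?f0.
  move: fv; set X := 4 * Im (f v) * Im (f a) => X0 B0.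
  set Y := 4 * Im (j v) * Im (j a) => h E.
  apply: ler_of_sqr; first by lra.
  have XB : 0 < (A + X) * B by rewrite mulr_gt0//; lra.
  rewrite -(ler_pM2r XB) E.
  apply: (@le_trans _ _ ((A + X) * ((1 + e) * B))).
    apply: ler_pM; rewrite ?addr_ge0 ?(ltW B0)//; try lra.
    by rewrite !mulr_ge0// ltW// j0.
  rewrite mulrCA ler_wpM2r// ?(ltW XB)// expr2 ler_peMr//; lra.
have F1 w : D w -> (cabs \o F) w <= 1.
  apply: max_principle => [v Dv|v Dv|e e0]; first exact/ccont_cabs/cF.
    apply: weak_sub_cabs => //; first exact: cF.
    have [r r0 vD] := oD v Dv; have [va|va] := eqVneq v a.
      exists r => // u u0 ur; apply: hol_cdiff; apply: hF; first exact: vD.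
      by move: u0; rewrite cabs_gt0 subr_eq0 va.
    exists (Num.min r (cabs (v - a))) => [|u u0].
      by rewrite lt_min r0 cabs_gt0 subr_eq0.
    rewrite lt_min => /andP[ur uv]; apply: hol_cdiff; apply: hF; first exact: vD.
    by apply: contraTneq uv => ->; rewrite cabsC ltxx.
  pose Ja := Im (j a).
  (* [eta] secures the premise of [Fbound] near the real line, and [M] secures it near infinity. *)
  pose eta := Num.min (Ja / 2) (e * Ja / 16).
  pose M := 2 * cabs (j a) + 16 * Ja / e.
  have [eta0 eta1 eta2] : [/\ 0 < eta, eta <= Ja / 2 & eta <= e * Ja / 16].
    by rewrite lt_min !ge_min !lexx orbT !divr_gt0// mulr_gt0.
  have [P [q [cP PD cq H]]] := pj eta M eta0.
  exists P, q; split=> // v Dv.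
  have [Jv|Jv] := leP eta (Im (j v)); last first.
    left; have va : v != a.
      by apply: contraTneq Jv => ->; rewrite -leNgt -/Ja; lra.
    have Jv0 := j0 v Dv; apply: Fbound => //.
    have : (Ja / 2) ^+ 2 <= cabs (j v - j a) ^+ 2.
      rewrite ler_sqr ?nnegrE ?cabs_ge0 ?divr_ge0 ?(ltW Ja0)//.
      rewrite cabsC (le_trans _ (Im_le_cabs _))// (le_trans _ (ler_norm _))//.
      by rewrite cImB -/Ja; lra.
    rewrite -(ler_pM2l e0) => h; apply: le_trans h; rewrite -/Ja expr2.
    have : 4 * Im (j v) * Ja <= 4 * (e * Ja / 16) * Ja.
      by rewrite ler_pM2r//; lra.
    by move/le_trans; apply; lra.
  have [jM|jM] := leP (cabs (j v)) M; first by right; exact: H.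
  left; have va : v != a.
    apply: contraTneq jM => ->; rewrite -leNgt /M.
    have : 0 <= 16 * Ja / e by rewrite divr_ge0 ?mulr_ge0 ?(ltW Ja0) ?(ltW e0).
    by have := cabs_ge0 (j a); lra.
  apply: Fbound => //; rewrite -/Ja.
  have Me : 16 * Ja <= e * M.
    rewrite /M mulrDr (_ : e * (16 * Ja / e) = 16 * Ja); last first.
      by field; rewrite gt_eqF.
    by rewrite lerDr mulr_ge0 ?mulr_ge0 ?cabs_ge0 ?(ltW e0).
  have jv2 : cabs (j v) / 2 <= cabs (j v - j a).
    have := le_cabsB (j v) (j a).
    have : 0 <= 16 * Ja / e by rewrite divr_ge0 ?mulr_ge0 ?(ltW Ja0) ?(ltW e0).
    by move: jM; rewrite /M; lra.
  have jv0 : 0 <= cabs (j v) / 2 by rewrite divr_ge0 ?cabs_ge0.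
  have h1 : (cabs (j v) / 2) ^+ 2 <= cabs (j v - j a) ^+ 2.
    by rewrite ler_sqr ?nnegrE ?cabs_ge0.
  apply: le_trans (_ : e * (cabs (j v) / 2) ^+ 2 <= _); last by rewrite ler_pM2l.
  have Jv1 : Im (j v) <= cabs (j v) by rewrite (le_trans (ler_norm _))// Im_le_cabs.
  have : 4 * Im (j v) * Ja <= 4 * cabs (j v) * Ja by rewrite ler_pM2r//; lra.
  move/le_trans; apply.
  have : 16 * Ja <= e * cabs (j v).
    by apply: (le_trans Me); rewrite ler_pM2l// ltW.
  by move=> /(ler_wpM2l (cabs_ge0 (j v))); lra.
have [->|za] := eqVneq z a; first by rewrite !subrr cabs0 expr0n/= !mul0r.
have := F1 z Dz => /= Fz; have := FE z Dz za; rewrite !conj_gap.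
have : cabs (F z) ^+ 2 <= 1 by rewrite expr_le1 ?cabs_ge0.
have : 0 < Im (f z) * Im (f a) by rewrite mulr_gt0 ?f0.
have : 0 <= cabs (f z - f a) ^+ 2 by rewrite sqr_ge0.
have : 0 <= cabs (j z - j a) ^+ 2 by rewrite sqr_ge0.
set A := cabs (f z - f a) ^+ 2; set B := cabs (j z - j a) ^+ 2.
set k := cabs (F z) ^+ 2 => B0 A0 X0 k1 E.
have : k * ((A + 4 * Im (f z) * Im (f a)) * B) <=
    1 * ((A + 4 * Im (f z) * Im (f a)) * B).
  by rewrite ler_wpM2r// mulr_ge0//; lra.
by rewrite E; lra.
Qed.

Lemma rcontP {R : realType} (u : R[i] -> R) (z : R[i]) :
  rcont u z <-> {for z, continuous (u : R[i]^o -> R)}.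
Proof.
split=> [cu|/cvgrPdist_lt cu e e0].
  apply/(@cvgrPdist_lt _ R _ (nbhs (z : R[i]^o))) => e e0.
  have [r r0 H] := cu e e0; apply/nbhs_ballP; exists r%:C; first by rewrite /= ltcR.
  by move=> w; rewrite /ball/= normE ltcR cabsC distrC => /H.
have /nbhs_ballP[r /=] := cu e e0; case: r => r1 r2.
rewrite ltcE/= => /andP[/eqP->] r0 H; exists r1 => // w wr.
have /H : ball (z : R[i]^o) r1%:C w by rewrite /ball/= normE ltcR cabsC.
by rewrite /= distrC.
Qed.

Lemma rcontM {R : realType} (u v : R[i] -> R) (z : R[i]) :
  rcont u z -> rcont v z -> rcont (fun w => u w * v w) z.
Proof. by move=> /rcontP cu /rcontP cv; apply/rcontP; exact: (cvgM cu cv). Qed.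

Lemma rcontB {R : realType} (u v : R[i] -> R) (z : R[i]) :
  rcont u z -> rcont v z -> rcont (fun w => u w - v w) z.
Proof. by move=> /rcontP cu /rcontP cv; apply/rcontP; exact: (cvgB cu cv). Qed.

Lemma rcontD {R : realType} (u v : R[i] -> R) (z : R[i]) :
  rcont u z -> rcont v z -> rcont (fun w => u w + v w) z.
Proof. by move=> /rcontP cu /rcontP cv; apply/rcontP; exact: (cvgD cu cv). Qed.

Lemma rcont_cst {R : realType} (c : R) (z : R[i]) : rcont (fun=> c) z.
Proof. by move=> e e0; exists 1 => // w _; rewrite subrr normr0. Qed.

Lemma ccont_Im {R : realType} (f : R[i] -> R[i]) (z : R[i]) :
  ccont f z -> rcont (fun w => Im (f w)) z.
Proof.
move=> cf e e0; have [r r0 H] := cf e e0; exists r => // w /H.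
by apply: le_lt_trans; rewrite -cImB Im_le_cabs.
Qed.

Lemma ler_small {R : realType} (x y k : R) :
  (forall d, 0 < d -> d <= 1 -> x <= y + d * k) -> x <= y.
Proof.
move=> H; rewrite leNgt; apply/negP => yx.
have k1 : 0 < `|k| + 1 by rewrite ltr_wpDl.
pose d0 := (x - y) / (2 * (`|k| + 1)).
have d00 : 0 < d0 by rewrite divr_gt0 ?mulr_gt0 ?subr_gt0.
have [d [d0' d1 dd]] : exists d, [/\ 0 < d, d <= 1 & d <= d0].
  by exists (Num.min 1 d0); rewrite lt_min ltr01 d00 !ge_min !lexx orbT.
have := H d d0' d1.
have : d * k <= d0 * (`|k| + 1).
  rewrite (le_trans (ler_norm _))// normrM gtr0_norm// ler_pM//; lra.
rewrite (_ : d0 * _ = (x - y) / 2); first by lra.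
by rewrite /d0; field; rewrite gt_eqF.
Qed.

(** Both restrictions of the previous lemma are removed by limits: f + id has positive imaginary
    part for d > 0, and [a] is a limit of noncritical points, with both sides continuous in the base
    point. *)
Lemma schwarz_pick {R : realType} (D : set R[i]) (j f : R[i] -> R[i]) (a z : R[i]) :
  copen D -> (forall w, D w -> hol_at j w) -> (forall w, D w -> hol_at f w) ->
  {in D &, injective j} -> (forall w, D w -> 0 < Im (j w)) ->
  (forall w, D w -> 0 <= Im (f w)) -> proper_to_H D j -> D a -> D z ->
  cabs (f z - f a) ^+ 2 * (Im (j z) * Im (j a)) <=
  cabs (j z - j a) ^+ 2 * (Im (f z) * Im (f a)).
Proof.
move=> oD hj hf ij j0 f0 pj Da Dz.
pose L w := cabs (f z - f w) ^+ 2 * (Im (j z) * Im (j w)).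
pose U d w := cabs (j z - j w) ^+ 2 * ((Im (f z) + d) * (Im (f w) + d)).
have LU d w dj : 0 < d -> D w -> cdiff j w dj -> dj != 0 -> L w <= U d w.
  move=> d0 Dw jw jw0; pose fd v := f v + (0 +i* d).
  have := @schwarz_pick_noncritical R D j fd w dj z oD hj _ ij j0 _ pj Dw jw jw0 Dz.
  have E v : fd z - fd v = f z - f v by rewrite /fd; ring.
  rewrite E /fd !cImD/=; apply => v Dv.
    by apply: holD; [exact: hf|exact: hol_cst].
  by rewrite cImD/= ltr_wpDl ?f0.
have LUa d : 0 < d -> L a <= U d a.
  move=> d0; rewrite leNgt; apply/negP => lt.
  have cg (g : R[i] -> R[i]) : hol_at g a -> rcont (fun w => cabs (g z - g w) ^+ 2) a.
    move=> /hol_cont hg; have c1 : rcont (cabs \o (fun w => g z - g w)) a.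
      by apply: ccont_cabs; apply: ccontB => //; exact: ccont_cst.
    exact (rcontM _ _ _ c1 c1).
  have c : rcont (fun w => L w - U d w) a.
    apply: rcontB.
      apply: rcontM; first exact/cg/hf.
      by apply: rcontM; [exact: rcont_cst|exact/ccont_Im/hol_cont/hj].
    apply: rcontM; first exact/cg/hj.
    apply: rcontM; first exact: rcont_cst.
    by apply: rcontD; [exact/ccont_Im/hol_cont/hf|exact: rcont_cst].
  have e0 : 0 < L a - U d a by rewrite subr_gt0.
  have [r r0 H] := c _ e0.
  have [w [dj [Dw wr jw dj0]]] := noncritical_dense D j a r oD hj ij Da r0.
  have := LU d w dj d0 Dw jw dj0; have := H w wr.
  by rewrite ltr_norml => /andP[+ _]; lra.
apply: (ler_small _ _ (cabs (j z - j a) ^+ 2 * (Im (f z) + Im (f a) + 1))) => d d0 d1.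
apply: (le_trans (LUa d d0)); rewrite /U -subr_ge0.
rewrite (_ : _ - _ = d * (1 - d) * cabs (j z - j a) ^+ 2); last by ring.
by apply: mulr_ge0; rewrite ?sqr_ge0//; apply: mulr_ge0; lra.
Qed.

(** * Julia's lemma at infinity *)

Lemma cabs_iy {R : realType} (Y : R) : 0 <= Y -> cabs (0 +i* Y) = Y.
Proof. by move=> Y0; rewrite /cabs/= expr0n add0r sqrtr_sqr ger0_norm. Qed.

(** Schwarz-Pick with base point iY. The two distances to the base point and the two imaginary parts
    at it are controlled by Y + O(1); dividing by $Y^3$ and letting Y grow leaves the inequality
    between Im j(z) and Im f(z). *)
Lemma julia_id {R : realType} (D : set R[i]) (j f : R[i] -> R[i]) (C Y0 : R) :
  copen D -> (forall w, D w -> hol_at j w) -> (forall w, D w -> hol_at f w) ->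
  {in D &, injective j} -> (forall w, D w -> 0 < Im (j w)) ->
  (forall w, D w -> 0 <= Im (f w)) -> proper_to_H D j ->
  (forall Y, Y0 <= Y -> [/\ D (0 +i* Y), cabs (j (0 +i* Y) - (0 +i* Y)) <= C &
     cabs (f (0 +i* Y) - (0 +i* Y)) <= C]) ->
  forall z, D z -> Im (j z) <= Im (f z).
Proof.
move=> oD hj hf ij j0 f0 pj HY z Dz.
have C0 : 0 <= C by have [_ + _] := HY Y0 (lexx _); exact/le_trans/cabs_ge0.
pose K := C + cabs (f z) + cabs (j z) + 1.
have K1 : 1 <= K by rewrite lerDr !addr_ge0 ?cabs_ge0.
apply: (ler_small _ _ (3 * Im (j z) + 7 * Im (f z))) => d d0 d1.
(* [K] bounds all O(1) terms, and [Y] is so large that they are at most [d * Y]. *)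
pose Y := Num.max Y0 (K / d).
have YY0 : Y0 <= Y by rewrite le_max lexx.
have YKd : K <= d * Y by rewrite mulrC -ler_pdivrMr// le_max lexx orbT.
have KY : K <= Y by rewrite (le_trans YKd)// ler_piMl//; nra.
have Y_0 : 0 < Y by lra.
have [DY jY fY] := HY Y YY0; set y := 0 +i* Y in DY jY fY.
have := schwarz_pick D j f y z oD hj hf ij j0 f0 pj DY Dz.
have yY : cabs y = Y by rewrite cabs_iy// ltW.
have h1 : Y - K <= cabs (f z - f y).
  have := cabs_trans (f y) y (f z); have := le_cabsB y (f z).
  have := cabsC y (f y); have := cabsC (f y) (f z); rewrite yY /K.
  have := cabs_ge0 (j z); lra.
have h2 : cabs (j z - j y) <= Y + K.
  have := cabs_trans y (j z) (j y); have := cabsB (j z) y.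
  have := cabsC y (j y); rewrite yY /K.
  have := cabs_ge0 (f z); lra.
have h3 : Y - K <= Im (j y).
  have := Im_le_cabs (j y - y); rewrite cImB /= ler_norml => /andP[+ _].
  have := cabs_ge0 (f z); have := cabs_ge0 (j z); rewrite /K; lra.
have h4 : Im (f y) <= Y + K.
  have := Im_le_cabs (f y - y); rewrite cImB /= ler_norml => /andP[_ +].
  have := cabs_ge0 (f z); have := cabs_ge0 (j z); rewrite /K; lra.
have Jz := j0 z Dz; have Fz := f0 z Dz; have Fy := f0 y DY.
move: h1 h2 h3 h4 Jz Fz Fy.
set a := cabs _; set b := cabs (j z - j y); set J := Im (j z); set F := Im (f z).
set J' := Im (j y); set F' := Im (f y) => h1 h2 h3 h4 Jz Fz Fy h.
pose x := K / Y.
have xd : x <= d by rewrite ler_pdivrMr.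
have x0 : 0 <= x by rewrite divr_ge0 ?ltW//; lra.
have x1 : x <= 1 by lra.
have KE : K = x * Y by rewrite divfK// gt_eqF.
have l1 : ((1 - x) * Y) ^+ 2 * (J * ((1 - x) * Y)) <= a ^+ 2 * (J * J').
  have e1 : 0 <= (1 - x) * Y by rewrite mulr_ge0 ?subr_ge0// ltW.
  apply: (ler_pM (sqr_ge0 _) (mulr_ge0 (ltW Jz) e1)).
    by rewrite ler_sqr ?nnegrE ?cabs_ge0//; rewrite mulrBl mul1r -KE.
  by rewrite ler_pM2l// mulrBl mul1r -KE.
have l2 : b ^+ 2 * (F * F') <= ((1 + x) * Y) ^+ 2 * (F * ((1 + x) * Y)).
  apply: (ler_pM (sqr_ge0 _) (mulr_ge0 Fz Fy)).
    rewrite ler_sqr ?nnegrE ?cabs_ge0//; first by rewrite mulrDl mul1r -KE.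
    by rewrite mulr_ge0 ?addr_ge0// ltW.
  by rewrite ler_wpM2l// mulrDl mul1r -KE.
have := le_trans l1 (le_trans h l2).
rewrite (_ : _ * (J * _) = (1 - x) ^+ 3 * J * Y ^+ 3); last by ring.
rewrite [leRHS](_ : _ = (1 + x) ^+ 3 * F * Y ^+ 3); last by ring.
rewrite ler_pM2r ?exprn_gt0// => {}h.
have m1 : (1 - 3 * x) * J <= (1 - x) ^+ 3 * J.
  rewrite ler_pM2r// -subr_ge0 (_ : _ - _ = x ^+ 2 * (3 - x)); last by ring.
  by rewrite mulr_ge0 ?sqr_ge0//; lra.
have m2 : (1 + x) ^+ 3 * F <= (1 + 7 * x) * F.
  rewrite ler_wpM2r// -subr_ge0.
  rewrite (_ : _ - _ = x * ((1 - x) * (4 + x))); last by ring.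
  by apply: mulr_ge0 => //; apply: mulr_ge0; lra.
have m3 : x * (3 * J + 7 * F) <= d * (3 * J + 7 * F).
  by rewrite ler_wpM2r//; lra.
lra.
Qed.

(** Schwarz-Pick with base point iY, where now f(iY) tends to 0 and Y Im f(iY) is asymptotically at
    most [k]; both sides are divided by Y. For $f=\int\mu(dx)/(x-j)$ with $\mu$ positive of mass
    [k], the conclusion is the Cauchy-Schwarz inequality. *)
Lemma julia_decay {R : realType} (D : set R[i]) (j f : R[i] -> R[i]) (C k : R) :
  copen D -> (forall w, D w -> hol_at j w) -> (forall w, D w -> hol_at f w) ->
  {in D &, injective j} -> (forall w, D w -> 0 < Im (j w)) ->
  (forall w, D w -> 0 <= Im (f w)) -> proper_to_H D j -> 0 <= k -> 0 <= C ->
  (forall e, 0 < e -> exists Y0, forall Y, Y0 <= Y -> [/\ D (0 +i* Y),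
     cabs (j (0 +i* Y) - (0 +i* Y)) <= C, cabs (f (0 +i* Y)) <= e &
     Y * Im (f (0 +i* Y)) <= k + e]) ->
  forall z, D z -> cabs (f z) ^+ 2 * Im (j z) <= k * Im (f z).
Proof.
move=> oD hj hf ij j0 f0 pj k0 C0 HY z Dz.
pose K := C + cabs (j z) + 1.
have K1 : 1 <= K by rewrite lerDr !addr_ge0 ?cabs_ge0.
have Jz := j0 z Dz; have Fz := f0 z Dz.
have fz0 := cabs_ge0 (f z).
apply: (ler_small _ _ (Im (j z) * (2 * cabs (f z) + (cabs (f z) + 1) ^+ 2) +
  (3 * k + 4) * Im (f z))) => d d0 d1.
have [Y0 {}HY] := HY d d0.
pose Y := Num.max Y0 (K / d).
have YY0 : Y0 <= Y by rewrite le_max lexx.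
have YKd : K <= d * Y by rewrite mulrC -ler_pdivrMr// le_max lexx orbT.
have KY : K <= Y by rewrite (le_trans YKd)// ler_piMl//; nra.
have Y_0 : 0 < Y by lra.
have [DY jY fY FY] := HY Y YY0; set y := 0 +i* Y in DY jY fY FY.
have := schwarz_pick D j f y z oD hj hf ij j0 f0 pj DY Dz.
have yY : cabs y = Y by rewrite cabs_iy// ltW.
have h1 : `|cabs (f z - f y) - cabs (f z)| <= d.
  by rewrite (le_trans (cabs_dist _ _))// addrC addKr cabsN.
have h2 : cabs (j z - j y) <= Y + K.
  have := cabs_trans y (j z) (j y); have := cabsB (j z) y.
  by have := cabsC y (j y); rewrite yY /K; lra.
have h3 : Y - K <= Im (j y).
  have := Im_le_cabs (j y - y); rewrite cImB /= ler_norml => /andP[+ _].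
  by have := cabs_ge0 (j z); rewrite /K; lra.
have Fy := f0 y DY; have := cabs_ge0 (f z - f y).
move: h1 h2 h3 Jz Fz Fy fz0 FY.
set a := cabs (f z - f y); set b := cabs (j z - j y); set J := Im (j z).
set F := Im (f z); set c := cabs (f z).
set J' := Im (j y); set F' := Im (f y) => + h2 h3 Jz Fz Fy c0 FY a0 h.
rewrite ler_norml => /andP[h11 h12].
pose x := K / Y.
have xd : x <= d by rewrite ler_pdivrMr.
have x0 : 0 <= x by rewrite divr_ge0 ?ltW//; lra.
have x1 : x <= 1 by lra.
have KE : K = x * Y by rewrite divfK// gt_eqF.
have aa : 0 <= a ^+ 2 by exact: sqr_ge0.
have l1 : a ^+ 2 * J * (1 - x) * Y <= a ^+ 2 * (J * J').
  have h3x : (1 - x) * Y <= J' by rewrite mulrBl mul1r -KE.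
  by have := ler_wpM2l aa (ler_wpM2l (ltW Jz) h3x); lra.
have l2 : b ^+ 2 * (F * F') * Y <= ((1 + x) * Y) ^+ 2 * (F * (k + d)).
  rewrite -mulrA; apply: (ler_pM (sqr_ge0 _) (mulr_ge0 (mulr_ge0 Fz Fy) (ltW Y_0))).
    rewrite ler_sqr ?nnegrE ?cabs_ge0//; first by rewrite mulrDl mul1r -KE.
    by rewrite mulr_ge0 ?addr_ge0// ltW.
  by rewrite -mulrA ler_wpM2l// mulrC.
have h' : a ^+ 2 * J * (1 - x) * Y * Y <= ((1 + x) * Y) ^+ 2 * (F * (k + d)).
  by apply: le_trans l2; rewrite ler_pM2r// (le_trans l1).
have {h'} : a ^+ 2 * J * (1 - x) <= (1 + x) ^+ 2 * (F * (k + d)).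
  rewrite -(ler_pM2r (exprn_gt0 2 Y_0)); move: h'.
  by rewrite exprMn expr2 !mulrA mulrAC; lra.
move=> h'.
have m1 : (c ^+ 2 - d * (2 * c + (c + 1) ^+ 2)) * J <= a ^+ 2 * J * (1 - x).
  rewrite mulrAC ler_pM2r//.
  have a2 : c ^+ 2 - 2 * d * c <= a ^+ 2.
    have [dc|cd] := leP d c; last first.
      apply: le_trans aa; rewrite expr2 -mulrBl.
      by rewrite nmulr_rle0//; nra.
    apply: (@le_trans _ _ ((c - d) ^+ 2)); last first.
      by rewrite ler_sqr ?nnegrE//; lra.
    by rewrite -subr_ge0 (_ : _ - _ = d ^+ 2) ?sqr_ge0//; ring.
  have a3 : x * a ^+ 2 <= d * (c + 1) ^+ 2.
    apply: ler_pM => //; rewrite ler_sqr ?nnegrE//; lra.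
  lra.
have m2 : (1 + x) ^+ 2 * (F * (k + d)) <= (k + d * (3 * k + 4)) * F.
  rewrite [X in _ * X]mulrC mulrA ler_wpM2r//.
  have : (1 + x) ^+ 2 <= 1 + 3 * d.
    rewrite expr2; have : x * x <= d * 1 by apply: ler_pM.
    lra.
  move=> q; apply: (@le_trans _ _ ((1 + 3 * d) * (k + d))).
    by rewrite ler_wpM2r// addr_ge0// ltW.
  have : d * d <= d * 1 by rewrite ler_pM2l.
  lra.
lra.
Qed.

(** * Conformal maps of complements of hulls *)

Definition dom {R : realType} (K : set R[i]) : set R[i] :=
  @upper_half_plane R `\` K.

Lemma map_hol {R : realType} (K : set R[i]) (t : R) (g : R[i] -> R[i]) (z : R[i]) :
  mapping_out K t g -> dom K z -> hol_at g z.
Proof. by move=> [hg _ _] Dz; constructor; exact: hg. Qed.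

Lemma map_inj {R : realType} (K : set R[i]) (t : R) (g : R[i] -> R[i]) :
  mapping_out K t g -> {in dom K &, injective g}.
Proof. by move=> [_ [_ ig _] _]. Qed.

Lemma map_im {R : realType} (K : set R[i]) (t : R) (g : R[i] -> R[i]) (z : R[i]) :
  mapping_out K t g -> dom K z -> 0 < Im (g z).
Proof. by move=> [_ [fg _ _] _] Dz; exact: (fg z Dz). Qed.

Lemma map_surj {R : realType} (K : set R[i]) (t : R) (g : R[i] -> R[i]) (w : R[i]) :
  mapping_out K t g -> 0 < Im w -> exists z, dom K z /\ g z = w.
Proof. by move=> [_ [_ _ sg] _] w0; have [z Dz <-] := sg w w0; exists z. Qed.

Lemma map_expansion {R : realType} (K : set R[i]) (t : R) (g : R[i] -> R[i]) :
  mapping_out K t g -> forall e : R, 0 < e -> exists M : R, forall z, dom K z ->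
    M < cabs z -> cabs (g z - (z + (2 * t)%:C / z)) <= e / cabs z.
Proof.
move=> [_ _ eg] e e0; have [M H] := eg e e0; exists M => z Dz zM.
have := H z Dz; rewrite normE ltcR => /(_ zM).
by rewrite !normE cabsV -rmorphM lecR.
Qed.

Lemma dom_iy {R : realType} (K : set R[i]) (B Y : R) : 0 < B ->
  (forall z, K z -> cabs z <= B) -> B < Y -> dom K (0 +i* Y).
Proof.
move=> B0 KB BY; have Y0 : 0 < Y by lra.
by split => // /KB; rewrite cabs_iy ?(ltW Y0)// leNgt BY.
Qed.

Lemma map_iy {R : realType} (K : set R[i]) (B t : R) (g : R[i] -> R[i]) : 0 < B ->
  (forall z, K z -> cabs z <= B) -> mapping_out K t g ->
  forall e : R, 0 < e -> exists2 Y0 : R, B < Y0 & forall Y, Y0 <= Y ->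
    cabs (g (0 +i* Y) - (0 +i* (Y - 2 * t / Y))) <= e / Y.
Proof.
move=> B0 KB mg e e0; have [M H] := map_expansion _ _ _ mg e e0.
exists (Num.max B M + 1) => [|Y].
  by rewrite ltr_pwDr// le_max lexx.
have : B <= Num.max B M by rewrite le_max lexx.
have : M <= Num.max B M by rewrite le_max lexx orbT.
move=> h1 h2 h3; have BY : B < Y by lra.
have Y0 : 0 < Y by lra.
have := H _ (dom_iy K B Y B0 KB BY); rewrite cabs_iy ?(ltW Y0)//.
rewrite (_ : 0 +i* (Y - 2 * t / Y) = (0 +i* Y) + (2 * t)%:C / (0 +i* Y)).
  by apply; lra.
apply: complexP; rewrite /= ?expr0n/= ?add0r; field; lra.
Qed.

Definition minv {R : realType} (K : set R[i]) (g : R[i] -> R[i]) (w : R[i]) : R[i] :=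
  xget 0 [set z | dom K z /\ g z = w].

Lemma minvP {R : realType} (K : set R[i]) (t : R) (g : R[i] -> R[i]) (w : R[i]) :
  mapping_out K t g -> 0 < Im w -> dom K (minv K g w) /\ g (minv K g w) = w.
Proof.
move=> mg w0; rewrite /minv; have [z zP] := map_surj _ _ _ _ mg w0.
by case: xgetP => [y _ //|/(_ z)]; case.
Qed.

Lemma minvK {R : realType} (K : set R[i]) (t : R) (g : R[i] -> R[i]) (z : R[i]) :
  mapping_out K t g -> dom K z -> minv K g (g z) = z.
Proof.
move=> mg Dz; have [h1 h2] := minvP _ _ _ _ mg (map_im _ _ _ _ mg Dz).
by apply: (map_inj _ _ _ mg) => //; exact/mem_set.
Qed.

Lemma minv_cont {R : realType} (K : set R[i]) (t : R) (g : R[i] -> R[i]) (w : R[i]) :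
  copen (dom K) -> mapping_out K t g -> 0 < Im w -> ccont (minv K g) w.
Proof.
move=> oK mg w0 e e0; have [Dz gz] := minvP _ _ _ _ mg w0.
have [d d0 H] := open_mapping (dom K) g (minv K g w) e oK
  (fun w Dw => map_hol _ _ _ _ mg Dw) (map_inj _ _ _ mg) Dz e0.
exists d => // w'; rewrite -{1}gz => /H[z [Dz' zw <-]].
by rewrite (minvK _ _ _ _ mg Dz').
Qed.

Lemma minv_qcont {R : realType} (K : set R[i]) (t : R) (g : R[i] -> R[i])
    (P : set (R * R)) :
  copen (dom K) -> mapping_out K t g -> (forall p, P p -> 0 < p.2) ->
  qcont P (fun p => minv K g (p.1 +i* p.2)).
Proof.
move=> oK mg P0 p Pp e e0.
have [d d0 H] := minv_cont _ _ _ (p.1 +i* p.2) oK mg (P0 p Pp) _ e0.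
exists (d / 2) => [|p' Pp' h1 h2]; first by rewrite divr_gt0.
apply: H; rewrite (_ : _ - _ = (p'.1 - p.1) +i* (p'.2 - p.2)).
  by rewrite (le_lt_trans (cabs_le_ReIm _))//= (splitr d) ltrD.
by apply: complexP.
Qed.

Lemma half_closed {R : realType} (eta a b : R) (p : R * R) :
  ~ (eta <= p.2 /\ b <= (p.1 - a) ^+ 2 + p.2 ^+ 2) ->
  exists2 d : R, 0 < d & forall p' : R * R,
     `|p'.1 - p.1| < d -> `|p'.2 - p.2| < d ->
     ~ (eta <= p'.2 /\ b <= (p'.1 - a) ^+ 2 + p'.2 ^+ 2).
Proof.
move=> np; have [pe|pe] := leP eta p.2; last first.
  exists (eta - p.2) => [|p' _]; first by rewrite subr_gt0.
  by rewrite ltr_norml => /andP[_ h] [h' _]; lra.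
have pb : (p.1 - a) ^+ 2 + p.2 ^+ 2 < b by rewrite ltNge; apply/negP => h; apply: np.
have cf : {for p, continuous (fun p : R * R => (p.1 - a) ^+ 2 + p.2 ^+ 2)}.
  apply: cvgD; rewrite expr2; last by apply: cvgM; exact: cvg_snd.
  by apply: cvgM; (apply: cvgB; [exact: cvg_fst|exact: cvg_cst]).
have k0 : 0 < b - ((p.1 - a) ^+ 2 + p.2 ^+ 2) by rewrite subr_gt0.
move/cvgrPdist_lt : cf => /(_ _ k0)/nbhs_ballP[d /= d0 H].
exists d => // p' b1 b2 [_ E].
have : ball p d p' by split; rewrite /= /ball/= distrC.
by move=> /H /=; rewrite ltr_norml => /andP[+ _]; lra.
Qed.

Lemma map_proper {R : realType} (K : set R[i]) (t : R) (g : R[i] -> R[i]) :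
  copen (dom K) -> mapping_out K t g -> proper_to_H (dom K) g.
Proof.
move=> oK mg eta M eta0.
(* With centre and bound 0, [half_closed] only imposes the height bound; the compact set is the
   image of a rectangle under the inverse map. *)
exists [set p : R * R | [/\ `|p.1| <= M, `|p.2| <= M &
  eta <= p.2 /\ 0 <= (p.1 - 0) ^+ 2 + p.2 ^+ 2]], (fun p => minv K g (p.1 +i* p.2)).
split.
- by apply: (compact_rect M); exact: half_closed.
- by move=> p [_ _ [h _]]; apply: (minvP _ _ _ _ mg _).1 => /=; lra.
- by apply: (minv_qcont _ _ _ _ oK mg) => p [_ _ [h _]]; lra.
move=> z Dz ez zM; exists (Re (g z), Im (g z)).
  split => /=; last by rewrite addr_ge0 ?sqr_ge0.
    by rewrite (le_trans (Re_le_cabs _)).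
  by rewrite (le_trans (Im_le_cabs _)).
rewrite /= (_ : _ +i* _ = g z); first exact: minvK mg Dz.
by case: (g z).
Qed.

(* Two maps of a Loewner chain at times [s < t], such that [G] sends the part of
   the curve grown in between into the disk of centre [W0] and radius [r]. *)
Record lpair {R : realType} (K1 K2 : set R[i]) (s t : R) (G w : R[i] -> R[i])
    (W0 r : R) : Prop := LPair {
  lp_sub : K1 `<=` K2 ;
  lp_bound : exists2 B : R, 0 < B & forall z, K2 z -> cabs z <= B ;
  lp_open1 : copen (dom K1) ;
  lp_open2 : copen (dom K2) ;
  lp_map1 : mapping_out K1 s G ;
  lp_map2 : mapping_out K2 t w ;
  lp_s0 : 0 <= s ;
  lp_st : s < t ;
  lp_r0 : 0 < r ;
  lp_cr : 2 * (t - s) <= r ^+ 2 ;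
  lp_loc : forall z, K2 z -> dom K1 z -> cabs (G z - W0%:C) <= r }.

(** * Comparison of two maps of a Loewner chain *)

Lemma lp_dom {R : realType} (K1 K2 : set R[i]) s t G w (W0 r : R) z :
  lpair K1 K2 s t G w W0 r -> dom K2 z -> dom K1 z.
Proof. by move=> L [Hz nz]; split => // /(lp_sub _ _ _ _ _ _ _ _ L). Qed.

(** On the imaginary axis $z+2t/z$ equals $i(Y-2t/Y)$. Subtracting the two expansions gives
    $G-w=ic/Y+o(1/Y)$ with $c=2(t-s)$. *)
Lemma lp_iy {R : realType} (K1 K2 : set R[i]) s t G w (W0 r : R) :
  lpair K1 K2 s t G w W0 r -> forall e, 0 < e -> exists2 Y0, 1 < Y0 &
   forall Y, Y0 <= Y -> [/\ dom K2 (0 +i* Y),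
     cabs (G (0 +i* Y) - (0 +i* Y)) <= 2 * s + 1,
     cabs (w (0 +i* Y) - (0 +i* Y)) <= 2 * t + 1,
     cabs (G (0 +i* Y) - w (0 +i* Y)) <= e &
     Y * Im (G (0 +i* Y) - w (0 +i* Y)) <= 2 * (t - s) + e].
Proof.
move=> L e e0; have [B B0 KB] := lp_bound _ _ _ _ _ _ _ _ L.
have KB1 z : K1 z -> cabs z <= B by move=> /(lp_sub _ _ _ _ _ _ _ _ L)/KB.
have [k [k0 ke k1]] : exists k, [/\ 0 < k, k <= e / 2 & k <= 1].
  exists (Num.min (e / 2) 1).
  by rewrite lt_min divr_gt0// ltr01 !ge_min !lexx orbT.
have [Y1 BY1 H1] := map_iy _ _ _ _ B0 KB1 (lp_map1 _ _ _ _ _ _ _ _ L) _ k0.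
have [Y2 BY2 H2] := map_iy _ _ _ _ B0 KB (lp_map2 _ _ _ _ _ _ _ _ L) _ k0.
have s0 := lp_s0 _ _ _ _ _ _ _ _ L; have st := lp_st _ _ _ _ _ _ _ _ L.
pose c := 2 * (t - s).
exists (Num.max (Num.max Y1 Y2) (Num.max 2 ((c + e) / e))).
  by rewrite !lt_max; apply/orP; right; rewrite ltr1n.
move=> Y; rewrite !ge_max => /andP[/andP[hY1 hY2] /andP[Y2' YE]].
have Y0 : 0 < Y by lra.
have := H1 Y hY1; have := H2 Y hY2.
have kY : k / Y <= k by rewrite ler_pdivrMr// ler_peMr ?(ltW k0)//; lra.
have split1 (x : R) : 0 <= x -> x / Y <= x.
  by move=> x0; rewrite ler_pdivrMr// ler_peMr//; lra.
set y := 0 +i* Y => h2 h1.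
have dy q : cabs ((0 +i* (Y - q / Y)) - y) = `|q| / Y.
  rewrite (_ : _ - y = 0 +i* (- (q / Y))); last by apply: complexP => /=; ring.
  by rewrite /cabs/= expr0n add0r sqrtr_sqr normrN normrM normfV (gtr0_norm Y0).
have hh : cabs (G y - w y - (0 +i* (c / Y))) <= e / Y.
  rewrite (_ : _ - _ = (G y - (0 +i* (Y - 2 * s / Y))) - (w y - (0 +i* (Y - 2 * t / Y)))).
    rewrite (le_trans (cabsB _ _))//.
    have : k / Y <= e / 2 / Y by rewrite ler_pM2r// invr_gt0.
    lra.
  have -> : 0 +i* (c / Y) = (0 +i* (Y - 2 * s / Y)) - (0 +i* (Y - 2 * t / Y)).
    by apply: complexP; rewrite /= /c; ring.
  by ring.
split.
- by apply: (dom_iy _ _ _ B0 KB); lra.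
- have := cabs_trans (0 +i* (Y - 2 * s / Y)) (G y) y; rewrite dy.
  have := split1 `|2 * s| (normr_ge0 _); rewrite ger0_norm ?mulr_ge0//; lra.
- have := cabs_trans (0 +i* (Y - 2 * t / Y)) (w y) y; rewrite dy.
  have := split1 `|2 * t| (normr_ge0 _); rewrite ger0_norm ?mulr_ge0//; lra.
- have := cabs_leD (G y - w y) (0 +i* (c / Y)).
  have c0 : 0 <= c by rewrite mulr_ge0//; lra.
  rewrite cabs_iy ?divr_ge0// ?(ltW Y0)// => /le_trans; apply.
  apply: (@le_trans _ _ ((c + e) / Y)); first by rewrite mulrDl lerD2l.
  by rewrite ler_pdivrMr// mulrC -ler_pdivrMr.
have := le_trans (ler_norm _) (le_trans (Im_le_cabs _) hh).
rewrite (cImB (G y - w y)) => h; have {h} : Im (G y - w y) - c / Y <= e / Y := h.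
move=> /(ler_wpM2l (ltW Y0)); rewrite mulrBr !(mulrC Y (_ / _)) !divfK ?gt_eqF//.
by rewrite /c; lra.
Qed.

Section Pair.
Context {R : realType} {K1 K2 : set R[i]} {s t : R} {G w : R[i] -> R[i]} {W0 r : R}.
Hypothesis L : lpair K1 K2 s t G w W0 r.

Let c := 2 * (t - s).
Let c0 : 0 < c. Proof. by rewrite mulr_gt0// subr_gt0 (lp_st _ _ _ _ _ _ _ _ L). Qed.
Let r0 : 0 < r := lp_r0 _ _ _ _ _ _ _ _ L.
Let cr : c <= r ^+ 2 := lp_cr _ _ _ _ _ _ _ _ L.
Let oK : copen (dom K2) := lp_open2 _ _ _ _ _ _ _ _ L.
Let mw : mapping_out K2 t w := lp_map2 _ _ _ _ _ _ _ _ L.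
Let mG : mapping_out K1 s G := lp_map1 _ _ _ _ _ _ _ _ L.
Let s0 : 0 <= s := lp_s0 _ _ _ _ _ _ _ _ L.
Let st : s < t := lp_st _ _ _ _ _ _ _ _ L.
Let D12 z : dom K2 z -> dom K1 z := lp_dom _ _ _ _ _ _ _ _ _ L.

Lemma lp_hol z : dom K2 z -> hol_at (fun z => G z - w z) z.
Proof.
by move=> Dz; apply: holB; [exact: map_hol mG (D12 _ Dz)|exact: map_hol mw Dz].
Qed.

(** Julia's lemma for [G] with [w] as reference map; both are at bounded distance from the identity
    on the imaginary axis. *)
Lemma lp_Im_le z : dom K2 z -> Im (w z) <= Im (G z).
Proof.
have [Y0 _ H] := lp_iy _ _ _ _ _ _ _ _ L 1 ltr01.
apply: (julia_id (dom K2) w G (2 * t + 1) Y0) => //.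
- by move=> v; exact: map_hol mw.
- by move=> v /D12; exact: map_hol mG.
- exact: map_inj mw.
- by move=> v; exact: map_im mw.
- by move=> v /D12 Dv; exact: ltW (map_im _ _ _ _ mG Dv).
- exact: map_proper mw.
by move=> Y /H[h1 h2 h3 _ _]; split => //; have := st; lra.
Qed.

(** By [lp_Im_le] and [lp_iy], G - w maps into the closed half-plane and decays like ic/Y, as
    [julia_decay] requires. *)
Lemma lp_decay z : dom K2 z ->
  cabs (G z - w z) ^+ 2 * Im (w z) <= c * Im (G z - w z).
Proof.
apply: (julia_decay (dom K2) w (fun z => G z - w z) (2 * t + 1)) => //.
- by move=> v; exact: map_hol mw.
- exact: lp_hol.
- exact: map_inj mw.
- by move=> v; exact: map_im mw.
- by move=> v Dv; rewrite cImB subr_ge0 lp_Im_le.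
- exact: map_proper mw.
- exact: ltW.
- by have := s0; have := st; lra.
move=> e e0; have [Y0 _ H] := lp_iy _ _ _ _ _ _ _ _ L e e0.
by exists Y0 => Y /H[].
Qed.

Lemma lp_small z : dom K2 z -> cabs (G z - w z) * Im (w z) <= c.
Proof.
move=> Dz; have := lp_decay _ Dz; have wz := map_im _ _ _ _ mw Dz.
have [->|h0] := eqVneq (G z - w z) 0; first by rewrite cabs0 mul0r (ltW c0).
have h1 : 0 < cabs (G z - w z) by rewrite cabs_gt0.
have h2 : c * Im (G z - w z) <= c * cabs (G z - w z).
  by rewrite ler_pM2l// (le_trans (ler_norm _))// Im_le_cabs.
move=> h3; have {h2 h3} h4 := le_trans h3 h2.
rewrite -(ler_pM2l h1).
by rewrite [leRHS]mulrC (le_trans _ h4)// expr2 mulrA.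
Qed.

(* The Joukowski map of the exterior of the localising disk serves as reference
   map in the Schwarz-Pick lemma. *)
Let zeta z := G z - W0%:C.
Let jk z := zeta z + (r ^+ 2)%:C / zeta z.
Let Om : set R[i] := [set z | dom K2 z /\ r < cabs (zeta z)].

Let Im_zeta z : Im (zeta z) = Im (G z).
Proof. by rewrite /zeta cImB/= subr0. Qed.

Let zeta0 z : dom K1 z -> zeta z != 0.
Proof.
move=> Dz; apply/eqP => E; have := map_im _ _ _ _ mG Dz.
by rewrite -Im_zeta E ltxx.
Qed.

Let Im_jk z : Im (jk z) = Im (G z) * (1 - r ^+ 2 / cabs (zeta z) ^+ 2).
Proof.
rewrite /jk cImD cImM cImV Im_zeta/= mul0r addr0; ring.
Qed.

Let jk_pos z : Om z -> 0 < Im (jk z).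
Proof.
move=> [Dz rz]; have zr : 0 < cabs (zeta z) by exact: lt_trans rz.
rewrite Im_jk mulr_gt0 ?(map_im _ _ _ _ mG (D12 _ Dz))// subr_gt0.
by rewrite ltr_pdivrMr ?exprn_gt0// mul1r ltr_sqr ?nnegrE ?ltW.
Qed.

(** The difference of two values is $(\zeta_a-\zeta_b)(1-r^2/(\zeta_a\zeta_b))$, and the second
    factor does not vanish outside the disc. *)
Let jk_inj : {in Om &, injective jk}.
Proof.
move=> a b /set_mem[Da ra] /set_mem[Db rb] E.
have za := zeta0 _ (D12 _ Da); have zb := zeta0 _ (D12 _ Db).
suff : zeta a = zeta b.
  by move=> /(congr1 (+%R^~ W0%:C)); rewrite !subrK;
    apply: (map_inj _ _ _ mG); apply/mem_set/D12.
apply/eqP; rewrite -subr_eq0.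
have : (zeta a - zeta b) * (1 - (r ^+ 2)%:C / (zeta a * zeta b)) = 0.
  transitivity (jk a - jk b); last by rewrite E subrr.
  by rewrite /jk; field; rewrite za zb.
move=> /eqP; rewrite mulf_eq0 => /orP[//|/eqP/subr0_eq /(congr1 cabs)].
have ab : 0 < cabs (zeta a * zeta b) by rewrite cabs_gt0 mulf_neq0.
rewrite cabsM cabsV cabs_real ger0_norm ?sqr_ge0//.
rewrite -[X in cabs X = _]/(1%:C) cabs_real normr1 => E1.
have : r * r < cabs (zeta a) * cabs (zeta b) by rewrite ltr_pM ?ltW.
rewrite -cabsM -[ltRHS]mul1r E1 divfK ?(lt0r_neq0 ab)//.
by rewrite expr2 ltxx.
Qed.

Let Om_open : copen Om.
Proof.
move=> z [Dz rz]; have [d1 d10 H1] := oK z Dz.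
have cz : ccont zeta z.
  by apply: ccontB; [exact/hol_cont/(map_hol _ _ _ _ mG)/D12|exact: ccont_cst].
have [|d2 d20 H2] := ccont_cabs _ _ cz (cabs (zeta z) - r); first by rewrite subr_gt0.
exists (Num.min d1 d2) => [|v]; first by rewrite lt_min d10.
rewrite lt_min => /andP[/H1 Dv /H2 b]; split => //.
by move: b; rewrite /= ltr_norml => /andP[+ _]; lra.
Qed.

Let jk_hol z : Om z -> hol_at jk z.
Proof.
move=> [Dz _]; have hz : hol_at zeta z.
  by apply: holB; [exact/(map_hol _ _ _ _ mG)/D12|exact: hol_cst].
apply: holD => //; apply: holM; first exact: hol_cst.
by apply: holV => //; exact/zeta0/D12.
Qed.

(** By [lp_loc] the added hull is sent into the disc of radius [r], so [Om] is the exterior of that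
    disc pulled back by [G]. Its compact pieces are therefore images under the inverse of [G]. *)
Let jk_proper : proper_to_H Om jk.
Proof.
move=> eta M eta0; pose M' := `|W0| + `|M| + r.
have M'0 : 0 < M' by rewrite ltr_wpDl ?addr_ge0.
(* If the Joukowski map has height at least [eta] and Im G is at most M', then
   $1-r^2/|\zeta|^2\ge\eta/M'$, whence $|\zeta|^2\ge b$. *)
pose b := r ^+ 2 * (1 + eta / M').
exists [set p : R * R | [/\ `|p.1| <= M', `|p.2| <= M' &
  eta <= p.2 /\ b <= (p.1 - W0) ^+ 2 + p.2 ^+ 2]], (fun p => minv K1 G (p.1 +i* p.2)).
split.
- by apply: (compact_rect M'); exact: half_closed.
- move=> p [_ _ [h1 h2]].
  have [|Dz Gz] := minvP _ _ _ (p.1 +i* p.2) mG; first by rewrite /=; lra.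
  have rz : r < cabs (zeta (minv K1 G (p.1 +i* p.2))).
    rewrite -(@ltr_pXn2r _ 2%N) ?nnegrE ?cabs_ge0 ?(ltW r0)//.
    rewrite /zeta Gz cabs_sqr/= subr0; apply: lt_le_trans h2.
    by rewrite /b ltr_pMr ?exprn_gt0// ltrDl divr_gt0.
  split => //; split; first by case: Dz.
  by move=> /(lp_loc _ _ _ _ _ _ _ _ L)/(_ Dz); rewrite leNgt rz.
- apply: (minv_qcont _ _ _ _ (lp_open1 _ _ _ _ _ _ _ _ L) mG).
  by move=> p [_ _ [h _]]; lra.
move=> z [Dz rz] ez zM; have D1z := D12 _ Dz.
have Gz := map_im _ _ _ _ mG D1z.
have z0 : 0 < cabs (zeta z) by exact: lt_trans rz.
have zM' : cabs (zeta z) <= `|M| + r.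
  have -> : zeta z = jk z - (r ^+ 2)%:C / zeta z by rewrite /jk addrK.
  rewrite (le_trans (cabsB _ _))// lerD//; first exact: le_trans (ler_norm _).
  rewrite cabsM cabsV cabs_real ger0_norm ?sqr_ge0// ler_pdivrMr// expr2.
  by rewrite ler_pM2l// ltW.
have GM : cabs (G z) <= M'.
  rewrite -(subrK W0%:C (G z)) (le_trans (cabsD _ _))// cabs_real.
  by move: zM'; rewrite /zeta /M'; lra.
exists (Re (G z), Im (G z)); last first.
  by rewrite (_ : _ +i* _ = G z) ?(minvK _ _ _ _ mG)//; case: (G z).
move: ez; rewrite Im_jk => ez.
have q1 : r ^+ 2 / cabs (zeta z) ^+ 2 < 1.
  by rewrite ltr_pdivrMr ?exprn_gt0// mul1r ltr_sqr ?nnegrE ?ltW.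
have q0 : 0 < r ^+ 2 / cabs (zeta z) ^+ 2 by rewrite divr_gt0 ?exprn_gt0.
split => /=.
- by rewrite (le_trans (Re_le_cabs _)).
- by rewrite (le_trans (Im_le_cabs _)).
split.
  apply: (le_trans ez); rewrite ler_piMr ?(ltW Gz)//; lra.
have ImM : Im (G z) <= M' by rewrite (le_trans (ler_norm _))// (le_trans (Im_le_cabs _)).
rewrite (_ : _ + _ = cabs (zeta z) ^+ 2); last first.
  by rewrite cabs_sqr /zeta cReB cImB/= subr0.
have e1 : eta / M' <= 1 - r ^+ 2 / cabs (zeta z) ^+ 2.
  rewrite ler_pdivrMr// mulrC (le_trans ez)// ler_wpM2r//; lra.
set x := cabs (zeta z) ^+ 2 in q0 q1 e1 *.
have x0 : 0 < x by rewrite exprn_gt0.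
have rE : r ^+ 2 = (r ^+ 2 / x) * x by rewrite divfK// gt_eqF.
rewrite /b rE -[leRHS]mul1r mulrAC ler_pM2r//.
set q := r ^+ 2 / x in q0 q1 e1 *; set y := eta / M' in e1 *.
have y0 : 0 < y by rewrite divr_gt0.
apply: (@le_trans _ _ (q * (1 + (1 - q)))); first by rewrite ler_pM2l//; lra.
by rewrite -subr_ge0 (_ : _ - _ = (1 - q) ^+ 2) ?sqr_ge0//; ring.
Qed.

Let jk_iy : exists2 Y0, 1 < Y0 & forall Y, Y0 <= Y -> Om (0 +i* Y) /\
  cabs (jk (0 +i* Y) - (0 +i* Y)) <= 2 * t + 1 + `|W0| + r.
Proof.
have [Y1 Y11 H] := lp_iy _ _ _ _ _ _ _ _ L 1 ltr01.
exists (Num.max Y1 (2 * t + 1 + `|W0| + r + 1)) => [|Y].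
  by rewrite lt_max Y11.
rewrite ge_max => /andP[/H[h1 h2 _ _ _]]; set y := 0 +i* Y in h1 h2 * => hY.
have W00 := normr_ge0 W0.
have yz : cabs (zeta y - y) <= 2 * s + 1 + `|W0|.
  rewrite /zeta addrAC (le_trans (cabsB _ _))// cabs_real; have := st; lra.
have [hs0 hst hr0] := And3 s0 st r0.
have yY : cabs y = Y by rewrite cabs_iy//; lra.
have rz : r < cabs (zeta y).
  by have := cabs_leD y (zeta y); rewrite (cabsC y) yY; lra.
split => //; rewrite /jk addrAC (le_trans (cabsD _ _))//.
have : cabs ((r ^+ 2)%:C / zeta y) <= r.
  have z0 : 0 < cabs (zeta y) by exact: lt_trans rz.
  rewrite cabsM cabsV cabs_real ger0_norm ?sqr_ge0// ler_pdivrMr// expr2.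
  by rewrite ler_pM2l// ltW.
lra.
Qed.

(** Julia's lemma with the Joukowski map as reference bounds Im w from below by
    $\mathrm{Im}\,G\,(1-r^2/|\zeta|^2)$. *)
Lemma lp_gap z : dom K2 z -> r < cabs (G z - W0%:C) ->
  Im (G z - w z) <= r ^+ 2 / cabs (G z - W0%:C) ^+ 2 * Im (G z).
Proof.
move=> Dz rz; have [Y1 _ H1] := jk_iy.
have [Y2 _ H2] := lp_iy _ _ _ _ _ _ _ _ L 1 ltr01.
have : Im (jk z) <= Im (w z).
  apply: (julia_id Om jk w (2 * t + 1 + `|W0| + r) (Num.max Y1 Y2)) => //.
  - by move=> v [Dv _]; exact: map_hol mw Dv.
  - by move=> v [Dv _]; exact/ltW/(map_im _ _ _ _ mw).
  move=> Y; rewrite ge_max => /andP[/H1[? ?] /H2[_ _ ? _ _]]; split => //.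
  by have := normr_ge0 W0; have := r0; lra.
by rewrite Im_jk cImB -/(zeta z); lra.
Qed.

Lemma lp_decay_ext z : dom K2 z -> r < cabs (G z - W0%:C) ->
  cabs (G z - w z) ^+ 2 * (1 - r ^+ 2 / cabs (G z - W0%:C) ^+ 2) * Im (G z) <=
  c * Im (G z - w z).
Proof.
move=> Dz rz; have [Y1 _ H1] := jk_iy.
have : cabs (G z - w z) ^+ 2 * Im (jk z) <= c * Im (G z - w z).
  apply: (julia_decay Om jk (fun z => G z - w z) (2 * t + 1 + `|W0| + r)) => //.
  - by move=> v [Dv _]; exact: lp_hol.
  - by move=> v [Dv _]; rewrite cImB subr_ge0 lp_Im_le.
  - exact: ltW.
  - by have := normr_ge0 W0; have := s0; have := st; have := r0; lra.
  move=> e e0; have [Y2 _ H2] := lp_iy _ _ _ _ _ _ _ _ L e e0.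
  exists (Num.max Y1 Y2) => Y.
  by rewrite ge_max => /andP[/H1[? ?] /H2[_ _ _ ? ?]].
by rewrite Im_jk -/(zeta z); lra.
Qed.

(** Here $r^2/|\zeta|^2\le 1/4$. [lp_gap] then bounds Im(G - w) by a quarter of Im G, and inserting
    this in [lp_decay_ext] leaves $|G-w|^2\le c/3\le r^2$. *)
Lemma lp_far z : dom K2 z -> 2 * r <= cabs (G z - W0%:C) ->
  cabs (G z - w z) <= r /\ Im (G z - w z) <= Im (w z).
Proof.
move=> Dz rz; have hr0 := r0.
have rz' : r < cabs (G z - W0%:C) by lra.
have := lp_decay_ext _ Dz rz'; have := lp_gap _ Dz rz'.
have Gz := map_im _ _ _ _ mG (D12 _ Dz).
have z0 : 0 < cabs (G z - W0%:C) by lra.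
have sq : (2 * r) ^+ 2 <= cabs (G z - W0%:C) ^+ 2.
  by rewrite ler_sqr ?nnegrE ?cabs_ge0//; lra.
have : r ^+ 2 / cabs (G z - W0%:C) ^+ 2 <= 4^-1.
  by rewrite ler_pdivrMr ?exprn_gt0// ler_pdivlMl//; lra.
set q := _ / _ => q4 h1 h2.
have h3 : q * Im (G z) <= 4^-1 * Im (G z) by rewrite ler_pM2r.
have h4 : Im (G z - w z) <= 4^-1 * Im (G z) by lra.
split; last by move: h4; rewrite cImB; lra.
apply: ler_of_sqr; first exact: ltW.
have : cabs (G z - w z) ^+ 2 * (1 - 4^-1) * Im (G z) <=
    cabs (G z - w z) ^+ 2 * (1 - q) * Im (G z).
  by rewrite ler_pM2r// ler_wpM2l ?sqr_ge0//; lra.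
have : c * Im (G z - w z) <= c * (4^-1 * Im (G z)) by rewrite ler_pM2l.
move=> h5 h6; have {h5 h6} : cabs (G z - w z) ^+ 2 * (1 - 4^-1) * Im (G z) <=
    c * 4^-1 * Im (G z) by lra.
by rewrite ler_pM2r//; have := cr; have := sqr_ge0 r; lra.
Qed.

End Pair.

Lemma ccont_comp {R : realType} (f g : R[i] -> R[i]) (z : R[i]) :
  ccont g z -> ccont f (g z) -> ccont (f \o g) z.
Proof.
move=> cg cf e e0; have [r r0 H] := cf e e0; have [r' r'0 H'] := cg r r0.
by exists r' => // w /H'/H.
Qed.

Lemma no_crossing {R : realType} (f : R -> R) (a b k : R) :
  econt `[Num.min a b, Num.max a b] f ->
  (forall x, Num.min a b <= x <= Num.max a b -> f x != k) -> f a < k -> f b < k.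
Proof.
move=> cf fk fa; rewrite ltNge; apply/negP => kb.
have mM : Num.min a b <= Num.max a b by rewrite le_max ge_min lexx.
have : exists2 c, c \in `[Num.min a b, Num.max a b] & f c = k.
  apply: (IVT mM); first exact/econtP.
  by rewrite ge_min le_max; case: (leP a b) => _; rewrite (ltW fa) kb ?orbT.
by move=> [c]; rewrite in_itv /= => /fk/eqP.
Qed.

Section Pair2.
Context {R : realType} {K1 K2 : set R[i]} {s t : R} {G w : R[i] -> R[i]} {W0 r : R}.
Hypothesis L : lpair K1 K2 s t G w W0 r.

Let oK : copen (dom K2) := lp_open2 _ _ _ _ _ _ _ _ L.
Let mw : mapping_out K2 t w := lp_map2 _ _ _ _ _ _ _ _ L.
Let mG : mapping_out K1 s G := lp_map1 _ _ _ _ _ _ _ _ L.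
Let D12 z : dom K2 z -> dom K1 z := lp_dom _ _ _ _ _ _ _ _ _ L.

(** A connectedness argument in the [w] plane. Where $|v-W_0|>3r$, the distance [psi] from G to W0
    is never 2r, because [lp_far] would then put [w] within 3r of W0. A vertical and a horizontal
    leg inside this region join w(z) to w(iY), where [psi] exceeds 2r. *)
Lemma lp_conn z : dom K2 z -> 3 * r < cabs (w z - W0%:C) ->
  2 * r < cabs (G z - W0%:C).
Proof.
move=> Dz wz; rewrite ltNge; apply/negP => Gz.
have r0 := lp_r0 _ _ _ _ _ _ _ _ L; have st := lp_st _ _ _ _ _ _ _ _ L.
pose psi v := cabs (G (minv K2 w v) - W0%:C).
have cpsi v : 0 < Im v -> rcont psi v.
  move=> v0; apply: ccont_cabs; apply: ccontB; last exact: ccont_cst.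
  apply: (ccont_comp G (minv K2 w)); first exact: minv_cont mw v0.
  by apply/hol_cont/(map_hol _ _ _ _ mG)/D12; have [] := minvP _ _ _ _ mw v0.
have npsi v : 0 < Im v -> 3 * r < cabs (v - W0%:C) -> psi v != 2 * r.
  move=> v0 vr; have [Dv wv] := minvP _ _ _ _ mw v0; apply/eqP => E.
  have [|h _] := lp_far L _ Dv; first by rewrite -/(psi v) E.
  rewrite wv in h; have := cabs_trans (G (minv K2 w v)) v W0%:C.
  by rewrite (cabsC v (G _)) -/(psi v) E; lra.
have w0 := map_im _ _ _ _ mw Dz.
have pw : psi (w z) < 2 * r.
  by rewrite lt_neqAle npsi//= /psi (minvK _ _ _ _ mw).
have [Y0 Y01 H] := lp_iy _ _ _ _ _ _ _ _ L 1 ltr01.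
(* High enough for the horizontal leg to stay at distance more than 3r from W0, and for [psi] to
   exceed 2r at its end. *)
pose Y := Num.max Y0 (2 * t + 1 + Im (w z) + 3 * r + `|W0| + 1).
have YY0 : Y0 <= Y by rewrite le_max lexx.
have Y1 : 2 * t + 1 + Im (w z) + 3 * r + `|W0| + 1 <= Y by rewrite le_max lexx orbT.
have [DY GY wY _ _] := H Y YY0; set y := 0 +i* Y in DY GY wY.
have W00 := normr_ge0 W0; have s0 := lp_s0 _ _ _ _ _ _ _ _ L.
have wy : Im (w z) + 3 * r < Im (w y).
  have := Im_le_cabs (w y - y); rewrite cImB /= ler_norml => /andP[+ _]; lra.
have p_end : 2 * r < psi (w y).
  rewrite /psi (minvK _ _ _ _ mw DY).
  have := cabs_leD y (G y - W0%:C).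
  rewrite (_ : y - (G y - W0%:C) = (y - G y) + W0%:C); last by ring.
  rewrite (cabs_iy Y); last by lra.
  by have := cabsD (y - G y) (W0%:C); rewrite cabs_real (cabsC y); lra.
have econt_psi (A : set R) (p : R -> R[i]) :
    (forall x y, cabs (p x - p y) = `|x - y|) ->
    (forall x, A x -> 0 < Im (p x)) -> econt A (psi \o p).
  move=> ip p0 x Ax e e0; have [d d0 Hd] := cpsi _ (p0 x Ax) _ e0.
  by exists d => // x' _ xx; apply: Hd; rewrite ip.
have p1 : psi (Re (w z) +i* Im (w y)) < 2 * r.
  have mE : Num.min (Im (w z)) (Im (w y)) = Im (w z) by rewrite min_l//; lra.
  apply: (@no_crossing _ (psi \o (fun y => Re (w z) +i* y)) (Im (w z))); last first.
  - by rewrite /= (_ : _ +i* _ = w z)//; case: (w z).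
  - rewrite mE => x /andP[x1 _]; apply: npsi; first by rewrite /=; lra.
    apply: (lt_le_trans wz); rewrite -(@ler_pXn2r _ 2%N) ?nnegrE ?cabs_ge0//.
    rewrite [leLHS]cabs_sqr [leRHS]cabs_sqr.
    have : Im (w z) ^+ 2 <= x ^+ 2 by rewrite ler_sqr ?nnegrE//; lra.
    by case: (w z) => a b /=; lra.
  - apply: econt_psi => [x x'|x].
      rewrite (_ : _ - _ = (0 +i* (x - x'))); last by apply: complexP => /=; ring.
      by rewrite /cabs/= expr0n add0r sqrtr_sqr.
    by rewrite mE /= in_itv/= => /andP[x1 _]; lra.
have : psi (w y) < 2 * r.
  rewrite (_ : w y = Re (w y) +i* Im (w y)); last by case: (w y).
  apply: (@no_crossing _ (psi \o (fun x => x +i* Im (w y))) (Re (w z))) => //.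
  - apply: econt_psi => [x x'|x _]; last by rewrite /=; lra.
    by rewrite (_ : _ - _ = (x - x')%:C) ?cabs_real//; apply: complexP => /=; ring.
  - move=> x _; apply: npsi; first by rewrite /=; lra.
    apply: lt_le_trans (Im_le_cabs _); rewrite cImB/= subr0 ger0_norm; lra.
lra.
Qed.

End Pair2.

Lemma mapping_out_id {R : realType} : mapping_out (set0 : set R[i]) 0 id.
Proof.
split.
- by move=> z _; exact: derivable_id.
- split; [by move=> z []|by move=> x y|].
  by move=> z Hz; exists z => //; split.
- move=> e e0; exists 0 => z _ _.
  by rewrite mulr0 mul0r addr0 subrr normr0 mulr_ge0 ?normr_ge0// lecR ltW.
Qed.

Lemma dom_open {R : realType} (K : set R[i]) :
  (forall z, 0 < Im z -> ~ K z -> exists2 e, 0 < e &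
    forall w, cabs (w - z) < e -> ~ K w) -> copen (dom K).
Proof.
move=> oK z [Hz Kz]; have [e e0 H] := oK z Hz Kz.
exists (Num.min e (Im z)) => [|w]; first by rewrite lt_min e0.
rewrite lt_min => /andP[/H nKw wz]; split => //=.
have := le_lt_trans (Im_le_cabs _) wz; rewrite cImB ltr_norml => /andP[+ _].
by rewrite /upper_half_plane/=; lra.
Qed.

Lemma lpair0 {R : realType} (K : set R[i]) (t : R) (w : R[i] -> R[i]) (B r : R) :
  0 < B -> (forall z, K z -> cabs z <= B) -> copen (dom K) -> mapping_out K t w ->
  0 < t -> B <= r -> 2 * t <= r ^+ 2 -> lpair set0 K 0 t id w 0 r.
Proof.
move=> B0 KB oK mw t0 Br tr; split => //.
- by exists B.
- by apply: dom_open => z _ _; exists 1; [exact: ltr01|move=> w0 _ []].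
- exact: mapping_out_id.
- exact: lt_le_trans Br.
- by rewrite subr0.
- by move=> z /KB zB _; rewrite subr0 (le_trans zB).
Qed.

Lemma map_far {R : realType} (K : set R[i]) (t : R) (w : R[i] -> R[i]) (B : R) :
  0 < B -> (forall z, K z -> cabs z <= B) -> copen (dom K) -> mapping_out K t w ->
  0 < t -> exists2 r, 0 < r & forall z, dom K z ->
    (2 * r <= cabs z -> cabs (z - w z) <= r) /\
    (3 * r < cabs (w z) -> cabs (w z) - r <= cabs z).
Proof.
move=> B0 KB oK mw t0; pose r := B + 2 * t + 1.
have r0 : 0 < r by rewrite /r; lra.
have L : lpair set0 K 0 t id w 0 r.
  apply: (lpair0 _ _ _ B r) => //; first by rewrite /r; lra.
  have : 1 * r <= r * r by rewrite ler_pM2r// /r; lra.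
  by rewrite expr2 /r; lra.
exists r => // z Dz; have := lp_far L _ Dz; have := lp_conn L _ Dz.
rewrite !subr0 => h1 h2; split=> [/h2[]//|/h1/ltW/h2[h3 _]].
by have := cabs_leD (w z) z; rewrite (cabsC (w z)); lra.
Qed.

(** * The one-step Loewner estimate *)

Section Pair3.
Context {R : realType} {K1 K2 : set R[i]} {s t : R} {G w : R[i] -> R[i]} {W0 r : R}.
Hypothesis L : lpair K1 K2 s t G w W0 r.

Let oK : copen (dom K2) := lp_open2 _ _ _ _ _ _ _ _ L.
Let mw : mapping_out K2 t w := lp_map2 _ _ _ _ _ _ _ _ L.
Let mG : mapping_out K1 s G := lp_map1 _ _ _ _ _ _ _ _ L.
Let D12 z : dom K2 z -> dom K1 z := lp_dom _ _ _ _ _ _ _ _ _ L.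

(** Think of $G-w=\int\mu(dx)/(x-w)$ with $\mu$ positive of mass $c$ carried by $|x-W_0|\le 3r$. For
    [sg] equal to 1 or -1, F plus the real constant [sg] c is then the same transform of the
    positive measure $(3r+sg(x-W_0))\mu$, which explains the sign proved in [F_ge0]. *)
Let F (sg : R) z := ((3 * r)%:C + sg%:C * (w z - W0%:C)) * (G z - w z).

Let F_hol sg z : dom K2 z -> hol_at (F sg) z.
Proof.
move=> Dz; have hw := map_hol _ _ _ _ mw Dz.
apply: holM; last exact: lp_hol L _ Dz.
apply: holD; first exact: hol_cst.
apply: holM; first exact: hol_cst.
by apply: holB => //; exact: hol_cst.
Qed.

Let Im_F sg z : Im (F sg z) = (3 * r + sg * (Re (w z) - W0)) * Im (G z - w z) +
  sg * Im (w z) * Re (G z - w z).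
Proof.
rewrite /F; case: (G z - w z) => a b; case: (w z) => x y /=; ring.
Qed.

Let F_infty sg : `|sg| = 1 -> forall e, 0 < e -> exists M, forall z, dom K2 z ->
  M < cabs z -> cabs (F sg z + (sg * (2 * (t - s)))%:C) <= e.
Proof.
move=> sg1 e e0; have e10 : 0 < e / 4 by rewrite divr_gt0.
have s0 := lp_s0 _ _ _ _ _ _ _ _ L; have st := lp_st _ _ _ _ _ _ _ _ L.
have r0 := lp_r0 _ _ _ _ _ _ _ _ L; have W00 := normr_ge0 W0.
have [M1 H1] := map_expansion _ _ _ mG _ e10.
have [M2 H2] := map_expansion _ _ _ mw _ e10.
pose c := 2 * (t - s); have c0 : 0 < c by rewrite /c; lra.
pose C := (3 * r + 2 * t + e / 4 + `|W0|) * (c + e / 2).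
have C0 : 0 < C by rewrite mulr_gt0//; lra.
exists (Num.max (Num.max M1 M2) (Num.max 1 (2 * C / e))) => z Dz.
rewrite !gt_max => /andP[/andP[zM1 zM2] /andP[z1 zC]].
have z0 : 0 < cabs z by lra.
have zn0 : z != 0 by rewrite -cabs_gt0.
have i1 : (cabs z)^-1 <= 1 by rewrite invf_le1// ltW.
have h1 := H1 z (D12 _ Dz) zM1; have h2 := H2 z Dz zM2.
set h := G z - w z.
have hc : cabs (h + c%:C / z) <= e / 2 / cabs z.
  rewrite (_ : h + _ = (G z - (z + (2 * s)%:C / z)) - (w z - (z + (2 * t)%:C / z))).
    by rewrite (le_trans (cabsB _ _))//; lra.
  rewrite (_ : c%:C = (2 * t)%:C - (2 * s)%:C); last by apply: complexP => /=; rewrite /c; ring.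
  by rewrite /h; ring.
have cz : cabs (c%:C / z) = c / cabs z by rewrite cabsM cabsV cabs_real gtr0_norm.
have hh : cabs h <= (c + e / 2) / cabs z.
  have := cabsB (h + c%:C / z) (c%:C / z); rewrite addrK cz; lra.
have wz : cabs (w z - z) <= 2 * t + e / 4.
  rewrite (_ : w z - z = (w z - (z + (2 * t)%:C / z)) + (2 * t)%:C / z); last by ring.
  rewrite (le_trans (cabsD _ _))// cabsM cabsV cabs_real ger0_norm; last by lra.
  have : 2 * t / cabs z <= 2 * t * 1 by rewrite ler_wpM2l//; lra.
  have : e / 4 / cabs z <= e / 4 * 1 by rewrite ler_wpM2l// ltW.
  lra.
pose A := sg%:C * (z * (h + c%:C / z)).
pose B := ((3 * r)%:C + sg%:C * (w z - z - W0%:C)) * h.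
have FE : F sg z = (- (sg * c))%:C + (A + B).
  rewrite (_ : (- (sg * c))%:C = - (sg%:C * c%:C)); last by apply: complexP => /=; ring.
  by rewrite /F /A /B -/h; field.
have Ae : cabs A <= e / 2.
  by rewrite /A !cabsM cabs_real sg1 mul1r mulrC -ler_pdivlMr.
have Be : cabs B <= C / cabs z.
  rewrite /B cabsM /C -mulrA; apply: ler_pM; rewrite ?cabs_ge0//.
  rewrite (le_trans (cabsD _ _))// cabs_real cabsM cabs_real sg1 mul1r.
  rewrite (gtr0_norm (_ : 0 < 3 * r)); last by lra.
  by have := cabsB (w z - z) W0%:C; rewrite cabs_real; lra.
have Ce : C / cabs z <= e / 2.
  rewrite ler_pdivrMr//; move: zC; rewrite ltr_pdivrMr// => zC.
  by lra.
rewrite FE (_ : _ + _ = A + B); last by rewrite addrAC -rmorphD addNr add0r.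
by rewrite (le_trans (cabsD _ _))//; lra.
Qed.

(** Maximum principle for -Im F = Re(iF). Where Im w is small, either the real factor of Im(G - w)
    is nonnegative, or w is farther than 3r from W0 and [lp_conn] with [lp_far] bounds Im(G - w) by
    Im w. At infinity F tends to a real number. *)
Let F_ge0 sg : `|sg| = 1 -> forall z, dom K2 z -> 0 <= Im (F sg z).
Proof.
move=> sg1; suff H z : dom K2 z -> Re ('i * F sg z) <= 0.
  move=> z /H; rewrite cReM /= mul0r mul1r sub0r; lra.
have s0 := lp_s0 _ _ _ _ _ _ _ _ L; have st := lp_st _ _ _ _ _ _ _ _ L.
have r0 := lp_r0 _ _ _ _ _ _ _ _ L; have W00 := normr_ge0 W0.
have [B B0 KB] := lp_bound _ _ _ _ _ _ _ _ L.
have t0 : 0 < t by lra.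
have [r1 r10 far] := map_far K2 t w B B0 KB oK mw t0.
apply: (max_principle (dom K2) (fun z => Re ('i * F sg z))).
- move=> v Dv; apply: ccont_Re; apply: ccontM; first exact: ccont_cst.
  exact/hol_cont/F_hol.
- move=> v Dv; apply: weak_sub_Re => //; first exact/hol_cont/F_hol.
  have [d d0 Hd] := oK v Dv; exists d => // u _ /Hd Du.
  exact/hol_cdiff/F_hol.
move=> e e0; have [M1 H1] := F_infty sg sg1 e e0.
pose M := Num.max (3 * r1) (r1 + `|M1|) + 1.
have [M3 M4] : 3 * r1 < M /\ r1 + M1 < M.
  split; first by rewrite ltr_pwDr// le_max lexx.
  rewrite ltr_pwDr// le_max; apply/orP; right.
  by rewrite lerD2l ler_norm.
pose C := 3 * r + `|W0| + M; pose X := C + M + `|W0|.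
have X0 : 0 < X by rewrite /X /C; lra.
(* [C] bounds |G - w| where |w| is at most M, so heights below [eta] cost at most [e] in Im F. *)
pose eta := e / X; have eta0 : 0 < eta by rewrite divr_gt0.
have [P [q [cP PD cq H]]] := map_proper _ _ _ oK mw eta M eta0.
exists P, q; split => // v Dv.
have reF : Re ('i * F sg v) = - Im (F sg v) by rewrite cReM /= mul0r mul1r sub0r.
rewrite add0r reF.
have [wM|wM] := leP (cabs (w v)) M; last first.
  left; have : M1 < cabs v by have [_] := far v Dv; lra.
  move=> /(H1 v Dv)/(le_trans (Im_le_cabs _)).
  by rewrite cImD/= addr0 ler_norml => /andP[+ _]; lra.
have [ew|we] := leP eta (Im (w v)); first by right; exact: H.
left; have wv := map_im _ _ _ _ mw Dv; have hv := lp_Im_le L _ Dv.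
set h := G v - w v; have h0 : 0 <= Im h by rewrite cImB subr_ge0.
have wW : cabs (w v - W0%:C) <= M + `|W0|.
  by have := cabsB (w v) W0%:C; rewrite cabs_real; lra.
have hC : cabs h <= C.
  have [Gf|Gf] := leP (2 * r) (cabs (G v - W0%:C)).
    by have [] := lp_far L _ Dv Gf; rewrite -/h /C; lra.
  have := cabs_trans W0%:C (G v) (w v); rewrite (cabsC W0%:C) -/h /C; lra.
have eX : eta * X = e by rewrite /eta divfK// gt_eqF.
have Imh2 : `|sg * Im (w v) * Re h| <= eta * C.
  rewrite !normrM sg1 mul1r (gtr0_norm wv); apply: ler_pM => //; first exact: ltW.
    exact: ltW.
  exact: le_trans (Re_le_cabs _) hC.
rewrite Im_F -/h.
have : 0 <= eta * (M + `|W0|) by rewrite mulr_ge0//; lra.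
move: Imh2; rewrite ler_norml => /andP[Imh2 _] eM.
have [p0|p0] := leP 0 (3 * r + sg * (Re (w v) - W0)).
  have : 0 <= (3 * r + sg * (Re (w v) - W0)) * Im h by rewrite mulr_ge0.
  by move: eX; rewrite /X; lra.
have absp : `|sg * (Re (w v) - W0)| <= cabs (w v - W0%:C).
  rewrite normrM sg1 mul1r (le_trans _ (Re_le_cabs _))// cReB//.
have [p1 p2] : - cabs (w v - W0%:C) <= sg * (Re (w v) - W0) /\
    sg * (Re (w v) - W0) <= cabs (w v - W0%:C).
  by move: absp; rewrite ler_norml => /andP[].
have wr : 3 * r < cabs (w v - W0%:C) by lra.
have [_] := lp_far L _ Dv (ltW (lp_conn L _ Dv wr)); rewrite -/h => hw.
have : - (3 * r + sg * (Re (w v) - W0)) * Im h <= (M + `|W0|) * eta.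
  by apply: ler_pM => //; lra.
by move: eX; rewrite /X; lra.
Qed.

(** The shifted function [A] = F 1 + c tends to 0 at infinity. Since $F_1+F_{-1}=6r(G-w)$ and both
    have nonnegative imaginary part, Im A lies between 0 and 6r Im(G - w). So [julia_decay] applies
    with constant 6rc. The result says that w - G is $2(t-s)/(w-W_0)$ up to an error proportional to
    [r]. *)
Lemma lp_increment z : dom K2 z ->
  cabs ((w z - W0%:C) * (G z - w z) + (2 * (t - s))%:C) * Im (w z) <=
  9 * r * (2 * (t - s)).
Proof.
have s0 := lp_s0 _ _ _ _ _ _ _ _ L; have st := lp_st _ _ _ _ _ _ _ _ L.
have r0 := lp_r0 _ _ _ _ _ _ _ _ L.
pose c := 2 * (t - s); have c0 : 0 < c by rewrite /c; lra.
have rc0 : 0 < r * c by exact: mulr_gt0.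
pose A z := F 1 z + c%:C.
have AE v : dom K2 v -> 0 <= Im (A v) /\ Im (A v) <= 6 * r * Im (G v - w v).
  move=> Dv; have -> : Im (A v) = Im (F 1 v).
    by rewrite /A cImD -[RHS]addr0.
  split; first by apply: F_ge0; rewrite ?normr1.
  have := F_ge0 (-1); rewrite normrN normr1 => /(_ erefl v Dv).
  by rewrite !Im_F; lra.
move=> Dz; have wz := map_im _ _ _ _ mw Dz.
have A1 : cabs (A z) ^+ 2 * Im (w z) <= (6 * r * c) * Im (A z).
  apply: (julia_decay (dom K2) w A (2 * t + 1)) Dz => //.
  - by move=> v; exact: map_hol mw.
  - by move=> v Dv; apply: holD; [exact: F_hol|exact: hol_cst].
  - exact: map_inj mw.
  - by move=> v; exact: map_im mw.
  - by move=> v /AE[].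
  - exact: map_proper mw.
  - by lra.
  - by lra.
  move=> e e0; pose k := e / (6 * r + 1).
  have k0 : 0 < k by rewrite divr_gt0//; lra.
  have kr : (6 * r + 1) * k = e by rewrite mulrC divfK//; lra.
  have [M HM] := F_infty 1 (normr1 _) e e0.
  have [Y0 Y01 H] := lp_iy _ _ _ _ _ _ _ _ L k k0.
  exists (Num.max Y0 (`|M| + 1)) => Y; rewrite ge_max => /andP[/H[DY _ wY _ hY] YM].
  have Yp : 0 < Y by have := normr_ge0 M; lra.
  split => //.
    have := HM _ DY; rewrite cabs_iy ?(ltW Yp)// mul1r; apply.
    by have := ler_norm M; lra.
  have [_ ha] := AE _ DY; have := ler_wpM2l (ltW Yp) ha.
  have : (6 * r) * (Y * Im (G (0 +i* Y) - w (0 +i* Y))) <= (6 * r) * (c + k).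
    by rewrite ler_wpM2l// mulr_ge0// ltW.
  by lra.
have A2 : cabs (A z) * Im (w z) <= 6 * r * c.
  have [->|A0] := eqVneq (A z) 0; first by rewrite cabs0 mul0r; lra.
  have A0' : 0 < cabs (A z) by rewrite cabs_gt0.
  rewrite -(ler_pM2l A0').
  have : 6 * r * c * Im (A z) <= 6 * r * c * cabs (A z).
    rewrite ler_wpM2l//; first by lra.
    exact: le_trans (ler_norm _) (Im_le_cabs _).
  lra.
have hs := lp_small L _ Dz.
(* [A] costs 6rc and the correction 3r(G - w) costs 3rc by [lp_small], whence the constant 9. *)
rewrite (_ : _ + _ = A z - (3 * r)%:C * (G z - w z)); last first.
  rewrite /A /F /c (_ : 1%:C = 1)//; ring.
have : cabs (A z - (3 * r)%:C * (G z - w z)) * Im (w z) <=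
    (cabs (A z) + 3 * r * cabs (G z - w z)) * Im (w z).
  rewrite ler_wpM2r ?(ltW wz)// (le_trans (cabsB _ _))// cabsM cabs_real.
  by rewrite ger0_norm//; lra.
have : 3 * r * (cabs (G z - w z) * Im (w z)) <= 3 * r * c.
  by rewrite ler_wpM2l//; lra.
by move=> h1 h2; rewrite -/c; lra.
Qed.

End Pair3.

(** * The chain of maps generated by a curve *)

Lemma within_cvg_eps {R : realType} {U : Type} (A : set R) (f : R -> R[i]) (x : R) l :
  (f : R -> R[i]^o) y @[y --> within A (nbhs x)] --> (l : R[i]^o) ->
  forall e : R, 0 < e -> exists2 d : R, 0 < d &
    forall y, A y -> `|y - x| < d -> cabs (f y - l) < e.
Proof.
move=> /(@cvgrPdist_lt _ R[i]^o) H e e0; have := H e%:C; rewrite ltcR => /(_ e0).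
rewrite near_withinE => /nbhs_ballP[d /= d0 Hd]; exists d => // y Ay yx.
have /Hd : ball x d y by rewrite /ball/= distrC.
by move=> /(_ Ay); rewrite normE ltcR cabsC.
Qed.

Lemma cwithin_cvg_eps {R : realType} (A : set R[i]) (f : R[i] -> R[i]) (x l : R[i]) :
  (f : R[i]^o -> R[i]^o) y @[y --> within A (nbhs (x : R[i]^o))] --> (l : R[i]^o) ->
  forall e : R, 0 < e -> exists2 d : R, 0 < d &
    forall y, A y -> cabs (y - x) < d -> cabs (f y - l) < e.
Proof.
move=> /(@cvgrPdist_lt _ R[i]^o) H e e0; have := H e%:C; rewrite ltcR => /(_ e0).
rewrite near_withinE => /nbhs_ballP[r /=]; case: r => r1 r2.
rewrite ltcE/= => /andP[/eqP->] r0 Hd; exists r1 => // y Ay yx.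
have /Hd : ball (x : R[i]^o) r1%:C y by rewrite /ball/= normE ltcR cabsC.
by move=> /(_ Ay); rewrite normE ltcR cabsC.
Qed.

Definition cecont {R : realType} (A : set R) (f : R -> R[i]) :=
  forall x, A x -> forall e, 0 < e -> exists2 d, 0 < d &
    forall y, A y -> `|y - x| < d -> cabs (f y - f x) < e.

Lemma cecont_dist {R : realType} (A : set R) (f : R -> R[i]) (z : R[i]) :
  cecont A f -> econt A (fun x => cabs (f x - z)).
Proof.
move=> cf x Ax e e0; have [d d0 H] := cf x Ax e e0; exists d => // y Ay yx.
rewrite (le_lt_trans (cabs_dist _ _))// (_ : _ - _ = f y - f x) ?H//; ring.
Qed.

Section Curve.
Context {R : realType} {x0 : R} {T : \bar R} {gamma : R -> R[i]^o}
  {g : R -> R[i]^o -> R[i]^o} {W x : R -> R}.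
Hypothesis LC : loewner_curve x0 T gamma g W x.

(** [loewner_curve] prescribes [gamma] and [g] at positive times only; this and [hull_map] extend
    them to time 0 by the origin and the identity. *)
Definition curve_from0 (s : R) : R[i] := if s == 0 then 0 else gamma s.
Definition hull_map (s : R) (z : R[i]) : R[i] := if s == 0 then z else g s z.
Let K := @curve_hull R gamma.

Lemma gamma_im t : times T t -> 0 < Im (gamma t).
Proof. exact: (loewner_curve_in_H LC). Qed.

Lemma hull0 : K 0 = set0.
Proof.
apply/seteqP; split => // z [s /=]; rewrite in_itv/= => /andP[a b] _.
by have := lt_le_trans a b; rewrite ltxx.
Qed.

Lemma gmap0 : hull_map 0 = id.
Proof. by apply/funext => z; rewrite /hull_map eqxx. Qed.

Lemma timesS s t : 0 < s -> s <= t -> (t%:E < T)%E -> times T s.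
Proof. by move=> s0 st tT; split => //; apply: le_lt_trans tT; rewrite lee_fin. Qed.

Lemma gamma0_cont b : (b%:E < T)%E -> cecont `[0, b] curve_from0.
Proof.
move=> bT u; rewrite /= in_itv/= => /andP[u0 ub] e e0.
move: u0; rewrite le_eqVlt => /predU1P[<-|u0].
  have := loewner_curve_start LC => /(@within_cvg_eps R unit) => /(_ e e0).
  move=> [d d0 H]; exists d => // y; rewrite /= in_itv/= /curve_from0 eqxx => /andP[y0 yb] yd.
  have [_|yn0] := eqVneq y 0; first by rewrite subrr cabs0.
  by apply: H => //; rewrite lt_neqAle eq_sym yn0.
have Tu : times T u by exact: timesS bT.
have := loewner_curve_continuous LC.
rewrite subspace_continuousP => /(_ u Tu)/(@within_cvg_eps R unit) => /(_ e e0).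
move=> [d d0 H]; exists (Num.min d u) => [|y]; first by rewrite lt_min d0.
rewrite /= in_itv/= lt_min => /andP[y0 yb] /andP[yd yu].
have yp : 0 < y by move: yu; rewrite ltr_norml => /andP[+ _]; lra.
rewrite /curve_from0 !gt_eqF//; apply: H => //; exact: timesS bT.
Qed.

Lemma hull_gamma0 b z : K b z -> exists2 r, 0 < r <= b & curve_from0 r = z.
Proof.
move=> [r]; rewrite /= in_itv/= => /andP[r0 rb] <-; exists r; first by rewrite r0.
by rewrite /curve_from0 gt_eqF.
Qed.

Lemma gamma0_hull b r : 0 < r -> r <= b -> K b (curve_from0 r).
Proof.
by move=> r0 rb; exists r; rewrite /= ?in_itv/= ?r0 ?rb// /curve_from0 gt_eqF.
Qed.

Lemma hull_bound b : 0 <= b -> (b%:E < T)%E ->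
  exists2 B, 0 < B & forall z, K b z -> cabs z <= B.
Proof.
move=> b0 bT; have cg := cecont_dist _ _ 0 (gamma0_cont _ bT).
have [c _ H] := EVT_max b0 ((econtP _ _).2 cg).
exists (cabs (curve_from0 c - 0) + 1) => [|z /hull_gamma0[r /andP[r0 rb] <-]].
  by rewrite ltr_wpDl ?cabs_ge0.
have := H r; rewrite in_itv/= (ltW r0) rb => /(_ isT).
by rewrite !subr0; lra.
Qed.

Lemma arc_away a b z : 0 <= a -> a <= b -> (b%:E < T)%E ->
  (forall r, a <= r <= b -> curve_from0 r <> z) ->
  exists2 d, 0 < d & forall r, a <= r <= b -> d <= cabs (curve_from0 r - z).
Proof.
move=> a0 ab bT nz; have cg := cecont_dist _ _ z (gamma0_cont _ bT).
have [|c ci H] := @EVT_min _ (fun r => cabs (curve_from0 r - z)) a b ab.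
  apply/econtP; apply: econtS cg => r; rewrite /= !in_itv/= => /andP[ar ->].
  by rewrite (le_trans a0).
exists (cabs (curve_from0 c - z)) => [|r rab]; last by apply: H; rewrite in_itv.
by rewrite cabs_gt0 subr_eq0; apply/eqP/nz; move: ci; rewrite in_itv.
Qed.

Lemma hull_open b : 0 <= b -> (b%:E < T)%E -> copen (dom (K b)).
Proof.
move=> b0 bT; apply: dom_open => z z0 nK.
have [|d d0 H] := arc_away 0 b z (lexx _) b0 bT.
  move=> r /andP[r0 rb] E; move: r0; rewrite le_eqVlt => /predU1P[r0|r0].
    by move: E z0; rewrite -r0 /curve_from0 eqxx => <-; rewrite ltxx.
  by apply: nK; rewrite -E; exact: gamma0_hull.
exists d => // w wz /hull_gamma0[r /andP[r0 rb] E].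
by have := H r; rewrite (ltW r0) rb E leNgt wz => /(_ isT).
Qed.

Lemma hullS s t : s <= t -> K s `<=` K t.
Proof.
by move=> st z /hull_gamma0[r /andP[r0 rs] <-]; apply: gamma0_hull => //; exact: le_trans st.
Qed.

Lemma gamma_dom s t : s < t -> times T t -> dom (K s) (gamma t).
Proof.
move=> st Tt; split; first exact: gamma_im.
move=> [r /=]; rewrite in_itv/= => /andP[r0 rs] E.
have Tr : times T r.
  by apply: (timesS r t) => //; [exact/ltW/(le_lt_trans rs)|case: Tt].
have := loewner_curve_simple LC; move/(_ r t (mem_set Tr) (mem_set Tt) E) => rt.
by move: rs; rewrite rt leNgt st.
Qed.

Lemma gmap_map s : 0 <= s -> (s%:E < T)%E -> mapping_out (K s) s (hull_map s).
Proof.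
rewrite le_eqVlt => /predU1P[<- _|s0 sT].
  by rewrite hull0 gmap0; exact: mapping_out_id.
have -> : hull_map s = g s by apply/funext => z; rewrite /hull_map gt_eqF.
exact: (loewner_curve_maps LC).
Qed.

Lemma gmap_loc s e : 0 <= s -> 0 < e -> exists2 d, 0 < d & forall t, s < t ->
  t < s + d -> (t%:E < T)%E -> forall z, K t z -> dom (K s) z ->
  cabs (hull_map s z - (W s)%:C) <= e.
Proof.
move=> s0 e0.
have gt t z : (t%:E < T)%E -> K t z -> dom (K s) z ->
    exists r, [/\ s < r, r <= t & z = curve_from0 r].
  move=> tT /hull_gamma0[r /andP[r0 rt] Ez] [_ nK]; exists r; split => //.
  by rewrite ltNge; apply/negP => rs; apply: nK; rewrite -Ez; exact: gamma0_hull.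
have [sT|Ts] := ltP s%:E T; last first.
  exists 1 => // t st _ tT; have : (s%:E < t%:E)%E by rewrite lte_fin.
  by move=> /(lt_trans)/(_ tT); rewrite ltNge Ts.
have [e1 e10 He1] : exists2 e1, 0 < e1 & forall z, dom (K s) z ->
    cabs (z - curve_from0 s) < e1 -> cabs (hull_map s z - (W s)%:C) < e.
  move: s0; rewrite le_eqVlt => /predU1P[<-|s0].
    exists e => // z _; rewrite gmap0 /curve_from0 eqxx subr0.
    by rewrite (loewner_curve_driving0 LC) subr0.
  have := loewner_curve_driving LC (conj s0 sT : times T s).
  move=> /cwithin_cvg_eps => /(_ e e0)[d d0 H]; exists d => // z Dz.
  by rewrite /curve_from0 /hull_map gt_eqF// => zd; exact: H.
have [b sb bT] : exists2 b, s < b & (b%:E < T)%E.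
  move: sT; case: (T) => [T'| |//]; last by exists (s + 1) => //; rewrite ?ltry ?ltrDl.
  by rewrite lte_fin => sT; exists ((s + T') / 2); rewrite ?lte_fin; lra.
have [|d d0 H] := gamma0_cont b bT s _ e1 e10; first by rewrite /= in_itv/= s0 ltW.
exists (Num.min d (b - s)) => [|t st]; first by rewrite lt_min d0 subr_gt0.
rewrite -ltrBlDl lt_min => /andP[td tb] tT z Kz Dz.
have [r [sr rt E]] := gt t z tT Kz Dz.
apply/ltW/He1 => //; rewrite E; apply: H.
  by rewrite /= in_itv/= (le_trans s0 (ltW sr)); lra.
by rewrite gtr0_norm; lra.
Qed.

Lemma lpair_loc s e : 0 <= s -> 0 < e -> exists2 d, 0 < d & forall t, s < t ->
  t < s + d -> (t%:E < T)%E ->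
  lpair (K s) (K t) s t (hull_map s) (hull_map t) (W s) e.
Proof.
move=> s0 e0; have [d d0 H] := gmap_loc s e s0 e0.
have e20 : 0 < e ^+ 2 / 2 by rewrite divr_gt0 ?exprn_gt0.
exists (Num.min d (e ^+ 2 / 2)) => [|t st]; first by rewrite lt_min d0.
rewrite -ltrBlDl lt_min => /andP[td te] tT.
have t0 : 0 <= t by lra.
have sT : (s%:E < T)%E by apply: lt_trans tT; rewrite lte_fin.
split => //; try exact: hull_open; try exact: gmap_map.
- exact/hullS/ltW.
- exact: hull_bound.
- by lra.
- by apply: H => //; rewrite -ltrBlDl.
Qed.

(** A crude localising disc for arbitrary s < t; it serves the monotonicity of Im g and the
    Lipschitz bound in time. *)
Lemma lpair_any s t : 0 <= s -> s < t -> (t%:E < T)%E ->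
  exists r, lpair (K s) (K t) s t (hull_map s) (hull_map t) 0 r.
Proof.
move=> s0 st tT; have t0 : 0 <= t by lra.
have sT : (s%:E < T)%E by apply: lt_trans tT; rewrite lte_fin.
have [B B0 KB] := hull_bound t t0 tT.
have [M HM] : exists M, forall z, K t z -> dom (K s) z -> cabs (hull_map s z) <= M.
  move: s0; rewrite le_eqVlt => /predU1P[<-|sp].
    by exists B => z /KB zB _; rewrite gmap0.
  have [||r r0 H] := map_far (K s) s (hull_map s) B B0 _ _ (gmap_map s (ltW sp) sT) sp.
  - by move=> z /(hullS _ _ (ltW st))/KB.
  - exact: hull_open (ltW sp) sT.
  exists (Num.max (3 * r) (B + r)) => z /KB zB /H[_ h].
  rewrite le_max; have [//|/h] := leP (cabs (hull_map s z)) (3 * r).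
  by move=> h1; rewrite orFb; lra.
exists (`|M| + 2 * (t - s) + 1).
have M0 := normr_ge0 M; have r1 : 1 <= `|M| + 2 * (t - s) + 1 by lra.
split => //; try exact: hull_open; try exact: gmap_map.
- exact/hullS/ltW.
- by exists B.
- by lra.
- set r := _ + _ + _ in r1 *; have : 1 * r <= r * r by rewrite ler_wpM2r//; lra.
  by rewrite -expr2 /r; lra.
- move=> z Kz Dz; rewrite subr0 (le_trans (HM z Kz Dz))//.
  by rewrite (le_trans (ler_norm _))//; lra.
Qed.

Lemma dom_hullS s t z : s <= t -> dom (K t) z -> dom (K s) z.
Proof. by move=> st [Hz nK]; split => // /(hullS _ _ st). Qed.

Lemma gmap_im s z : 0 <= s -> (s%:E < T)%E -> dom (K s) z -> 0 < Im (hull_map s z).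
Proof. by move=> s0 sT; exact/map_im/gmap_map. Qed.

Lemma gmap_im_le s t z : 0 <= s -> s <= t -> (t%:E < T)%E -> dom (K t) z ->
  Im (hull_map t z) <= Im (hull_map s z).
Proof.
move=> s0; rewrite le_eqVlt => /predU1P[<-//|st] tT Dz.
by have [r L] := lpair_any s t s0 st tT; exact: lp_Im_le L _ Dz.
Qed.

Lemma gmap_lip s t b z : 0 <= s -> s <= t -> t <= b -> (b%:E < T)%E ->
  dom (K b) z -> cabs (hull_map t z - hull_map s z) <= 2 * (t - s) / Im (hull_map b z).
Proof.
move=> s0 st tb bT Dz; have b0 : 0 < Im (hull_map b z) by apply: gmap_im => //; lra.
move: st; rewrite le_eqVlt => /predU1P[<-|st].
  by rewrite !subrr cabs0 mulr0 mul0r.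
have tT : (t%:E < T)%E by apply: le_lt_trans bT; rewrite lee_fin.
have [r L] := lpair_any s t s0 st tT.
have := lp_small L _ (dom_hullS _ _ _ tb Dz); rewrite cabsC ler_pdivlMr//.
apply: le_trans; rewrite ler_wpM2l ?cabs_ge0//.
by apply: gmap_im_le => //; lra.
Qed.

(** Loewner's equation as a right derivative. Divide [lp_increment] by $w-W_s$, then replace [w] by
    [G] in the denominator at a quadratic cost, by [lp_small]. All heights are bounded below by [m],
    the height at time [b]. *)
Lemma gmap_rderiv s b z e : 0 <= s -> s < b -> (b%:E < T)%E -> dom (K b) z ->
  0 < e -> exists2 d, 0 < d & forall t, s < t -> t < s + d -> t <= b ->
    cabs (hull_map t z - hull_map s z - (t - s)%:C * (2%:C / (hull_map s z - (W s)%:C))) <=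
    e * (t - s).
Proof.
move=> s0 sb bT Dz e0; have b0 : 0 <= b by lra.
have m0 := gmap_im b z b0 bT Dz; set m := Im (hull_map b z) in m0.
(* With this radius the error $9rc/m^2$ is a quarter of $ec$; the bound [d2] below does the same for
   $c^2/m^3$. *)
pose r := e * m ^+ 2 / 36; have r0 : 0 < r by rewrite divr_gt0// mulr_gt0// exprn_gt0.
have [d1 d10 H] := lpair_loc s r s0 r0.
pose d2 := e * m ^+ 3 / 8; have d20 : 0 < d2 by rewrite divr_gt0// mulr_gt0// exprn_gt0.
exists (Num.min d1 d2) => [|t st]; first by rewrite lt_min d10.
rewrite -ltrBlDl lt_min => /andP[td1 td2] tb.
have tT : (t%:E < T)%E by apply: le_lt_trans bT; rewrite lee_fin.
have sT : (s%:E < T)%E by apply: lt_trans tT; rewrite lte_fin.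
have Dt := dom_hullS _ _ _ tb Dz.
have L : lpair (K s) (K t) s t (hull_map s) (hull_map t) (W s) r by apply: H => //; lra.
have h1 := lp_increment L _ Dt; have h2 := lp_small L _ Dt.
have t0 : 0 <= t by lra.
have wm : m <= Im (hull_map t z) by apply: gmap_im_le.
have Gm : m <= Im (hull_map s z) by apply: gmap_im_le => //; exact: ltW.
move: h1 h2 wm Gm; set c := 2 * (t - s).
set w := hull_map t z; set G := hull_map s z; set W0 := (W s)%:C => h1 h2 wm Gm.
have c0 : 0 < c by rewrite /c; lra.
have imW v : m <= Im v -> m <= cabs (v - W0).
  move=> mv; rewrite (le_trans mv)// (le_trans _ (Im_le_cabs _))//.
  by rewrite (le_trans (ler_norm _))// cImB/= subr0.
have w1 := imW _ wm; have G1 := imW _ Gm.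
have wn0 : w - W0 != 0 by rewrite -cabs_gt0; lra.
have Gn0 : G - W0 != 0 by rewrite -cabs_gt0; lra.
have hm : cabs (G - w) <= c / m.
  by rewrite ler_pdivlMr// (le_trans _ h2)// ler_wpM2l ?cabs_ge0.
have Am : cabs ((w - W0) * (G - w) + c%:C) <= 9 * r * c / m.
  by rewrite ler_pdivlMr// (le_trans _ h1)// ler_wpM2l ?cabs_ge0.
rewrite (_ : w - G - _ = - (((w - W0) * (G - w) + c%:C) / (w - W0)) +
    c%:C * (G - w) / ((w - W0) * (G - W0))); last first.
  rewrite (_ : (t - s)%:C * (2%:C / _) = c%:C / (G - W0)); last first.
    by rewrite mulrA; congr (_ / _); apply: complexP; rewrite /= /c; ring.
  by field; rewrite wn0 Gn0.
rewrite (le_trans (cabsD _ _))// cabsN !cabsM !cabsV !cabsM cabs_real (gtr0_norm c0).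
have b1 : cabs ((w - W0) * (G - w) + c%:C) / cabs (w - W0) <= 9 * r * c / m / m.
  apply: ler_pM => //; rewrite ?cabs_ge0 ?invr_ge0 ?cabs_ge0//.
  by rewrite lef_pV2 ?posrE//; lra.
have b2 : c * cabs (G - w) / (cabs (w - W0) * cabs (G - W0)) <= c * (c / m) / (m * m).
  have p1 : c * cabs (G - w) <= c * (c / m) by rewrite ler_pM2l.
  have p2 : (cabs (w - W0) * cabs (G - W0))^-1 <= (m * m)^-1.
    rewrite lef_pV2 ?posrE; [|apply: mulr_gt0; lra|exact: mulr_gt0].
    by rewrite ler_pM// ltW.
  by apply: ler_pM p1 p2; rewrite ?invr_ge0 mulr_ge0 ?cabs_ge0 ?(ltW c0).
have e1 : 9 * r * c / m / m = e / 4 * c by rewrite /r; field; rewrite gt_eqF.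
have e2 : c * (c / m) / (m * m) <= e / 4 * c.
  rewrite (_ : c * (c / m) / (m * m) = c / m ^+ 3 * c); last by field; rewrite gt_eqF.
  rewrite ler_wpM2r ?(ltW c0)// ler_pdivrMr ?exprn_gt0//.
  by move: td2; rewrite /d2 /c; lra.
by move: b1 b2 e1 e2; rewrite /c; lra.
Qed.

End Curve.

(** * Solutions of Loewner's equation with right derivatives *)

Lemma realcB {R : realType} (a b : R) : (a - b)%:C = a%:C - b%:C.
Proof. by apply: complexP => /=; ring. Qed.

Lemma ler_addgt0 {R : realType} (x y : R) : (forall e, 0 < e -> x <= y + e) -> x <= y.
Proof. by move=> H; apply/ler_addgt0Pr => e; exact: H. Qed.

(** Mean value inequality by real induction. The bound on the derivative at [r] may assume the
    conclusion up to [r], which permits bootstrapping; the gap between [M] and [M'] pays for the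
    local error. *)
Lemma mean_value_right {R : realType} (Z k : R -> R[i]) (s t M M' : R) (k0 : R[i]) :
  M < M' -> cecont `[s, t] Z ->
  (forall r, s <= r -> r < t -> forall e, 0 < e -> exists2 d, 0 < d &
     forall r', r < r' -> r' < r + d -> r' <= t ->
       cabs (Z r' - Z r - (r' - r)%:C * k r) <= e * (r' - r)) ->
  (forall r, s <= r -> r < t -> (forall y, s <= y -> y <= r ->
      cabs (Z y - Z s - (y - s)%:C * k0) <= M' * (y - s)) -> cabs (k r - k0) <= M) ->
  forall r, s <= r -> r <= t -> cabs (Z r - Z s - (r - s)%:C * k0) <= M' * (r - s).
Proof.
move=> MM' cZ dZ kM; apply: real_induction.
- by rewrite !subrr mul0r subrr cabs0 mulr0.
- move=> r sr rt ind; have [|d d0 H] := dZ r sr rt (M' - M); first by rewrite subr_gt0.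
  exists d => // r' rr' rd r't; have kr := kM r sr rt ind.
  rewrite (_ : _ - _ - _ = (Z r' - Z r - (r' - r)%:C * k r) +
    ((Z r - Z s - (r - s)%:C * k0) + (r' - r)%:C * (k r - k0))); last first.
    by rewrite (_ : (r' - s)%:C = (r' - r)%:C + (r - s)%:C);
      [ring|apply: complexP => /=; ring].
  have h1 := H r' rr' rd r't; have h2 := ind r sr (lexx _).
  have h3 : cabs ((r' - r)%:C * (k r - k0)) <= (r' - r) * M.
    by rewrite cabsM cabs_real ger0_norm ?ler_wpM2l// subr_ge0 ltW.
  rewrite (le_trans (cabsD _ _))//.
  have := cabsD (Z r - Z s - (r - s)%:C * k0) ((r' - r)%:C * (k r - k0)).
  by lra.
move=> r sr rt ind; have ci : `[s, t]%classic r by rewrite /= in_itv/= (ltW sr).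
apply: ler_addgt0 => e e0.
pose q := `|M'| + cabs k0 + 1; have q0 : 0 < q by rewrite ltr_wpDl ?addr_ge0 ?cabs_ge0.
have [d d0 H] := cZ r ci _ (divr_gt0 e0 (ltr0n _ 2)).
have eq0 : 0 < e / (2 * q) by rewrite divr_gt0// mulr_gt0.
pose h := Num.min (d / 2) (Num.min (e / (2 * q)) (r - s)).
have [h0 hd he hs] : [/\ 0 < h, h <= d / 2, h <= e / (2 * q) & h <= r - s].
  by rewrite /h !lt_min !ge_min !lexx ?orbT divr_gt0//= eq0 subr_gt0 sr.
pose y := r - h.
have sy : s <= y by rewrite /y; lra.
have yr : y < r by rewrite /y; lra.
have := ind y sy yr.
have := H y; rewrite /= in_itv/= sy (le_trans (ltW yr) rt) => /(_ isT).
rewrite (_ : y - r = - h); last by rewrite /y; ring.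
rewrite normrN gtr0_norm//; have hd' : h < d by lra.
move=> /(_ hd') zz hy.
rewrite (_ : _ - _ - _ = (Z y - Z s - (y - s)%:C * k0) - (Z y - Z r) - h%:C * k0).
  2: by rewrite (_ : (r - s)%:C = (y - s)%:C + h%:C);
       [ring|apply: complexP => /=; rewrite /y; ring].
have := cabsB (Z y - Z s - (y - s)%:C * k0 - (Z y - Z r)) (h%:C * k0).
have := cabsB (Z y - Z s - (y - s)%:C * k0) (Z y - Z r).
rewrite cabsM cabs_real (gtr0_norm h0).
have hq : h * q <= e / 2.
  by move: he; rewrite ler_pdivlMr ?mulr_gt0//; lra.
have : M' * (y - s) <= M' * (r - s) + `|M'| * h.
  rewrite /y; have := ler_norm (- M'); rewrite normrN => a.
  have : - M' * h <= `|M'| * h by rewrite ler_wpM2r ?(ltW h0).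
  by lra.
by move: hq; rewrite /q; lra.
Qed.

Definition flow {R : realType} (Z : R -> R[i]) (W : R -> R) (s t : R) :=
  cecont `[s, t] Z /\
  forall r, s <= r -> r < t -> forall e, 0 < e -> exists2 d, 0 < d &
    forall r', r < r' -> r' < r + d -> r' <= t ->
      cabs (Z r' - Z r - (r' - r)%:C * (2%:C / (Z r - (W r)%:C))) <= e * (r' - r).

Lemma cecontS {R : realType} (A B : set R) (f : R -> R[i]) :
  B `<=` A -> cecont A f -> cecont B f.
Proof.
move=> BA cf x Bx e e0; have [d d0 H] := cf x (BA _ Bx) e e0.
by exists d => // y /BA; exact: H.
Qed.

Lemma flowS {R : realType} (Z : R -> R[i]) (W : R -> R) (s t s' t' : R) :
  s <= s' -> t' <= t -> flow Z W s t -> flow Z W s' t'.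
Proof.
move=> ss tt [cZ dZ]; split.
  apply: cecontS cZ => r; rewrite /= !in_itv/= => /andP[a b].
  by rewrite (le_trans ss a) (le_trans b).
move=> r sr rt e e0; have [||d d0 H] := dZ r _ _ e e0; try lra.
by exists d => // r' a b c; apply: H => //; lra.
Qed.

Lemma cabs_inv_le {R : realType} (d : R) (z : R[i]) : 0 < d -> d <= cabs z ->
  cabs (2%:C / z) <= 2 / d.
Proof.
move=> d0 dz; rewrite cabsM cabsV cabs_real ger0_norm// ler_pM2l//.
by rewrite lef_pV2 ?posrE//; lra.
Qed.

(** While Z keeps distance d/2 from W its speed is at most 4/d, so within time $d^2/32$ it moves at
    most 5d/32. As W moves at most d/4, the distance d/2 is never lost. *)
Lemma flow_stay {R : realType} (Z : R -> R[i]) (W : R -> R) (s t d : R) :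
  flow Z W s t -> 0 < d -> d <= cabs (Z s - (W s)%:C) ->
  (forall r, s <= r -> r <= t -> `|W r - W s| <= d / 4) -> t - s <= d ^+ 2 / 32 ->
  forall r, s <= r -> r <= t ->
    cabs (Z r - Z s) <= d / 4 /\ d / 2 <= cabs (Z r - (W r)%:C).
Proof.
move=> [cZ dZ] d0 ds oW ts.
have near r : s <= r -> r <= t -> cabs (Z r - Z s) <= 5 / d * (r - s) ->
    cabs (Z r - Z s) <= d / 4 /\ d / 2 <= cabs (Z r - (W r)%:C).
  move=> sr rt h.
  have h1 : cabs (Z r - Z s) <= 5 * d / 32.
    rewrite (le_trans h)// -mulrA -[leRHS]mulrA ler_pM2l//.
    by rewrite mulrC ler_pdivrMr//; lra.
  split; first by lra.
  have := oW r sr rt; have := cabs_trans (Z r) (Z s) (W s)%:C.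
  have := cabs_trans (W r)%:C (Z r) (W s)%:C.
  rewrite -realcB cabs_real (cabsC (Z s) (Z r)); lra.
have key : forall r, s <= r -> r <= t ->
    cabs (Z r - Z s - (r - s)%:C * 0) <= 5 / d * (r - s).
  apply: (mean_value_right Z (fun r => 2%:C / (Z r - (W r)%:C)) s t (4 / d)) => //.
    by rewrite ltr_pM2r ?invr_gt0//; lra.
  move=> r sr rt /(_ r sr (lexx _)); rewrite mulr0 !subr0 => h.
  have [_ h2] := near r sr (ltW rt) h.
  apply: le_trans (cabs_inv_le _ _ (_ : 0 < d / 2) h2) _; first by rewrite divr_gt0.
  by rewrite le_eqVlt; apply/orP; left; apply/eqP; field; rewrite gt_eqF.
by move=> r sr rt; have := key r sr rt; rewrite mulr0 subr0; exact: near.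
Qed.

(** An Euler step with the velocity frozen at an arbitrary time [c] of the interval. With [c] at the
    right end it controls left increments too, so derivatives become two-sided later. *)
Lemma flow_diff {R : realType} (Z : R -> R[i]) (W : R -> R) (s t d m c : R) :
  flow Z W s t -> 0 < d -> (forall r, s <= r -> r <= t -> d <= cabs (Z r - (W r)%:C)) ->
  s <= c -> c <= t -> (forall r, s <= r -> r <= t -> `|W r - W c| <= m) ->
  cabs (Z t - Z s - (t - s)%:C * (2%:C / (Z c - (W c)%:C))) <=
  2 / d ^+ 2 * (6 / d * (t - s) + m) * (t - s).
Proof.
move=> F d0 dZ sc ct oW.
have st : s <= t by lra.
have lip a : s <= a -> a <= t -> cabs (Z a - Z s) <= 3 / d * (t - s).
  move=> sa at'; have [cZ rZ] := F.
  have : cabs (Z a - Z s - (a - s)%:C * 0) <= 3 / d * (a - s).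
    apply: (mean_value_right Z (fun r => 2%:C / (Z r - (W r)%:C)) s t (2 / d)) => //.
      by rewrite ltr_pM2r ?invr_gt0//; lra.
    by move=> r sr rt _; rewrite subr0; apply: cabs_inv_le => //; apply: dZ => //; lra.
  rewrite mulr0 subr0 => /le_trans; apply.
  by rewrite ler_wpM2l ?divr_ge0 ?(ltW d0)//; lra.
have m0 : 0 <= m by exact: le_trans (oW s (lexx _) st).
pose M := 2 / d ^+ 2 * (6 / d * (t - s) + m).
apply: ler_addgt0 => e e0.
have [->|st'] := eqVneq s t.
  by rewrite !subrr mul0r subrr cabs0 mulr0 add0r ltW.
have ts0 : 0 < t - s by rewrite subr_gt0 lt_neqAle st' st.
have [cZ rZ] := F.
have MM : M < M + e / (t - s) by rewrite ltrDl divr_gt0.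
suff : cabs (Z t - Z s - (t - s)%:C * (2%:C / (Z c - (W c)%:C))) <=
    (M + e / (t - s)) * (t - s) by rewrite mulrDl divfK ?gt_eqF.
apply: (mean_value_right Z (fun r => 2%:C / (Z r - (W r)%:C)) s t M) => //.
move=> r sr rt _; have hr := dZ r sr (ltW rt); have hc := dZ c sc ct.
have r0 : Z r - (W r)%:C != 0 by rewrite -cabs_gt0; lra.
have c0 : Z c - (W c)%:C != 0 by rewrite -cabs_gt0; lra.
rewrite (_ : _ - _ = 2%:C * ((Z c - Z s) - (Z r - Z s) + (W r - W c)%:C) /
   ((Z r - (W r)%:C) * (Z c - (W c)%:C))); last first.
  by rewrite realcB; field; rewrite r0 c0.
rewrite !cabsM cabsV cabsM cabs_real ger0_norm// -mulrA /M -mulrA ler_pM2l// mulrC.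
have p1 : cabs (Z c - Z s - (Z r - Z s) + (W r - W c)%:C) <= 6 / d * (t - s) + m.
  rewrite (le_trans (cabsD _ _))// cabs_real.
  have := cabsB (Z c - Z s) (Z r - Z s).
  have := lip c sc ct; have := lip r sr (ltW rt); have := oW r sr (ltW rt); lra.
have p2 : (cabs (Z r - (W r)%:C) * cabs (Z c - (W c)%:C))^-1 <= (d ^+ 2)^-1.
  rewrite lef_pV2 ?posrE ?exprn_gt0//; last by apply: mulr_gt0; lra.
  by rewrite expr2 ler_pM// ltW.
by apply: ler_pM p2 p1; rewrite ?cabs_ge0// invr_ge0 mulr_ge0 ?cabs_ge0.
Qed.

(** * The image of the tip *)

Section Curve2.
Context {R : realType} {x0 : R} {T : \bar R} {gamma : R -> R[i]^o}
  {g : R -> R[i]^o -> R[i]^o} {W x : R -> R}.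
Hypothesis LC : loewner_curve x0 T gamma g W x.
Let K := @curve_hull R gamma.
Let gmap := @hull_map R g.
Let gamma0 := @curve_from0 R gamma.

Lemma gmap_flow b z : 0 <= b -> (b%:E < T)%E -> dom (K b) z ->
  flow (gmap ^~ z) W 0 b.
Proof.
move=> b0 bT Dz; have m0 := gmap_im LC b z b0 bT Dz; split; last first.
  by move=> r r0 rb e e0; apply: (gmap_rderiv LC).
move=> s; rewrite /= in_itv/= => /andP[s0 sb] e e0.
have lip a c : 0 <= a -> a <= b -> 0 <= c -> c <= b ->
    cabs (gmap a z - gmap c z) <= 2 / Im (gmap b z) * `|a - c|.
  move=> a0 ab c0 cb; have [ca|/ltW ac] := leP c a.
    by rewrite ger0_norm ?subr_ge0// (le_trans (gmap_lip LC c a b z _ _ _ _ _))// mulrAC.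
  rewrite cabsC distrC ger0_norm ?subr_ge0//.
  by rewrite (le_trans (gmap_lip LC a c b z _ _ _ _ _))// mulrAC.
exists (e * Im (gmap b z) / 2) => [|y]; first by rewrite divr_gt0 ?mulr_gt0.
rewrite /= in_itv/= => /andP[y0 yb] yd.
rewrite (le_lt_trans (lip y s y0 yb s0 sb))// mulrC -ltr_pdivlMr ?divr_gt0//.
by rewrite invf_div mulrA.
Qed.

(* Otherwise a circle around [gamma t] lies on the arc, and the arc parameter
   would be a continuous injection of the circle into the line. *)
Lemma gamma_closure t d : times T t -> 0 < d ->
  exists z, dom (K t) z /\ cabs (z - gamma t) < d.
Proof.
move=> Tt d0; have [t0 tT] := Tt; apply: contrapT => no.
have gt0 := gamma_im LC t Tt; set p := (gamma t : R[i]) in gt0 no.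
have [rho [rho0 rhod rhoi]] : exists rho, [/\ 0 < rho, rho < d & rho < Im p].
  exists (Num.min d (Im p) / 2).
  have : Num.min d (Im p) <= d by rewrite ge_min lexx.
  have : Num.min d (Im p) <= Im p by rewrite ge_min lexx orbT.
  have : 0 < Num.min d (Im p) by rewrite lt_min d0 gt0.
  by set y := Num.min _ _; split; lra.
pose c a := p + cexp (ln rho) a.
have cr a : cabs (c a - p) = rho by rewrite /c addrC addKr cabs_cexp lnK ?posrE.
have Kc a : K t (c a).
  apply: contrapT => nK; apply: no; exists (c a); rewrite cr; split => //; split => //.
  have := Im_le_cabs (c a - p); rewrite cr cImB ler_norml => /andP[+ _].
  by rewrite /upper_half_plane/=; lra.
pose tau z := xget 0 [set r | (0 < r <= t) /\ gamma0 r = z].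
have tauP a : (0 < tau (c a) <= t) /\ gamma0 (tau (c a)) = c a.
  rewrite /tau; have [r r0 E] := hull_gamma0 _ _ (Kc a).
  by case: xgetP => [r' _ //|/(_ r)]; case.
have ccc a e : 0 < e -> exists2 d', 0 < d' & forall a', `|a' - a| < d' ->
    cabs (c a' - c a) < e.
  move=> e0; have [k k0 H] := cexp_near0 (1 : R) ltr01.
  pose q := rho * 3 * 2; have q0 : 0 < q by rewrite /q; lra.
  exists (Num.min k (e / q)) => [|a']; first by rewrite lt_min k0 divr_gt0.
  rewrite lt_min ltr_pdivlMr// => /andP[ak ae].
  have := H 0 (a' - a); rewrite normr0 => /(_ k0 ak); rewrite add0r mul1r => h.
  rewrite (_ : c a' - c a = cexp (ln rho) a * (cexp 0 (a' - a) - 1)); last first.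
    by rewrite mulrBr -cexpD addr0 mulr1 (addrC a) subrK /c; ring.
  rewrite cabsM cabs_cexp lnK ?posrE//.
  have := cabs_leD (cexp 0 (a' - a) - 1) (0 +i* (a' - a)).
  have : cabs (0 +i* (a' - a)) = `|a' - a|.
    by rewrite /cabs/= expr0n add0r sqrtr_sqr.
  move=> E1 h2; have h3 : cabs (cexp 0 (a' - a) - 1) <= 3 * `|a' - a|.
    by have := normr_ge0 (a' - a); lra.
  apply: le_lt_trans (_ : rho * (3 * `|a' - a|) < _); first by rewrite ler_pM2l.
  by move: ae; rewrite /q; have := mulr_ge0 (ltW rho0) (normr_ge0 (a' - a)); lra.
(* Continuity of the inverse of the arc: by [arc_away], the parts of the arc with parameter at least
   [e] away from [u] keep a positive distance from c(a). *)
have ctau a e : 0 < e -> exists2 d', 0 < d' & forall a', `|a' - a| < d' ->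
    `|tau (c a') - tau (c a)| < e.
  move=> e0; have [/andP[u0 ut] Eu] := tauP a; set u := tau (c a) in u0 ut Eu *.
  have inj r : 0 <= r -> r <= t -> gamma0 r = c a -> r = u.
    rewrite le_eqVlt => /predU1P[<-|r0] rt.
      rewrite -Eu /gamma0 /curve_from0 eqxx gt_eqF// => E.
      have := gamma_im LC u (timesS _ _ u0 ut tT).
      by rewrite -E ltxx.
    rewrite -Eu /gamma0 /curve_from0 !gt_eqF//.
    by apply: (loewner_curve_simple LC); apply/mem_set; apply: timesS tT.
  have [d1 d10 H1] : exists2 d1, 0 < d1 & forall r, 0 <= r -> r <= u - e ->
      d1 <= cabs (gamma0 r - c a).
    have [ue|ue] := leP 0 (u - e); last by exists 1 => // r; lra.
    have ueT : ((u - e)%:E < T)%E by apply: le_lt_trans tT; rewrite lee_fin; lra.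
    have nz r : 0 <= r <= u - e -> gamma0 r <> c a.
      by move=> /andP[r0 re] E; have := inj r r0 _ E; lra.
    have [d1 d10 H1] := arc_away LC 0 (u - e) (c a) (lexx _) ue ueT nz.
    by exists d1 => // r r0 re; apply: H1; rewrite r0.
  have [d2 d20 H2] : exists2 d2, 0 < d2 & forall r, u + e <= r -> r <= t ->
      d2 <= cabs (gamma0 r - c a).
    have [ue|ue] := leP (u + e) t; last by exists 1 => // r; lra.
    have nz r : u + e <= r <= t -> gamma0 r <> c a.
      by move=> /andP[r0 re] E; have := inj r _ re E; lra.
    have ue0 : 0 <= u + e by lra.
    have [d2 d20 H2] := arc_away LC (u + e) t (c a) ue0 ue tT nz.
    by exists d2 => // r r0 re; apply: H2; rewrite r0.
  have dd : 0 < Num.min d1 d2 by rewrite lt_min d10.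
  have [d' d'0 H] := ccc a _ dd; exists d' => // a' /H.
  have [/andP[v0 vt] Ev] := tauP a'; rewrite -{1}Ev lt_min => /andP[l1 l2].
  rewrite ltNge; apply/negP; rewrite ler_normr => /orP[h|h].
    by have := H2 (tau (c a')) _ vt; lra.
  by have := H1 (tau (c a')) (ltW v0) _; lra.
(* Passing to the antipode changes the sign of [h], so [h] vanishes somewhere: two antipodal points
   would have the same parameter. *)
pose h a := tau (c a) - tau (c (a + pi)).
have c2pi a : c (a + pi + pi) = c a.
  by rewrite /c /cexp !cosDpi !sinDpi !opprK.
have eh : econt `[0, pi] h.
  move=> a _ e e0; have e20 : 0 < e / 2 by rewrite divr_gt0.
  have [d1 d10 H1] := ctau a _ e20; have [d2 d20 H2] := ctau (a + pi) _ e20.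
  exists (Num.min d1 d2) => [|a' _]; first by rewrite lt_min d10.
  rewrite lt_min => /andP[/H1 h1 ad]; have := H2 (a' + pi).
  rewrite (_ : a' + pi - (a + pi) = a' - a); last by ring.
  move=> /(_ ad) h2; rewrite /h.
  rewrite (_ : _ - _ - _ = (tau (c a') - tau (c a)) -
    (tau (c (a' + pi)) - tau (c (a + pi)))); last by ring.
  by rewrite (le_lt_trans (ler_normB _ _))// (splitr e) ltrD.
have : exists2 a, a \in `[0, pi] & h a = 0.
  apply: IVT; [exact: pi_ge0|exact/econtP|].
  have E : h pi = - h 0.
    rewrite /h add0r opprB (_ : c (pi + pi) = c 0)//.
    by rewrite -{1}[pi]add0r c2pi.
  rewrite E ge_min le_max oppr_ge0 oppr_le0.
  by have [_|/ltW ->] := leP (h 0) 0; rewrite ?orbT.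
move=> [a _ ha]; have [_ E1] := tauP a; have [_ E2] := tauP (a + pi).
have : c a = c (a + pi).
  by rewrite -E1 -E2; congr (gamma0 _); move: ha; rewrite /h; lra.
rewrite /c => /addrI E.
have := cexpD (ln rho) a 0 pi; rewrite addr0 -E => E3.
have : cexp (ln rho) a * (1 - cexp 0 pi) = 0 by rewrite mulrBr -E3 mulr1 subrr.
move=> /eqP; rewrite mulf_eq0 => /orP[/eqP/(congr1 cabs)|].
  by rewrite cabs_cexp cabs0 lnK ?posrE// => E4; rewrite E4 ltxx in rho0.
rewrite /cexp expR0 cospi sinpi => /eqP/(congr1 (@complex.Re R)) /=; lra.
Qed.

Hypothesis Wc : forall b, 0 <= b -> (b%:E < T)%E -> econt `[0, b] W.

(** Suppose $g_s(\gamma(t))$ is farther than [e] from $W_s$. A point z outside the hull and close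
    enough to $\gamma(t)$ starts at distance at least e/2, and [flow_stay] keeps it e/4 away from W
    up to time t. But $g_t(z)$ is within e/16 of $W_t$ by the boundary limit defining the driving
    function. *)
Lemma tip t e : times T t -> 0 < e -> exists2 d, 0 < d & forall s, 0 <= s ->
  t - d < s -> s < t -> cabs (gmap s (gamma t) - (W s)%:C) <= e.
Proof.
move=> Tt e0; have [t0 tT] := Tt; have e40 : 0 < e / 16 by rewrite divr_gt0.
have [|d1 d10 H1] := Wc t (ltW t0) tT t _ _ e40.
  by rewrite /= in_itv/= lexx ltW.
pose d := Num.min d1 (e ^+ 2 / 128).
have d0 : 0 < d by rewrite lt_min d10 divr_gt0// exprn_gt0.
exists d => // s s0 sd st; rewrite leNgt; apply/negP => far.
have sT : (s%:E < T)%E by apply: lt_trans tT; rewrite lte_fin.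
have Ds := gamma_dom LC s t st Tt.
have [d2 d20 H2] := hol_cont _ _ (map_hol _ _ _ _ (gmap_map LC s s0 sT) Ds) _ e40.
have [d3 d30 H3] : exists2 d3, 0 < d3 & forall z, dom (K t) z ->
    cabs (z - gamma t) < d3 -> cabs (gmap t z - (W t)%:C) < e / 16.
  have [d3 d30 H3] := cwithin_cvg_eps _ _ _ _ (loewner_curve_driving LC Tt) _ e40.
  by exists d3 => // z; rewrite /gmap /hull_map gt_eqF//; exact: H3.
have d230 : 0 < Num.min d2 d3 by rewrite lt_min d20.
have [z [Dz]] := gamma_closure _ _ Tt d230.
rewrite lt_min => /andP[/H2 zs /(H3 _ Dz) zt].
have F := flowS _ _ _ _ _ _ s0 (lexx t) (gmap_flow t z (ltW t0) tT Dz).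
have dd1 : d <= d1 by rewrite ge_min lexx.
have dd2 : d <= e ^+ 2 / 128 by rewrite ge_min lexx orbT.
have oW r : s <= r -> r <= t -> `|W r - W t| <= e / 16.
  move=> sr rt; apply/ltW/H1; first by rewrite /= in_itv/= rt (le_trans s0).
  by rewrite ler0_norm ?subr_le0//; lra.
have e2 : 0 < e / 2 by rewrite divr_gt0.
have far' : e / 2 <= cabs (gmap s z - (W s)%:C).
  have := cabs_trans (gmap s z) (gmap s (gamma t)) (W s)%:C.
  by rewrite (cabsC (gmap s (gamma t)) (gmap s z)); move: zs; rewrite -/gmap; lra.
have osc r : s <= r -> r <= t -> `|W r - W s| <= e / 2 / 4.
  move=> sr rt; have := oW r sr rt; have := oW s (lexx _) (ltW st).
  rewrite !ler_norml => /andP[? ?] /andP[? ?]; apply/andP; split; lra.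
have ts : t - s <= (e / 2) ^+ 2 / 32 by rewrite expr_div_n; lra.
have [_] := flow_stay _ _ s t (e / 2) F e2 far' osc ts t (ltW st) (lexx _).
lra.
Qed.

End Curve2.

(** * The marked boundary point *)

Section Marked.
Context {R : realType} {x0 : R} {T : \bar R} {gamma : R -> R[i]^o}
  {g : R -> R[i]^o -> R[i]^o} {W x : R -> R}.
Hypothesis x00 : 0 < x0.
Hypothesis LC : loewner_curve x0 T gamma g W x.
Let K := @curve_hull R gamma.
Let gmap := @hull_map R g.

Lemma dom_marked b : 0 <= b -> (b%:E < T)%E -> exists2 d, 0 < d &
  forall eta, 0 < eta -> eta < d -> dom (K b) (x0 +i* eta).
Proof.
move=> b0 bT; have [|d d0 H] := arc_away LC 0 b x0%:C (lexx _) b0 bT.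
  move=> r /andP[r0 rb]; rewrite /curve_from0; case: eqP => [_|/eqP rn0] E.
    by move: x00; rewrite -[x0]/(complex.Re x0%:C) -E ltxx.
  have rp : 0 < r by rewrite lt_neqAle eq_sym rn0.
  have := gamma_im LC r (timesS _ _ rp rb bT).
  by rewrite E ltxx.
exists d => // eta e0 ed; split => // /hull_gamma0[r /andP[r0 rb] E].
have := H r; rewrite (ltW r0) rb E => /(_ isT).
rewrite (_ : _ - _ = 0 +i* eta); last by apply: complexP => /=; ring.
by rewrite cabs_iy ?(ltW e0)// leNgt ed.
Qed.

Lemma marked_limit s e : 0 <= s -> (s%:E < T)%E -> 0 < e ->
  exists2 d, 0 < d & forall eta, 0 < eta -> eta < d ->
    cabs (gmap s (x0 +i* eta) - (x s)%:C) <= e.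
Proof.
move=> + sT e0.
have etaE eta : 0 < eta -> cabs (x0 +i* eta - x0%:C) = eta.
  move=> h; rewrite (_ : _ - _ = 0 +i* eta) ?cabs_iy// ?ltW//.
  by apply: complexP => /=; ring.
rewrite le_eqVlt => /predU1P[<-|s0].
  exists e => // eta h1 h2; rewrite /gmap gmap0 (loewner_curve_marked0 LC).
  by rewrite etaE// ltW.
have [d d0 H] := cwithin_cvg_eps _ _ _ _ (loewner_curve_marked LC (conj s0 sT)) _ e0.
have [d' d'0 H'] := dom_marked s (ltW s0) sT.
exists (Num.min d d') => [|eta h0]; first by rewrite lt_min d0.
rewrite lt_min => /andP[h1 h2]; rewrite /gmap /hull_map gt_eqF//.
by apply/ltW/H; [exact: H'|rewrite etaE].
Qed.

Hypothesis Wc : forall b, 0 <= b -> (b%:E < T)%E -> econt `[0, b] W.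

(** As a boundary limit, $x_t$ is followed by interior points $x_0+i\eta$; one $\eta$ serves four
    given times together. *)
Lemma marked_approx t e q1 q2 q3 q4 : 0 <= t -> (t%:E < T)%E -> 0 < e ->
  0 <= q1 <= t -> 0 <= q2 <= t -> 0 <= q3 <= t -> 0 <= q4 <= t ->
  exists Z, [/\ flow Z W 0 t, cabs (Z q1 - (x q1)%:C) <= e,
    cabs (Z q2 - (x q2)%:C) <= e, cabs (Z q3 - (x q3)%:C) <= e &
    cabs (Z q4 - (x q4)%:C) <= e].
Proof.
move=> t0 tT e0 /andP[a1 b1] /andP[a2 b2] /andP[a3 b3] /andP[a4 b4].
have lT q : q <= t -> (q%:E < T)%E by move=> h; apply: le_lt_trans tT; rewrite lee_fin.
have [d1 d10 H1] := marked_limit q1 e a1 (lT _ b1) e0.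
have [d2 d20 H2] := marked_limit q2 e a2 (lT _ b2) e0.
have [d3 d30 H3] := marked_limit q3 e a3 (lT _ b3) e0.
have [d4 d40 H4] := marked_limit q4 e a4 (lT _ b4) e0.
have [d5 d50 H5] := dom_marked t t0 tT.
have [eta [h0 h1 h2 h3 [h4 h5]]] : exists eta, [/\ 0 < eta, eta < d1, eta < d2,
    eta < d3 & eta < d4 /\ eta < d5].
  exists (Num.min (Num.min (Num.min d1 d2) (Num.min d3 d4)) d5 / 2).
  set m := Num.min _ d5.
  have m0 : 0 < m by rewrite !lt_min d10 d20 d30 d40.
  have [n1 n2 n3 [n4 n5]] : [/\ m <= d1, m <= d2, m <= d3 & m <= d4 /\ m <= d5].
    by rewrite /m !ge_min !lexx ?orbT.
  by split; [..|split]; lra.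
exists (gmap ^~ (x0 +i* eta)); split; [|exact: H1|exact: H2|exact: H3|exact: H4].
by apply: (gmap_flow LC) => //; exact: H5.
Qed.

Lemma marked_local s t d : 0 <= s -> s <= t -> (t%:E < T)%E -> 0 < d ->
  d <= x s - W s -> (forall r, s <= r -> r <= t -> `|W r - W s| <= d / 16) ->
  t - s <= d ^+ 2 / 128 ->
  (forall r, s <= r -> r <= t -> d / 4 <= x r - W r) /\
  forall a b c m, s <= a -> a <= c -> c <= b -> b <= t ->
    (forall r, a <= r -> r <= b -> `|W r - W c| <= m) ->
    `|x b - x a - (b - a) * (2 / (x c - W c))| <=
    32 / d ^+ 2 * (24 / d * (b - a) + m) * (b - a).
Proof.
move=> s0 st tT d0 ds oW ts; have t0 : 0 <= t by lra.
have stay Z : flow Z W 0 t -> cabs (Z s - (x s)%:C) <= d / 16 ->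
    forall r, s <= r -> r <= t ->
      cabs (Z r - Z s) <= d / 8 /\ d / 4 <= cabs (Z r - (W r)%:C).
  move=> F Zs r sr rt; have F' := flowS _ _ _ _ _ _ s0 (lexx t) F.
  have d20 : 0 < d / 2 by rewrite divr_gt0.
  have far : d / 2 <= cabs (Z s - (W s)%:C).
    have := cabs_trans (Z s) (x s)%:C (W s)%:C.
    by rewrite -realcB cabs_real (cabsC _ (Z s)); have := ler_norm (x s - W s); lra.
  have osc q : s <= q -> q <= t -> `|W q - W s| <= d / 2 / 4.
    by move=> h1 h2; have := oW q h1 h2; lra.
  have ts' : t - s <= (d / 2) ^+ 2 / 32 by rewrite expr_div_n; lra.
  have [h1 h2] := flow_stay _ _ s t (d / 2) F' d20 far osc ts' r sr rt.
  by split; [move: h1|move: h2]; lra.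
have pos r : s <= r -> r <= t -> d / 4 <= x r - W r.
  move=> sr rt; have e0 : 0 < d / 16 by rewrite divr_gt0.
  have [|||| Z [F Zs Zr _ _]] := marked_approx t _ s r s s t0 tT e0; try lra.
  have [h1 _] := stay Z F Zs r sr rt.
  have := cabs_trans (Z r) (x r)%:C (x s)%:C; have := cabs_trans (Z s) (Z r) (x s)%:C.
  rewrite -realcB cabs_real (cabsC _ (Z r)) => h2 h3.
  have : `|x r - x s| <= d / 4 by lra.
  have := oW r sr rt; rewrite !ler_norml => /andP[? ?] /andP[? ?]; lra.
split=> // a b c m sa ac cb bt om.
have xc : d / 4 <= x c - W c by apply: pos; lra.
apply: ler_addgt0 => e e0.
pose q := 2 + (b - a) * (32 / d ^+ 2).
have q0 : 0 < q by rewrite /q ltr_pwDl// mulr_ge0 ?divr_ge0 ?exprn_ge0//; lra.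
have [k [k0 kd ke]] : exists k, [/\ 0 < k, k <= d / 16 & k <= e / q].
  exists (Num.min (d / 16) (e / q)); rewrite lt_min !divr_gt0// !ge_min !lexx.
  by rewrite orbT.
have [|||| Z [F Zs Za Zb Zc]] := marked_approx t k s a b c t0 tT k0; try lra.
have Zs' : cabs (Z s - (x s)%:C) <= d / 16 by lra.
have ab : a <= b by lra.
have F' := flowS _ _ _ _ _ _ (le_trans s0 sa) bt F.
have d40 : 0 < d / 4 by rewrite divr_gt0.
have farab r : a <= r -> r <= b -> d / 4 <= cabs (Z r - (W r)%:C).
  by move=> ar rb; have [||_] := stay Z F Zs' r; try lra.
have := flow_diff Z W a b (d / 4) m c F' d40 farab ac cb om.
have -> : 2 / (d / 4) ^+ 2 * (6 / (d / 4) * (b - a) + m) * (b - a) =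
    32 / d ^+ 2 * (24 / d * (b - a) + m) * (b - a) by field; rewrite gt_eqF.
move=> hZ; rewrite -cabs_real.
have cW : d / 4 <= cabs (Z c - (W c)%:C) by apply: farab.
have A0 : Z c - (W c)%:C != 0 by rewrite -cabs_gt0; lra.
have B0 : (x c)%:C - (W c)%:C != 0.
  by rewrite -realcB -cabs_gt0 cabs_real; have := ler_norm (x c - W c); lra.
have -> : (x b - x a - (b - a) * (2 / (x c - W c)))%:C =
   (Z b - Z a - (b - a)%:C * (2%:C / (Z c - (W c)%:C))) -
   ((Z b - (x b)%:C) - (Z a - (x a)%:C)) -
   (b - a)%:C * (2%:C * ((Z c - (x c)%:C) /
     (((x c)%:C - (W c)%:C) * (Z c - (W c)%:C)))).
  have -> : (x b - x a - (b - a) * (2 / (x c - W c)))%:C =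
     (x b)%:C - (x a)%:C - (b - a)%:C * (2%:C / ((x c)%:C - (W c)%:C)).
    by rewrite -!realcB -[in RHS]fmorphV -!rmorphM -realcB.
  by field; rewrite A0 B0.
rewrite (le_trans (cabsB _ _))//.
have := cabsB (Z b - Z a - (b - a)%:C * (2%:C / (Z c - (W c)%:C)))
   ((Z b - (x b)%:C) - (Z a - (x a)%:C)).
have := cabsB (Z b - (x b)%:C) (Z a - (x a)%:C).
have : cabs ((b - a)%:C * (2%:C * ((Z c - (x c)%:C) /
     (((x c)%:C - (W c)%:C) * (Z c - (W c)%:C))))) <= (b - a) * (32 / d ^+ 2) * k.
  rewrite !cabsM cabsV cabsM !cabs_real (ger0_norm (_ : 0 <= b - a)) ?subr_ge0//.
  rewrite -mulrA ler_wpM2l ?subr_ge0// ger0_norm// -realcB cabs_real.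
  have i1 : (`|x c - W c| * cabs (Z c - (W c)%:C))^-1 <= (d ^+ 2 / 16)^-1.
    rewrite lef_pV2 ?posrE ?divr_gt0 ?exprn_gt0//.
      rewrite (_ : d ^+ 2 / 16 = d / 4 * (d / 4)); last by field.
      by apply: ler_pM => //; rewrite ?(ltW d40)// (le_trans xc)// ler_norm.
    by apply: mulr_gt0; [rewrite normr_gt0; lra|lra].
  have i2 : cabs (Z c - (x c)%:C) * (`|x c - W c| * cabs (Z c - (W c)%:C))^-1 <=
      k * (d ^+ 2 / 16)^-1.
    by apply: ler_pM; rewrite ?cabs_ge0 ?invr_ge0 ?mulr_ge0 ?cabs_ge0.
  have -> : 32 / d ^+ 2 * k = 2 * (k * (d ^+ 2 / 16)^-1) by field; rewrite gt_eqF.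
  by rewrite ler_pM2l.
have : k * q <= e by rewrite -ler_pdivlMr.
rewrite /q; lra.
Qed.

End Marked.

(** * Absolutely continuous functions are integrals of their derivatives *)

Section AbsCont.
Context {R : realType}.
Implicit Types (f : R -> R) (a b d e : R) (p q : R * R) (l : seq (R * R)).

(* Intervals are pairs (right end, left end), as in [variation_zip]. *)
Definition ojoint p q := Num.min p.1 q.1 <= Num.max p.2 q.2.

Definition itvs a b l :=
  all (fun p => [&& a <= p.2, p.2 <= p.1 & p.1 <= b]) l && pairwise ojoint l.

Lemma ojoint_sub p q r : p.2 <= q.2 -> q.1 <= p.1 -> ojoint p r -> ojoint q r.
Proof.
rewrite /ojoint => h1 h2; rewrite !le_max !ge_min.
by move=> /orP[/orP[h|h]|/orP[h|h]]; apply/orP; [left|left|right|right];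
  apply/orP; [left|right|left|right]; lra.
Qed.

Lemma ojointC p q : ojoint p q = ojoint q p.
Proof. by rewrite /ojoint minC maxC. Qed.

Lemma ac_seq a b e d f :
  (forall (n : nat) (u v : 'I_n -> R),
      (forall i, a <= u i /\ u i <= v i /\ v i <= b) ->
      trivIset setT (fun i => [set` `]u i, v i[]) ->
      \sum_(i < n) (v i - u i) < d ->
      \sum_(i < n) `|f (v i) - f (u i)| < e) ->
  forall l, itvs a b l -> \sum_(p <- l) (p.1 - p.2) < d ->
  \sum_(p <- l) `|f p.1 - f p.2| < e.
Proof.
move=> H l /andP[/allP al pl]; rewrite !(big_nth (0, 0)) !big_mkord => ld.
apply: H => // [i|].
  by have /and3P[? ? ?] := al _ (mem_nth (0, 0) (ltn_ord i)).
have dj (i j : 'I_(size l)) : (i < j)%N ->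
    [set` `](nth (0, 0) l i).2, (nth (0, 0) l i).1[] `&`
    [set` `](nth (0, 0) l j).2, (nth (0, 0) l j).1[] = set0.
  move=> ij; apply/seteqP; split => // z /=.
  rewrite !in_itv/= => -[/andP[h1 h2] /andP[h3 h4]].
  have /(pairwiseP (0, 0))/(_ i j (ltn_ord i) (ltn_ord j) ij) := pl.
  rewrite /ojoint le_max !ge_min.
  by move=> /orP[/orP[h|h]|/orP[h|h]]; lra.
apply/trivIsetP => i j _ _ ij.
have : (i != j :> nat) by [].
by rewrite neq_ltn => /orP[?|?]; [exact: dj|rewrite setIC; exact: dj].
Qed.

Lemma itvs_zip a b s : itv_partition a b s ->
  itvs a b (zip s (a :: s)) /\ \sum_(p <- zip s (a :: s)) (p.1 - p.2) = b - a.
Proof.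
rewrite /itv_partition => -[+ /eqP <-] {b}.
elim: s a => [|c s IH] a; first by rewrite /itvs/= big_nil subrr.
move=> /andP[ac cs].
have cl : c <= last c s.
  by apply: (@itv_partition_le _ _ c _ s); split.
move: cs => /IH[/andP[]]; rewrite -[zip (c :: s) (a :: _)]/((c, a) :: zip s (c :: s)).
move: (zip s (c :: s)) => t al pl E.
rewrite big_cons/= E; split; last by ring.
rewrite /itvs/= lexx (ltW ac) cl pl/=; apply/and3P; split=> //.
  apply/allP => p /(allP al)/and3P[h1 -> ->]; rewrite andbT; lra.
apply/allP => p /(allP al)/and3P[h1 h2 h3].
by rewrite /ojoint/= le_max !ge_min h1 orbT.
Qed.

(** Induction on [l2]: the variation over its head is a supremum over partitions, and the pieces of
    a partition can be moved into [l1] without changing the total length. *)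
Lemma ac_variation a b e d f :
  (forall l, itvs a b l -> \sum_(p <- l) (p.1 - p.2) < d ->
    \sum_(p <- l) `|f p.1 - f p.2| < e) ->
  forall l2 l1, itvs a b (l1 ++ l2) -> \sum_(p <- l1 ++ l2) (p.1 - p.2) < d ->
  ((\sum_(p <- l1) `|f p.1 - f p.2|)%:E +
   \sum_(p <- l2) total_variation p.2 p.1 f <= e%:E)%E.
Proof.
move=> H; elim=> [|p l2 IH] l1.
  by rewrite cats0 big_nil adde0 lee_fin => h1 h2; apply/ltW/H.
move=> I D; rewrite big_cons.
have [pi p2] : [&& a <= p.2, p.2 <= p.1 & p.1 <= b] /\
    (0 <= \sum_(q <- l2) total_variation q.2 q.1 f)%E.
  move: I => /andP[]; rewrite all_cat/= => /and3P[_ -> al] _; split => //.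
  rewrite big_seq; apply: sume_ge0 => q ql.
  by have /and3P[? ? ?] := allP al _ ql; exact: total_variation_ge0.
suff HH s : itv_partition p.2 p.1 s ->
  ((\sum_(q <- l1) `|f q.1 - f q.2| + variation p.2 p.1 f s)%:E +
    \sum_(q <- l2) total_variation q.2 q.1 f <= e%:E)%E.
  move: p2 HH; set S := (\sum_(q <- l2) total_variation q.2 q.1 f)%E.
  set A := \sum_(q <- l1) _ => p2 HH.
  have Sfin : S \is a fin_num.
    have [s /HH] : exists s, itv_partition p.2 p.1 s.
      have [h|h] := ltP p.2 p.1; first by exists [:: p.1]; exact: itv_partition1.
      exists [::]; split => //=; case/and3P: pi => _ h' _.
      by apply/eqP/le_anti; rewrite h h'.
    move: p2; case: (S) => // p2' /=; by rewrite addey.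
  rewrite addeCA -leeBrDr ?fin_numD//; apply: ge_ereal_sup => _ [_ [s sp <-] <-].
  by rewrite leeBrDr ?fin_numD// addeA -EFinD (addrC _ A); exact: HH.
move=> sp; rewrite variation_zip// -big_cat.
have [] := itvs_zip _ _ _ sp; move: (zip s (p.2 :: s)) => t /andP[al pl] len.
have sub q : q \in t -> [/\ p.2 <= q.2, q.2 <= q.1 & q.1 <= p.1].
  by move=> /(allP al)/and3P.
apply: IH; last first.
  move: D; rewrite !big_cat big_cons/=. by rewrite len addrA.
move: I => /andP[]; rewrite /itvs !all_cat/= !pairwise_cat/= allrel_consr.
move=> /and3P[-> _ ->] /and3P[/andP[r1 r2] -> /andP[r3 ->]].
rewrite allrel_catl r2 pl/= !andbT; apply/and3P; split.
- apply/allP => q /sub[h1 h2 h3]; case/and3P: pi => h4 h5 h6.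
  by apply/and3P; split; lra.
- apply/allrelP => q r /sub[h1 h2 h3] rl.
  by apply: (ojoint_sub p) => //; exact: (allP r3).
- apply/allrelP => r q rl /sub[h1 h2 h3]; rewrite ojointC.
  by apply: (ojoint_sub p) => //; rewrite ojointC; exact: (allP r1).
Qed.

Lemma abs_continuous_tv a b f : a <= b -> abs_continuous a b f ->
  total_variation a b f \is a fin_num /\
  forall e, 0 < e -> exists2 d, 0 < d & forall l, itvs a b l ->
    \sum_(p <- l) (p.1 - p.2) < d ->
    (\sum_(p <- l) total_variation p.2 p.1 f <= e%:E)%E.
Proof.
move=> ab H.
have AC e : 0 < e -> exists2 d, 0 < d & forall l, itvs a b l ->
    \sum_(p <- l) (p.1 - p.2) < d ->
    (\sum_(p <- l) total_variation p.2 p.1 f <= e%:E)%E.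
  move=> /H[d d0 /ac_seq/ac_variation h]; exists d => // l il ld.
  by have := h l [::]; rewrite big_nil add0e; apply.
split => //; have [d d0 Hd] := AC 1 ltr01.
(* Pieces of length d/2 have variation at most 1 each, which bounds the total variation by their
   number. *)
have step N c : a <= c -> c <= b -> c <= a + N%:R * (d / 2) ->
    (total_variation a c f <= N%:R%:E)%E.
  elim: N c => [|N IH] c ac cb cN.
    have -> : c = a by lra.
    by rewrite total_variationxx.
  have [h|h] := leP c (a + N%:R * (d / 2)).
    by rewrite (le_trans (IH _ ac cb h))// lee_fin ler_nat.
  set c' := a + N%:R * (d / 2) in h.
  have ac' : a <= c' by rewrite /c' lerDl mulr_ge0// ltW// divr_gt0.
  rewrite (total_variationD f ac' (ltW h)) -addn1 natrD EFinD.
  apply: leeD; first by apply: IH => //; lra.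
  have := Hd [:: (c, c')]; rewrite !big_seq1; apply.
    by rewrite /itvs/= ac' cb (ltW h).
  by move: cN; rewrite -addn1 natrD mulrDl /c' /=; lra.
rewrite ge0_fin_numE; last exact: total_variation_ge0.
have [N hN] : exists N : nat, b <= a + N%:R * (d / 2).
  exists (Num.truncn ((b - a) / (d / 2))).+1.
  have := truncnS_gt ((b - a) / (d / 2)).
  by rewrite ltr_pdivrMr ?divr_gt0//; lra.
by rewrite (le_lt_trans (step N b ab (lexx _) hN))// ltry.
Qed.

End AbsCont.

Lemma open_interval_ends {R : realType} (I : set R) : open I -> is_interval I ->
  (@lebesgue_measure R I < +oo)%E -> exists p : R * R,
  [/\ p.2 <= p.1, I `<=` `]p.2, p.1]%classic, `]p.2, p.1[%classic `<=` I &
    @lebesgue_measure R I = (p.1 - p.2)%:E].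
Proof.
move=> oI iI; have [->|/set0P[z Iz]] := eqVneq I set0.
  exists (0, 0); split => //=; last by rewrite measure0 subrr.
  by move=> z /=; rewrite in_itv/= => /andP[h1 h2]; have := lt_trans h1 h2; rewrite ltxx.
move: (iI) => /is_intervalP IE; rewrite IE.
have : [set` Rhull I] z by rewrite -IE.
rewrite lebesgue_measure_itv.
case: (Rhull I) IE => [[c u|[]] [c' v|[]]] IE //=; rewrite ?in_itv/= ?ltNyr ?ltry//=.
  move=> /andP[h1 h2] _; exists (v, u).
  have uz : u <= z by case: c h1 {IE} => //= /ltW.
  have zv : z <= v by case: c' h2 {IE} => //= /ltW.
  have uv := le_trans uz zv; split => //=.
  - move=> w /=; rewrite !in_itv/= => /andP[h3 h4].
    have -> : w <= v by case: c' h4 {IE h2} => //= /ltW.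
    rewrite andbT lt_neqAle; apply/andP; split; last by case: c h3 {IE h1} => //= /ltW.
    apply/eqP => uw; have Iu : I u by rewrite uw IE /= in_itv/= h3.
    have [e /= e0 be] := oI u Iu.
    have : I (u - e / 2).
      by apply: be => /=; rewrite opprB addrC subrK ger0_norm//; lra.
    by rewrite IE /= in_itv/= => /andP[+ _]; case: c {IE h1 h3} => /= ?; lra.
  - move=> w /=; rewrite !in_itv/= => /andP[h3 h4].
    by apply/andP; split; [case: c {IE h1} => //=; exact: ltW|
      case: c' {IE h2} => //=; exact: ltW].
  rewrite lte_fin; case: ltP => // vu.
  by rewrite (_ : v = u) ?subrr//; apply/le_anti; rewrite vu uv.
by rewrite andbF.
Qed.

Section Density.
Context {R : realType} {a b : R} {G : R -> R}.
Hypothesis ab : a <= b.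
Hypothesis Gnd : forall x y, a <= x -> x <= y -> y <= b -> G x <= G y.
Hypothesis Gac : forall e : R, 0 < e -> exists2 d : R, 0 < d & forall l, itvs a b l ->
  \sum_(p <- l) (p.1 - p.2) < d -> \sum_(p <- l) (G p.1 - G p.2) <= e.

(** Clamping to [a, b] is nondecreasing and does not increase distances, so composing with it
    extends [G] to the whole line. *)
Let cl (x : R) := Num.max a (Num.min x b).
Let F x := G (cl x).

Let cl_in x : a <= cl x <= b.
Proof. by rewrite /cl le_max lexx/= ge_max ab/= ge_min lexx orbT. Qed.

Let cl_nd x y : x <= y -> cl x <= cl y.
Proof.
move=> xy; rewrite /cl ge_max !le_max !le_min !ge_min lexx/=.
by case: (leP x b) => h1; case: (leP y b) => h2; case: (leP a x) => h3;
  rewrite ?lexx ?xy ?h1 ?h2 ?ab ?orbT//=; lra.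
Qed.

Let cl_dist x y : x <= y -> cl y - cl x <= y - x.
Proof.
move=> xy; rewrite /cl.
by case: (leP x b) => h1; case: (leP y b) => h2; rewrite /Num.max;
 do 2?case: ifP => ?; lra.
Qed.

Let F_nd : nondecreasing F.
Proof.
move=> x y xy; rewrite /F; case/andP: (cl_in x) => h1 h2.
by case/andP: (cl_in y) => h3 h4; apply: Gnd => //; exact: cl_nd.
Qed.

Let F_bd x y : F y - F x <= G b - G a.
Proof.
have h z : G a <= F z <= G b.
  by case/andP: (cl_in z) => h1 h2; rewrite /F !Gnd.
by case/andP: (h x) => h1 h2; case/andP: (h y) => h3 h4; lra.
Qed.

Let F_rc : right_continuous F.
Proof.
move=> x; apply/cvgrPdist_le => e e0; have [d d0 H] := Gac e e0.
near=> y.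
have xy : x <= y by apply/ltW; near: y; exact: nbhs_right_gt.
have yd : y < x + d by near: y; apply: nbhs_right_lt; rewrite ltrDl.
rewrite distrC ger0_norm ?subr_ge0 ?F_nd//.
have := H [:: (cl y, cl x)]; rewrite !big_seq1; apply.
  rewrite /itvs/= cl_nd//; case/andP: (cl_in x) => -> _.
  by case/andP: (cl_in y) => _ ->.
by have := cl_dist x y xy; rewrite /=; lra.
Unshelve. all: by end_near. Qed.

(** The Lebesgue-Stieltjes measure of the extension is finite. It vanishes on null sets: such a set
    lies in an open set of measure below [d], and [Gac] bounds the increments of G over its
    components. Radon-Nikodym supplies the density. *)
Lemma monotone_density : exists h : R -> R,
  (@lebesgue_measure R).-integrable setT (EFin \o h) /\
  forall s t, a <= s -> s <= t -> t <= b ->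
    G t - G s = \int[@lebesgue_measure R]_(x in `]s, t]) h x.
Proof.
pose Fm := isCumulative.Build R _ R F F_nd F_rc.
pose Fc : cumulative R R := HB.pack F Fm.
pose nu := lebesgue_stieltjes_measure Fc.
have nuE (s t : R) : s <= t -> nu (`]s, t]%classic : set R) = (F t - F s)%:E.
  move=> st; rewrite /nu /lebesgue_stieltjes_measure.
  rewrite /measure_extension measurable_mu_extE/=; last exact: is_ocitv.
  by rewrite wlength_itv_bnd.
have nuT : (nu setT <= (G b - G a)%:E)%E.
  rewrite -(bigcup_itvT false false).
  pose I n : set R := `]- (n%:R), n%:R]%classic.
  have c : (nu \o I) n @[n --> \oo] --> nu (\bigcup_n I n).
    apply: nondecreasing_cvg_mu; rewrite /I//; first exact: bigcup_measurable.
    by move=> *; apply/subsetPset/subset_itv; rewrite leBSide/= ?lerN2 ler_nat.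
  rewrite -(cvg_lim _ c)//; apply: lime_le; first by apply/cvg_ex; eexists; exact: c.
  by apply: nearW => n; rewrite /= /I nuE ?lee_fin ?F_bd// ge0_cp.
have nufin : fin_num_fun nu.
  move=> A mA; rewrite ge0_fin_numE//; apply: le_lt_trans (ltry (G b - G a)).
  by rewrite (le_trans _ nuT)//; apply: le_measure => //; exact: mem_set.
pose nm := Measure_isFinite.Build _ _ _ nu nufin.
pose nuf : {finite_measure set _ -> \bar R} := HB.pack nu nm.
have dom : nuf `<< (@lebesgue_measure R).
  apply/null_content_dominatesP => A mA A0.
  change (nu A = 0%E); apply/eqP; rewrite eq_le measure_ge0 andbT.
  apply/lee_addgt0Pr => e e0; rewrite add0e; have [d d0 Hd] := Gac e e0.
  have [|U [oU AU UA]] := lebesgue_regularity_outer mA _ d0; first by rewrite A0.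
  have mU : measurable U by exact: measurable_realfun.open_measurable.
  have Ud : (@lebesgue_measure R U < d%:E)%E.
    rewrite -(setDUK AU); apply: (@le_lt_trans _ _
        (@lebesgue_measure R A + @lebesgue_measure R (U `\` A))%E).
      by apply: measureU2 => //; exact: measurableD.
    by rewrite A0 add0e.
  pose I := open_disjoint_itv oU.
  have mI k : measurable (I k).
    by apply: measurable_realfun.open_measurable; exact: open_disjoint_itv_open.
  have UE : U = \bigcup_k I k := open_disjoint_itv_bigcup oU.
  have tI : trivIset setT I by exact: open_disjoint_itv_trivIset.
  have lI k : (@lebesgue_measure R (I k) < +oo)%E.
    apply: (@le_lt_trans _ _ (@lebesgue_measure R U)); last exact: lt_trans Ud (ltry _).
    apply: le_measure; [exact: (mem_set (mI k))|exact: mem_set|].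
    by move=> y Iy; rewrite UE; exists k.
  have /choice[p Hp] : forall k, exists p : R * R,
      [/\ p.2 <= p.1, I k `<=` `]p.2, p.1]%classic, `]p.2, p.1[%classic `<=` I k &
        @lebesgue_measure R (I k) = (p.1 - p.2)%:E].
    move=> k; apply: open_interval_ends => //; first exact: open_disjoint_itv_open.
    exact: open_disjoint_itv_is_interval.
  apply: (@le_trans _ _ (nu U)); first by apply: le_measure => //; exact: mem_set.
  have -> : nu U = (\sum_(0 <= k <oo) nu (I k))%E.
    rewrite [in LHS]UE; apply: (measure_semi_bigcup nuf mI tI).
    by have := mU; rewrite {1}UE.
  apply: lime_le; first by apply: is_cvg_nneseries => *; exact: measure_ge0.
  apply: nearW => n.
  pose l := [seq (cl (p k).1, cl (p k).2) | k <- iota 0 n].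
  apply: (@le_trans _ _ (\sum_(q <- l) (G q.1 - G q.2))%:E).
    rewrite /l big_map -sumEFin /index_iota subn0; apply: lee_sum => k _.
    have [h1 h2 h3 h4] := Hp k; rewrite -nuE//.
    by apply: le_measure => //; apply: mem_set; [exact: mI|exact: measurable_itv].
  rewrite lee_fin; apply: Hd.
    apply/andP; split.
      apply/allP => _ /mapP[k _ ->] /=; have [h1 _ _ _] := Hp k.
      case/andP: (cl_in (p k).1) => _ ->; case/andP: (cl_in (p k).2) => -> _.
      by rewrite cl_nd.
    rewrite pairwise_map; have := iota_uniq 0 n; rewrite uniq_pairwise.
    apply: sub_pairwise => i j /= ij; rewrite /ojoint /=.
    have : ojoint (p i) (p j).
      rewrite /ojoint leNgt; apply: contraNN ij => uv; apply/eqP.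
      apply: (tI i j Logic.I Logic.I).
      exists ((Num.max (p i).2 (p j).2 + Num.min (p i).1 (p j).1) / 2).
      have [_ _ hi _] := Hp i; have [_ _ hj _] := Hp j.
      move: uv; rewrite lt_min !gt_max => /andP[/andP[a1 a2] /andP[a3 a4]].
      by split; [apply: hi|apply: hj]; rewrite /= in_itv/= /Num.max /Num.min;
        do 2?case: ifP => ?; apply/andP; split; lra.
    move: (cl_nd (p i).1 (p i).2) (cl_nd (p i).1 (p j).2).
    move: (cl_nd (p j).1 (p i).2) (cl_nd (p j).1 (p j).2); rewrite /ojoint /=.
    move: (cl _) (cl _) (cl _) (cl _) => c1 c2 c3 c4 h1 h2 h3 h4.
    by rewrite !le_max !ge_min => /orP[/orP[/h3->|/h1->]|/orP[/h4->|/h2->]];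
      rewrite ?orbT.
  rewrite -lte_fin; apply: le_lt_trans Ud.
  have -> : lebesgue_measure U = (\sum_(0 <= k <oo) lebesgue_measure (I k))%E.
    rewrite [in LHS]UE; apply: measure_semi_bigcup => //.
    by have := mU; rewrite {1}UE.
  apply: le_trans (nneseries_lim_ge n _); last by move=> *; exact: measure_ge0.
  rewrite /l big_map -sumEFin /index_iota subn0; apply: lee_sum => k _.
  by have [h1 _ _ ->] := Hp k; rewrite lee_fin; exact: cl_dist.
have [h [h0 hfin hint hE]] := radon_nikodym_sigma_finite dom.
exists (fine \o h); have hE' : EFin \o (fine \o h) = h.
  by apply/funext => y /=; rewrite fineK.
split => [|s t as_ st tb]; first by rewrite hE'.
rewrite /Rintegral (eq_integral h) => [|y _]; last by rewrite /= fineK.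
rewrite -hE//= nuE//= /F.
have clE z : a <= z -> z <= b -> cl z = z.
  by move=> az zb; rewrite /cl min_l// max_r.
by rewrite !clE//; lra.
Qed.
End Density.

(** With V the total variation, f = V - (V - f) is a difference of nondecreasing absolutely
    continuous functions. Lebesgue differentiation identifies the derivative with the density almost
    everywhere. *)
Lemma ac_density {R : realType} (a b : R) (f : R -> R) :
  a <= b -> abs_continuous a b f ->
  exists w : R -> R, [/\ (@lebesgue_measure R).-integrable setT (EFin \o w),
    forall s t, a <= s -> s <= t -> t <= b ->
      f t - f s = \int[@lebesgue_measure R]_(x in `]s, t]) w x &
    {ae (@lebesgue_measure R), forall t, a < t < b ->
      derivable f t 1 /\ derive1 f t = w t}].
Proof.
move=> ab /(abs_continuous_tv _ _ _ ab)[fin Hac].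
pose V x := fine (total_variation a x f).
have Vfin x y : a <= x -> x <= y -> y <= b -> total_variation x y f \is a fin_num.
  move=> ax xy yb; rewrite ge0_fin_numE ?total_variation_ge0//.
  apply: (@le_lt_trans _ _ (total_variation a b f)).
    rewrite (total_variationD f (le_trans ax xy) yb) (total_variationD f ax xy).
    by rewrite addeAC leeDr// adde_ge0 ?total_variation_ge0.
  by rewrite ltey_eq fin.
have VE x y : a <= x -> x <= y -> y <= b ->
    V y - V x = fine (total_variation x y f).
  move=> ax xy yb; rewrite /V (total_variationD f ax xy) fineD ?Vfin//; first by ring.
  exact: le_trans xy yb.
have Vf x y : a <= x -> x <= y -> y <= b -> `|f y - f x| <= V y - V x.
  move=> ax xy yb; rewrite VE//.
  by rewrite -lee_fin fineK ?Vfin// total_variation_ge.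
have Vac (e : R) : 0 < e -> exists2 d : R, 0 < d & forall l, itvs a b l ->
    \sum_(p <- l) (p.1 - p.2) < d -> \sum_(p <- l) (V p.1 - V p.2) <= e.
  move=> /Hac[d d0 H]; exists d => // l il /(H l il); rewrite -lee_fin; apply: le_trans.
  rewrite -sumEFin big_seq [leRHS]big_seq; apply: lee_sum => p pl.
  case/andP: il => /allP/(_ p pl)/and3P[h1 h2 h3] _.
  by rewrite VE// fineK ?Vfin.
have [||h1 [i1 e1]] := @monotone_density _ a b V ab.
- move=> x y ax xy yb; rewrite -subr_ge0; exact: le_trans (Vf x y ax xy yb).
- exact: Vac.
have [||h2 [i2 e2]] := @monotone_density _ a b (fun x => V x - f x) ab.
- move=> x y ax xy yb; have := Vf x y ax xy yb; rewrite ler_norml => /andP[_]; lra.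
- move=> e e0; have [|d d0 H] := Vac (e / 2); first by rewrite divr_gt0.
  exists d => // l il ld; apply: le_trans (_ : 2 * \sum_(p <- l) (V p.1 - V p.2) <= e).
    rewrite mulr_sumr big_seq [leRHS]big_seq; apply: ler_sum => p pl.
    case/andP: il => /allP/(_ p pl)/and3P[h4 h5 h6] _.
    by have := Vf _ _ h4 h5 h6; rewrite ler_norml => /andP[+ _]; lra.
  by have := H l il ld; lra.
pose w x := h1 x - h2 x.
have iw : (@lebesgue_measure R).-integrable setT (EFin \o w).
  by have := integrableB measurableT i1 i2; apply: eq_integrable.
have wE s t : a <= s -> s <= t -> t <= b ->
    f t - f s = \int[@lebesgue_measure R]_(x in `]s, t]) w x.
  move=> h3 h4 h5; rewrite RintegralB//.
  - by rewrite -e1// -e2//; ring.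
  - exact: integrableS i1.
  - exact: integrableS i2.
exists w; split => //.
have loc : locally_integrable setT w by apply: open_integrable_locally => //; exact: openT.
have iy (y : R) : (@lebesgue_measure R).-integrable
    [set` Interval (BRight a) (BRight y)] (EFin \o w) by exact: integrableS iw.
have := FTC1 iy loc.
apply: filterS; first exact: (ae_filter_ringOfSetsType (@lebesgue_measure R)).
move=> t Ht /andP[at_ tb].
have [] := Ht _; first exact: at_.
set F := fun y : R => _; move=> dF <-.
have nE : \forall y \near t, (F \+ cst (f a)) y = f y.
  near=> y; have ay : a < y by near: y; exact: lt_nbhsr.
  have yb : y < b by near: y; exact: lt_nbhsl.
  by rewrite -[LHS]/(F y + f a) /F -(wE a y (lexx _) (ltW ay) (ltW yb)) subrK.
have dc : derivable (cst (f a) : R -> R) t 1 by exact: derivable_cst.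
split; first by apply: near_eq_derivable nE _; exact: derivableD.
rewrite !derive1E -(near_eq_derive _ nE) deriveD// derive_cst addr0.
by [].
Unshelve. all: by end_near. Qed.

(** * Integrals of nonnegative functions as suprema, and tails of the energy *)

Import HBNNSimple.

Section LowerIntegral.
Context {d} {T : measurableType d} {R : realType}.
Variable mu : {measure set T -> \bar R}.
Local Open Scope ereal_scope.

(* No measurability is assumed: for nonnegative functions the integral is
   a supremum over simple minorants. *)
Lemma ge0_integral_mono (A B : set T) (f g : T -> \bar R) :
  (forall x, A x -> 0 <= f x) -> (forall x, B x -> 0 <= g x) -> A `<=` B ->
  (forall x, A x -> f x <= g x) ->
  \int[mu]_(x in A) f x <= \int[mu]_(x in B) g x.
Proof.
move=> f0 g0 AB fg; rewrite !ge0_integralE//.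
apply: ereal_sup_le => _ [h hf <-].
exists h => // x; apply: le_trans (hf x) _.
rewrite /patch; case: ifP => [/set_mem Ax|_]; first by rewrite mem_set ?fg//; exact: AB.
by case: ifP => // /set_mem; exact: g0.
Qed.

(** The sum of simple minorants on two disjoint sets is a simple minorant on the union. *)
Lemma ge0_integral_superadd (A B : set T) (f : T -> \bar R) :
  (forall x, (A `|` B) x -> 0 <= f x) -> A `&` B = set0 ->
  \int[mu]_(x in A) f x + \int[mu]_(x in B) f x <= \int[mu]_(x in A `|` B) f x.
Proof.
move=> f0 AB.
have fA x : A x -> 0 <= f x by move=> Ax; apply: f0; left.
have fB x : B x -> 0 <= f x by move=> Bx; apply: f0; right.
have ge0 (C : set T) : (forall x, C x -> 0 <= f x) -> 0 <= \int[mu]_(x in C) f x.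
  exact: integral_ge0.
have [->|AfinN] := eqVneq (\int[mu]_(x in A `|` B) f x) +oo; first by rewrite leey.
have Ufin : \int[mu]_(x in A `|` B) f x \is a fin_num.
  by rewrite ge0_fin_numE ?ge0// ltey.
have le1 (C : set T) : C `<=` A `|` B ->
    \int[mu]_(x in C) f x \is a fin_num.
  move=> CU; have C0 x : C x -> 0 <= f x by move=> /CU; exact: f0.
  rewrite ge0_fin_numE ?ge0//; apply: (@le_lt_trans _ _ (\int[mu]_(x in A `|` B) f x)).
    exact: ge0_integral_mono.
  by rewrite ltey.
have IA := le1 A (@subsetUl _ _ _); have IB := le1 B (@subsetUr _ _ _).
rewrite -leeBrDr//; rewrite (ge0_integralE _ fA).
apply: ge_ereal_sup => _ [h hf <-]; rewrite leeBrDr// addeC.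
have sfin : sintegral mu h \is a fin_num.
  rewrite ge0_fin_numE ?sintegral_ge0//; apply: (@le_lt_trans _ _ (\int[mu]_(x in A) f x)).
    by rewrite ge0_integralE//; apply: ereal_sup_ubound; exists h.
  by rewrite ltey_eq IA.
rewrite -leeBrDr//; rewrite (ge0_integralE _ fB).
apply: ge_ereal_sup => _ [h' hf' <-]; rewrite leeBrDr//.
rewrite -sintegralD ge0_integralE//.
apply: ereal_sup_ubound; exists (add_nnsfun h' h) => //= x.
have := hf x; have := hf' x; rewrite /patch EFinD.
have [xA|xA] := boolP (x \in A); have [xB|xB] := boolP (x \in B).
- by have : (A `&` B) x by [split; exact: set_mem]; rewrite AB.
- rewrite mem_set; last by left; exact: set_mem.
  by move=> h1 h2; rewrite -[leRHS]add0e; exact: leeD.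
- rewrite mem_set; last by right; exact: set_mem.
  by move=> h1 h2; rewrite -[leRHS]adde0; exact: leeD.
- rewrite memNset; last by move=> []/mem_set; apply/negP.
  by move=> h1 h2; rewrite -[leRHS]adde0; exact: leeD.
Qed.

Lemma integral_le_funepos (A : set T) (f : T -> \bar R) :
  \int[mu]_(x in A) f x <= \int[mu]_(x in A) f^\+ x.
Proof.
have q0 : 0 <= \int[mu]_(x in A) f^\- x by apply: integral_ge0.
rewrite [leLHS]integralE; move: q0; set q := integral _ _ (f^\-).
by move: q => q q0; rewrite -[leRHS]sube0; exact: leeB.
Qed.

Lemma ge0_integral_scale (A : set T) (f : T -> R) (C : R) :
  (0 <= C)%R -> (forall x, A x -> (0 <= f x)%R) ->
  \int[mu]_(x in A) (C * f x)%:E <= C%:E * \int[mu]_(x in A) (f x)%:E.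
Proof.
move=> C0 f0; have f0' x : A x -> 0 <= (f x)%:E by move=> /f0; rewrite lee_fin.
have Cf0 x : A x -> 0 <= (C * f x)%:E by move=> /f0 h; rewrite lee_fin mulr_ge0.
move: C0; rewrite le_eqVlt => /predU1P[C0|C0].
  by rewrite -C0 mul0e integral0_eq// => x _; rewrite mul0r.
rewrite (ge0_integralE _ Cf0); apply: ge_ereal_sup => _ [h hf <-].
have Ci : (0 <= C^-1)%R by rewrite invr_ge0 ltW.
have -> : sintegral mu h = C%:E * sintegral mu (scale_nnsfun h Ci).
  by rewrite /= sintegralrM muleA -EFinM mulfV ?gt_eqF// mul1e.
rewrite lee_pmul2l//; rewrite ge0_integralE//.
apply: ereal_sup_ubound; exists (scale_nnsfun h Ci) => //= x.
have := hf x; rewrite /patch; case: ifP => _; rewrite !lee_fin.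
  by rewrite ler_pdivrMl.
by move=> h0; rewrite pmulr_rle0// invr_gt0.
Qed.

End LowerIntegral.

(** Choose [s] for which the integral up to [s] is within [e] of the supremum of all such partial
    integrals; superadditivity bounds what comes after. *)
Lemma integral_tail {R : realType} (T : \bar R) (f : R -> \bar R) (e : R) :
  (0 < T)%E -> (forall t, times T t -> (0 <= f t)%E) ->
  (\int[@lebesgue_measure R]_(t in times T) f t < +oo)%E -> 0 < e ->
  exists2 s, times T s & forall b, s <= b -> (b%:E < T)%E ->
    (\int[@lebesgue_measure R]_(t in `]s, b[) f t <= e%:E)%E.
Proof.
move=> T0 f0 ffin e0.
pose F (s : R) := (\int[@lebesgue_measure R]_(t in `]0%R, s[) f t)%E.
have sub (s b : R) : 0 <= s -> (b%:E < T)%E -> `]s, b[%classic `<=` times T.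
  move=> s0 bT t; rewrite /= in_itv/= => /andP[h1 h2]; split; first exact: le_lt_trans h1.
  by apply: lt_trans bT; rewrite lte_fin.
pose M := ereal_sup [set F s | s in times T].
have le1 s : times T s -> (F s <= \int[@lebesgue_measure R]_(t in times T) f t)%E.
  move=> [s0 sT]; apply: ge0_integral_mono => //; last exact: sub.
  by move=> t /(sub _ _ (lexx _) sT); exact: f0.
have F0 s : times T s -> (0 <= F s)%E.
  by move=> [s0 sT]; apply: integral_ge0 => t /(sub _ _ (lexx _) sT); exact: f0.
have [s1 s1T] : exists s, times T s.
  move: T0; case: (T) => [r| |]//; rewrite ?lte_fin => r0.
    by exists (r / 2); split; rewrite ?lte_fin; lra.
  by exists 1; split; rewrite ?ltry.
have Mfin : M \is a fin_num.
  rewrite ge0_fin_numE; last first.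
    by apply: le_trans (F0 _ s1T) _; apply: ereal_sup_ubound; exists s1.
  by apply: le_lt_trans ffin; apply: ge_ereal_sup => _ [s sT <-]; exact: le1.
have [_ [s sT <-] sM] := ub_ereal_sup_adherent e0 Mfin.
exists s => // b sb bT; have [s0 sT'] := sT; have bT' : times T b by split=> //; lra.
have FM : (F b <= M)%E by apply: ereal_sup_ubound; exists b.
have Ffin t : times T t -> F t \is a fin_num.
  by move=> tT; rewrite ge0_fin_numE ?F0//; apply: le_lt_trans ffin; exact: le1.
set J := (\int[@lebesgue_measure R]_(t in `]s, b[) f t)%E.
have : (F s + J <= F b)%E.
  have AB : (`]0, s[%classic `&` `]s, b[%classic : set R) = set0.
    apply/seteqP; split => // t [/=]; rewrite !in_itv/= => /andP[_ h1] /andP[h2 _].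
    by have := lt_trans h1 h2; rewrite ltxx.
  have U : (`]0, s[%classic `|` `]s, b[%classic : set R) `<=` `]0, b[%classic.
    move=> t [] /=; rewrite !in_itv/= => /andP[h1 h2]; apply/andP; split => //.
      exact: lt_le_trans sb.
    exact: lt_trans h1.
  have f0' (t : R) : `]0, b[%classic t -> (0 <= f t)%E.
    by move=> /(sub _ _ (lexx _) bT); exact: f0.
  have := ge0_integral_superadd (@lebesgue_measure R) _ _ f _ AB.
  move=> /(_ (fun t h => f0' t (U t h))) /le_trans; apply.
  by apply: ge0_integral_mono => // t /U; exact: f0'.
rewrite -/M in sM; move: (Ffin _ sT) (Ffin _ bT') Mfin sM FM.
move: (F s) (F b) (M) (J) => [fs| |]// [fb| |]// [m| |]// [r| |]// _ _ _.
all: by rewrite -?EFinB -?EFinD ?lte_fin ?lee_fin ?leNye//; lra.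
Qed.

(** * Integrating differential inequalities along the driving function *)

Definition jint {R : realType} (s t : R) (h : R -> R) : R :=
  \int[@lebesgue_measure R]_(x in `]s, t]) h x.

Definition jint_able {R : realType} (a b : R) (h : R -> R) :=
  (@lebesgue_measure R).-integrable `]a, b] (EFin \o h).

Section Jint.
Context {R : realType}.
Implicit Types (a b s t r c : R) (h f g : R -> R).

Lemma jint_ableS a b s t h : a <= s -> t <= b -> jint_able a b h -> jint_able s t h.
Proof.
by move=> as_ tb; apply: integrableS => //; apply: subset_itv; rewrite bnd_simp.
Qed.

Lemma jintxx s h : jint s s h = 0.
Proof.
rewrite /jint (_ : `]s, s]%classic = set0) ?Rintegral_set0//.
by apply/seteqP; split => // x /=; rewrite in_itv/= => /andP[h1 h2]; lra.
Qed.

Lemma jint_cat a r b h : jint_able a b h -> a <= r -> r <= b ->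
  jint a b h = jint a r h + jint r b h.
Proof.
move=> ih ar rb; have := @Rintegral_itvB R h (BRight a) (BRight b) r ih.
by rewrite !bnd_simp /jint => /(_ ar rb) <-; ring.
Qed.

Lemma jint_cst s t c : s <= t -> jint s t (fun=> c) = c * (t - s).
Proof.
move=> st; rewrite /jint Rintegral_cst//= lebesgue_measure_itv/= lte_fin.
by case: ltP => [//|ts]/=; rewrite (_ : t = s) ?subrr//; apply/le_anti; rewrite ts st.
Qed.

Lemma jint_able_cst s t c : jint_able s t (fun=> c).
Proof.
have h : s <= Num.max s t by rewrite le_max lexx.
apply: (@jint_ableS s (Num.max s t)) => //; first by rewrite le_max lexx orbT.
apply: integrableS (@econt_integrable R s (Num.max s t) (fun=> c) _) => //.
- by apply: subset_itv; rewrite bnd_simp.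
- by move=> x _ e e0; exists 1 => // y _ _; rewrite subrr normr0.
Qed.

Lemma jintD s t f g : jint_able s t f -> jint_able s t g ->
  jint s t (fun x => f x + g x) = jint s t f + jint s t g.
Proof. exact: RintegralD. Qed.

Lemma jint_ableD s t f g : jint_able s t f -> jint_able s t g ->
  jint_able s t (fun x => f x + g x).
Proof. by move=> i1 i2; exact: (integrableD _ i1 i2). Qed.

Lemma jintZ s t f c : jint_able s t f ->
  jint s t (fun x => c * f x) = c * jint s t f.
Proof. by move=> i; rewrite /jint RintegralZl. Qed.

Lemma jint_ableZ s t f c : jint_able s t f -> jint_able s t (fun x => c * f x).
Proof. by move=> i; exact: (integrableZl _ c i). Qed.

Lemma jint_able_abs s t f : jint_able s t f -> jint_able s t (fun x => `|f x|).
Proof. by move=> i; exact: (integrable_abse i). Qed.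

Lemma jint_abs_le s t f g : jint_able s t f -> jint_able s t g ->
  (forall x, s <= x -> x <= t -> `|f x| <= g x) -> `|jint s t f| <= jint s t g.
Proof.
move=> i1 i2 fg; apply: le_trans (le_normr_Rintegral _ i1) _ => //.
apply: le_Rintegral => //; first exact: jint_able_abs.
by move=> x; rewrite /= in_itv/= => /andP[/ltW h1 h2]; exact: fg.
Qed.

Lemma jint_ableM a b f g : a <= b -> econt `[a, b] f -> jint_able a b g ->
  jint_able a b (fun x => f x * g x).
Proof.
move=> ab /econtP cf ig.
have [c1 _ H1] := EVT_max ab cf; have [c2 _ H2] := EVT_min ab cf.
have sub : `]a, b]%classic `<=` (`[a, b]%classic : set R).
  by apply: subset_itv; rewrite bnd_simp.
have mf : measurable_fun `]a, b] f.
  apply: measurable_funS sub _ => //.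
  exact: measurable_realfun.subspace_continuous_measurable_fun.
have bf : [bounded f x | x in `]a, b]%classic].
  exists (`|f c1| + `|f c2|); split; first by rewrite num_real.
  move=> M /ltW hM x /sub xab; apply: le_trans hM.
  have := H1 x xab; have := H2 x xab; have := ler_norm (f c1).
  have := ler_norm (- f c2); rewrite normrN ler_norml => h1 h2 h3 h4.
  by have := normr_ge0 (f c1); have := normr_ge0 (f c2); move=> h5 h6; apply/andP; split; lra.
exact: (@integrableMr _ (measurableTypeR R) R (@lebesgue_measure R) `]a, b]%classic _ f (EFin \o g) mf bf ig).
Qed.

End Jint.

(* [d phi = al dt + be dW] at [t], relative to [A]. *)
Definition wdiff {R : realType} (A : set R) (W phi : R -> R) (t al be : R) :=
  forall e : R, 0 < e -> exists2 d : R, 0 < d & forall s, A s -> `|s - t| < d ->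
    `|phi s - phi t - al * (s - t) - be * (W s - W t)| <=
    e * (`|s - t| + `|W s - W t|).

(** With [w] the density of W, the expansion [wdiff] integrates to $\phi(b)-\phi(a)=\int(al+be\,w)$,
    and the pointwise lower bound holds wherever [w] is the derivative of W. It turns a differential
    inequality into a bound by the energy. *)
Lemma ac_ge {R : realType} (a b C : R) (W phi al be k : R -> R) :
  a <= b -> 0 <= C -> abs_continuous a b W ->
  econt `[a, b] al -> econt `[a, b] be ->
  (forall t, a <= t -> t <= b -> wdiff `[a, b] W phi t (al t) (be t)) ->
  (forall t, a < t -> t < b -> derivable W t 1 ->
    - (C * (derive1 W t - k t) ^+ 2) <= al t + be t * derive1 W t) ->
  ((phi a - phi b)%:E <= C%:E *
    \int[@lebesgue_measure R]_(t in `]a, b[) ((derive1 W t - k t) ^+ 2)%:E)%E.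
Proof.
move=> ab C0 AC ac bc dphi lb.
have [w [iw wE wae]] := ac_density a b W ab AC.
have iw' s t : jint_able s t w by exact: integrableS iw.
pose h x := al x + be x * w x.
have ih : jint_able a b h.
  apply: jint_ableD; last exact: jint_ableM.
  have := jint_ableM a b al (fun=> 1) ab ac (jint_able_cst a b 1).
  by congr (is_true (_.-integrable _ _)); apply/funext => x /=; rewrite mulr1.
(* Its integral dominates $|s'-s|+|W_{s'}-W_s|$, the error scale of [wdiff]. *)
pose g x := 1 + `|w x|.
have ig s t : jint_able s t g.
  by apply: jint_ableD; [exact: jint_able_cst|exact: jint_able_abs].
have gE s t : s <= t -> jint s t g = (t - s) + jint s t (fun x => `|w x|).
  move=> st; rewrite jintD ?jint_cst ?mul1r//; first exact: jint_able_cst.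
  exact: jint_able_abs.
have Wle s t : a <= s -> s <= t -> t <= b -> `|W t - W s| <= jint s t (fun x => `|w x|).
  move=> h1 h2 h3; rewrite wE// -/(jint _ _ _); apply: jint_abs_le => //.
  exact: jint_able_abs.
(* One end must be [t], the point of expansion; the two cases feed the two clauses of the real
   induction. *)
have local t e : a <= t -> t <= b -> 0 < e -> exists2 d, 0 < d &
    forall s s', a <= s -> s <= s' -> s' <= b -> (s = t \/ s' = t) -> s' - s < d ->
    `|phi s' - phi s - jint s s' h| <= e * jint s s' g.
  move=> at_ tb e0; have e2 : 0 < e / 2 by rewrite divr_gt0.
  have tI : (`[a, b]%classic : set R) t by rewrite /= in_itv/= at_.
  have [d1 d10 H1] := ac t tI _ e2; have [d2 d20 H2] := bc t tI _ e2.
  have [d3 d30 H3] := dphi t at_ tb _ e2.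
  exists (Num.min d1 (Num.min d2 d3)); first by rewrite !lt_min d10 d20.
  move=> s s' as_ ss sb st; rewrite !lt_min => /and3P[l1 l2 l3].
  have near_t x : s <= x -> x <= s' -> `|x - t| <= s' - s.
    by move=> sx xs; rewrite ler_norml; case: st => <-; apply/andP; split; lra.
  have E1 : `|phi s' - phi s - al t * (s' - s) - be t * (W s' - W s)| <=
      e / 2 * jint s s' g.
    apply: (@le_trans _ _ (e / 2 * (`|s' - s| + `|W s' - W s|))).
      case: st => st.
        rewrite -st; rewrite -st in H3; apply: H3; first by rewrite /= in_itv/=; lra.
        by rewrite ger0_norm; lra.
      have := H3 s; rewrite -st /= in_itv/= as_ (le_trans ss sb) => /(_ isT).
      rewrite (distrC s) ger0_norm ?subr_ge0// (distrC (W s)) => /(_ l3).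
      by apply: le_trans; rewrite -normrN le_eqVlt; apply/predU1P; left; congr (`|_|); ring.
    by rewrite ler_pM2l// gE// ger0_norm ?subr_ge0// lerD2l Wle.
  have E2 : `|jint s s' h - (al t * (s' - s) + be t * (W s' - W s))| <=
      e / 2 * jint s s' g.
    have ih' : jint_able s s' h by exact: jint_ableS ih.
    have iq : jint_able s s' (fun x => (- al t) + (- be t) * w x).
      by apply: jint_ableD; [exact: jint_able_cst|exact: jint_ableZ].
    have -> : jint s s' h - (al t * (s' - s) + be t * (W s' - W s)) =
        jint s s' (fun x => h x + ((- al t) + (- be t) * w x)).
      rewrite (jintD _ _ h)// (jintD _ _ (fun=> - al t)) ?jint_cst ?jintZ// ?wE//.
      - by rewrite -/(jint s s' w); ring.
      - exact: jint_able_cst.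
      - exact: jint_ableZ.
    rewrite -jintZ//; apply: jint_abs_le; [exact: jint_ableD|exact: jint_ableZ|].
    move=> x sx xs; have xI : (`[a, b]%classic : set R) x by rewrite /= in_itv/=; lra.
    have := near_t x sx xs => xt.
    have := H1 x xI (le_lt_trans xt l1); have := H2 x xI (le_lt_trans xt l2).
    move=> q2 q1; rewrite /h /g.
    have -> : al x + be x * w x + (- al t + - be t * w x) =
      (al x - al t) + (be x - be t) * w x by ring.
    rewrite (le_trans (ler_normD _ _))// normrM mulrDr mulr1.
    by apply: lerD; [exact: ltW|apply: ler_wpM2r => //; exact: ltW].
  have := ler_normD (phi s' - phi s - al t * (s' - s) - be t * (W s' - W s))
    (- (jint s s' h - (al t * (s' - s) + be t * (W s' - W s)))).
  rewrite normrN => E3.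
  rewrite (_ : _ - jint s s' h = phi s' - phi s - al t * (s' - s) - be t * (W s' - W s)
    - (jint s s' h - (al t * (s' - s) + be t * (W s' - W s)))); last by ring.
  by apply: le_trans E3 _; lra.
have main e : 0 < e -> forall x, a <= x -> x <= b ->
    `|phi x - phi a - jint a x h| <= e * jint a x g.
  move=> e0.
  have join u v : a <= u -> u <= v -> v <= b ->
      `|phi u - phi a - jint a u h| <= e * jint a u g ->
      `|phi v - phi u - jint u v h| <= e * jint u v g ->
      `|phi v - phi a - jint a v h| <= e * jint a v g.
    move=> au uv vb p1 p2; rewrite (jint_cat a u v h)//; last exact: jint_ableS ih.
    rewrite (jint_cat a u v g)//.
    have := ler_normD (phi u - phi a - jint a u h) (phi v - phi u - jint u v h).
    have <- : phi v - phi a - (jint a u h + jint u v h) =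
      phi u - phi a - jint a u h + (phi v - phi u - jint u v h) by ring.
    by lra.
  apply: real_induction.
  - by rewrite !jintxx !subrr normr0 mulr0.
  - move=> x ax xb Hx; have [d d0 Hd] := local x e ax (ltW xb) e0.
    exists d => // y xy yd yb; apply: (join x y) => //; first exact: ltW.
      exact: Hx.
    by apply: Hd => //; [exact: ltW|left|lra].
  - move=> x ax xb Hx; have [d d0 Hd] := local x e (ltW ax) xb e0.
    have [y [ay yx dy]] : exists y, [/\ a <= y, y < x & x - y < d].
      exists (Num.max a (x - d / 2)); rewrite le_max lexx gt_max ax/=.
      split=> //; first by lra.
      have : x - d / 2 <= Num.max a (x - d / 2) by rewrite le_max lexx orbT.
      by lra.
    apply: (join y x) => //; [exact: ltW|exact: Hx|].
    by apply: Hd => //; [exact: ltW|right].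
have phiE : phi b - phi a = jint a b h.
  apply/eqP; rewrite -subr_eq0 -normr_le0.
  apply: (ler_small _ _ (jint a b g)) => d d0 _; rewrite add0r.
  exact: main.
(* Off the null set [N] the density is the derivative, and deleting [N] does not change the integral
   of the integrable function [- h]. *)
have [N [mN N0 HN]] := wae.
pose D := (`]a, b[%classic `\` N : set R).
have mD : measurable (D : set (measurableTypeR R)) by apply: measurableD.
pose nh x := - h x.
have inh : jint_able a b nh.
  have := jint_ableZ a b h (-1) ih; congr (is_true (_.-integrable _ _)).
  by apply/funext => x; rewrite /= mulN1r.
have iio : (@lebesgue_measure R).-integrable `]a, b[ (EFin \o nh).
  by apply: integrableS inh => //; apply: subset_itv; rewrite bnd_simp.
have -> : (phi a - phi b)%:E = (\int[@lebesgue_measure R]_(x in D) (- h x)%:E)%E.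
  have -> : phi a - phi b = jint a b nh.
    have -> : phi a - phi b = -1 * jint a b h by rewrite -phiE; ring.
    by rewrite -jintZ//; congr jint; apply/funext => x; rewrite mulN1r.
  rewrite /jint /Rintegral fineK; last by exact: integrable_fin_num inh.
  rewrite -integral_itv_bndo_bndc; last exact: measurable_int iio.
  exact: negligible_integral.
apply: le_trans (ge0_integral_scale _ _ _ _ C0 _) => [|x _]; last exact: sqr_ge0.
apply: le_trans (integral_le_funepos _ _ _) _.
apply: ge0_integral_mono => [x _|x _|x [+ _]//|x [xab Nx]]; first exact: funepos_ge0.
  by rewrite lee_fin mulr_ge0// sqr_ge0.
have [dW WE] : derivable W x 1 /\ derive1 W x = w x.
  apply: contrapT => H; apply: Nx; apply: HN => /= H'; apply: H; apply: H'.
  by move: xab; rewrite /= in_itv.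
move: xab; rewrite /= in_itv/= => /andP[ax xb].
rewrite funeposE ge_max !lee_fin mulr_ge0 ?sqr_ge0// andbT.
by have := lb x ax xb dW; rewrite WE /h; lra.
Qed.

(** * Calculus of differentials in time and driving function *)

Section EcontAlgebra.
Context {R : realType} {A : set R}.
Implicit Types f g : R -> R.

Lemma econtM f g : econt A f -> econt A g -> econt A (fun x => f x * g x).
Proof.
by move=> /econtP cf /econtP cg; apply/econtP => x; apply: continuousM;
  [exact: cf|exact: cg].
Qed.

Lemma econtD f g : econt A f -> econt A g -> econt A (fun x => f x + g x).
Proof.
by move=> /econtP cf /econtP cg; apply/econtP => x; apply: continuousD;
  [exact: cf|exact: cg].
Qed.

Lemma econtN f : econt A f -> econt A (fun x => - f x).
Proof. by move=> /econtP cf; apply/econtP => x; apply: continuousN; exact: cf. Qed.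

Lemma econt_comp f g : econt A f -> (forall x, A x -> {for f x, continuous g}) ->
  econt A (fun x => g (f x)).
Proof.
move=> cf cg x Ax e e0; have /cvgrPdist_lt/(_ e e0) := cg x Ax.
move=> /nbhs_ballP[d /= d0 H]; have [d' d'0 H'] := cf x Ax d d0.
exists d' => // y Ay yx; rewrite distrC; apply: H.
by rewrite /ball/= distrC; exact: H'.
Qed.

Lemma econtV f : econt A f -> (forall x, A x -> f x != 0) ->
  econt A (fun x => (f x)^-1).
Proof. by move=> cf f0; apply: econt_comp cf _ => x Ax; apply: inv_continuous; exact: f0. Qed.

End EcontAlgebra.

Section Wdiff.
Context {R : realType} {A : set R} {W : R -> R} {t : R}.
Hypothesis Wc : forall e : R, 0 < e -> exists2 d : R, 0 < d &
  forall s, A s -> `|s - t| < d -> `|W s - W t| < e.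
Implicit Types (phi psi : R -> R) (al be : R).

Let rate (s : R) : R := `|s - t| + `|W s - W t|.

Let rate_ge0 s : 0 <= rate s. Proof. by rewrite addr_ge0. Qed.

Let rate_small (e : R) : 0 < e -> exists2 d : R, 0 < d &
  forall s, A s -> `|s - t| < d -> rate s < e.
Proof.
move=> e0; have e2 : 0 < e / 2 by rewrite divr_gt0.
have [d d0 H] := Wc _ e2; exists (Num.min d (e / 2)); first by rewrite lt_min d0.
by move=> s As; rewrite lt_min => /andP[/(H s As) h1 h2]; rewrite /rate; lra.
Qed.

Lemma eq_wdiff phi al be al' be' : al = al' -> be = be' ->
  wdiff A W phi t al be -> wdiff A W phi t al' be'.
Proof. by move=> -> ->. Qed.

Let wdiff_lip phi al be : wdiff A W phi t al be -> exists K d : R,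
  [/\ 0 < K, 0 < d & forall s, A s -> `|s - t| < d ->
    `|phi s - phi t| <= K * rate s].
Proof.
move=> H; have [d d0 Hd] := H 1 ltr01.
exists (1 + `|al| + `|be|), d; split => //.
move=> s As st; have := Hd s As st; rewrite -/(rate s) mul1r => h.
have := ler_normD (phi s - phi t - al * (s - t) - be * (W s - W t))
  (al * (s - t) + be * (W s - W t)).
have -> : phi s - phi t - al * (s - t) - be * (W s - W t) +
  (al * (s - t) + be * (W s - W t)) = phi s - phi t by ring.
have := ler_normD (al * (s - t)) (be * (W s - W t)).
have a1 : `|al * (s - t)| <= `|al| * rate s by rewrite normrM ler_wpM2l// lerDl.
have a2 : `|be * (W s - W t)| <= `|be| * rate s by rewrite normrM ler_wpM2l// lerDr.
lra.
Qed.

Lemma wdiff_cont phi al be : wdiff A W phi t al be ->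
  forall e : R, 0 < e -> exists2 d : R, 0 < d &
  forall s, A s -> `|s - t| < d -> `|phi s - phi t| < e.
Proof.
move=> /wdiff_lip[K [d1 [K0 d10 H1]]] e e0.
have eK : 0 < e / K by rewrite divr_gt0.
have [d2 d20 H2] := rate_small _ eK.
exists (Num.min d1 d2); first by rewrite lt_min d10.
move=> s As; rewrite lt_min => /andP[/(H1 s As) h1 /(H2 s As) h2].
by apply: le_lt_trans h1 _; rewrite mulrC -ltr_pdivlMr.
Qed.

Lemma wdiff_cst c : wdiff A W (fun=> c) t 0 0.
Proof.
move=> e e0; exists 1 => // s _ _; rewrite !mul0r subrr !subr0 normr0.
by apply: mulr_ge0; [exact: ltW|exact: rate_ge0].
Qed.

Lemma wdiffD phi psi al be al' be' :
  wdiff A W phi t al be -> wdiff A W psi t al' be' ->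
  wdiff A W (fun s => phi s + psi s) t (al + al') (be + be').
Proof.
move=> H1 H2 e e0; have e2 : 0 < e / 2 by rewrite divr_gt0.
have [d1 d10 h1] := H1 _ e2; have [d2 d20 h2] := H2 _ e2.
exists (Num.min d1 d2); first by rewrite lt_min d10.
move=> s As; rewrite lt_min => /andP[/(h1 s As) {}h1 /(h2 s As) {}h2].
rewrite -/(rate s) in h1 h2 *.
have := ler_normD (phi s - phi t - al * (s - t) - be * (W s - W t))
  (psi s - psi t - al' * (s - t) - be' * (W s - W t)).
have <- : phi s + psi s - (phi t + psi t) - (al + al') * (s - t) -
   (be + be') * (W s - W t) = (phi s - phi t - al * (s - t) - be * (W s - W t)) +
  (psi s - psi t - al' * (s - t) - be' * (W s - W t)) by ring.
lra.
Qed.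

Lemma wdiffM phi psi al be al' be' :
  wdiff A W phi t al be -> wdiff A W psi t al' be' ->
  wdiff A W (fun s => phi s * psi s) t
    (al * psi t + phi t * al') (be * psi t + phi t * be').
Proof.
move=> H1 H2 e e0.
have [K1 [d1 [K10 d10 h1]]] := wdiff_lip _ _ _ H1.
have [K2 [d2 [K20 d20 h2]]] := wdiff_lip _ _ _ H2.
have [k [k0 kphi kpsi kK]] : exists k, [/\ 0 < k, `|phi t| * k <= e / 3,
    `|psi t| * k <= e / 3 & K1 * K2 * k <= e / 3].
  have p1 : 0 <= `|phi t| by []. have p2 : 0 <= `|psi t| by [].
  have p3 : 0 < K1 * K2 by rewrite mulr_gt0.
  have [S [S0 S1 S2 S3]] : exists S, [/\ 0 < S, `|phi t| <= S, `|psi t| <= S & K1 * K2 <= S].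
    by exists (`|phi t| + `|psi t| + K1 * K2); split; lra.
  have q0 : 0 < e / (3 * S) by rewrite divr_gt0// mulr_gt0.
  have E : S * (e / (3 * S)) = e / 3 by field; rewrite gt_eqF.
  by exists (e / (3 * S)); split => //; rewrite -E ler_pM2r.
have [d3 d30 h3] := H1 _ k0; have [d4 d40 h4] := H2 _ k0.
have [d5 d50 h5] := rate_small _ k0.
exists (Num.min d1 (Num.min d2 (Num.min d3 (Num.min d4 d5)))).
  by rewrite !lt_min d10 d20 d30 d40.
move=> s As; rewrite !lt_min => /and5P[l1 l2 l3 l4 l5].
have {}h1 := h1 s As l1; have {}h2 := h2 s As l2; have {}h3 := h3 s As l3.
have {}h4 := h4 s As l4; have {}h5 := h5 s As l5.
rewrite -/(rate s) in h1 h2 h3 h4 *; move: h3 h4.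
set u := (phi s - phi t - _ - _); set v := (psi s - psi t - _ - _) => h3 h4.
have -> : phi s * psi s - phi t * psi t - (al * psi t + phi t * al') * (s - t) -
   (be * psi t + phi t * be') * (W s - W t) =
   u * psi t + phi t * v + (phi s - phi t) * (psi s - psi t) by rewrite /u /v; ring.
have b1 : `|u * psi t| <= e / 3 * rate s.
  rewrite normrM mulrC; apply: le_trans (ler_wpM2l _ h3) _ => //.
  by rewrite mulrA ler_wpM2r.
have b2 : `|phi t * v| <= e / 3 * rate s.
  rewrite normrM; apply: le_trans (ler_wpM2l _ h4) _ => //.
  by rewrite mulrA ler_wpM2r.
have b3 : `|(phi s - phi t) * (psi s - psi t)| <= e / 3 * rate s.
  rewrite normrM; apply: (@le_trans _ _ ((K1 * rate s) * (K2 * rate s))).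
    exact: ler_pM.
  have -> : K1 * rate s * (K2 * rate s) = K1 * K2 * rate s * rate s by ring.
  rewrite ler_wpM2r//; apply: le_trans kK; rewrite ler_wpM2l ?ltW//.
  by rewrite mulr_gt0.
have := ler_normD (u * psi t + phi t * v) ((phi s - phi t) * (psi s - psi t)).
have := ler_normD (u * psi t) (phi t * v).
lra.
Qed.

Lemma wdiffZ c phi al be : wdiff A W phi t al be ->
  wdiff A W (fun s => c * phi s) t (c * al) (c * be).
Proof.
move=> H; have := wdiffM _ _ _ _ _ _ (wdiff_cst c) H.
by rewrite !mul0r !add0r.
Qed.

Lemma wdiffN phi al be : wdiff A W phi t al be ->
  wdiff A W (fun s => - phi s) t (- al) (- be).
Proof.
move=> /(wdiffZ (-1)); rewrite !mulN1r; congr (wdiff _ _ _ _ _ _).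
by apply/funext => s; rewrite mulN1r.
Qed.

Lemma wdiffB phi psi al be al' be' :
  wdiff A W phi t al be -> wdiff A W psi t al' be' ->
  wdiff A W (fun s => phi s - psi s) t (al - al') (be - be').
Proof. by move=> H1 /wdiffN; exact: wdiffD. Qed.

Lemma wdiff_comp F D phi al be :
  (forall e : R, 0 < e -> exists2 r : R, 0 < r & forall h, `|h| < r ->
    `|F (phi t + h) - F (phi t) - D * h| <= e * `|h|) ->
  wdiff A W phi t al be ->
  wdiff A W (fun s => F (phi s)) t (D * al) (D * be).
Proof.
move=> HF H e e0; have [K [d1 [K0 d10 h1]]] := wdiff_lip _ _ _ H.
have e2 : 0 < e / (2 * K) by rewrite divr_gt0// mulr_gt0.
have D0 : 0 < `|D| + 1 by have := normr_ge0 D; lra.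
have e3 : 0 < e / (2 * (`|D| + 1)) by rewrite divr_gt0// mulr_gt0.
have [r r0 hr] := HF _ e2; have [d2 d20 h2] := H _ e3.
have rK : 0 < r / K by rewrite divr_gt0.
have [d3 d30 h3] := rate_small _ rK.
exists (Num.min d1 (Num.min d2 d3)); first by rewrite !lt_min d10 d20.
move=> s As; rewrite !lt_min => /and3P[l1 l2 l3].
have {}h1 := h1 s As l1; have {}h2 := h2 s As l2; have {}h3 := h3 s As l3.
rewrite -/(rate s) in h2 *.
have hs : `|phi s - phi t| < r.
  apply: le_lt_trans h1 _; rewrite mulrC -ltr_pdivlMr//.
have := hr _ hs; rewrite (addrC (phi t)) subrK => h4.
set u := (phi s - phi t - _ - _) in h2.
have := ler_normD (F (phi s) - F (phi t) - D * (phi s - phi t)) (D * u).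
have -> : F (phi s) - F (phi t) - D * (phi s - phi t) + D * u =
  F (phi s) - F (phi t) - D * al * (s - t) - D * be * (W s - W t) by rewrite /u; ring.
have b1 : `|D * u| <= e / 2 * rate s.
  rewrite normrM; apply: (@le_trans _ _ ((`|D| + 1) * (e / (2 * (`|D| + 1)) * rate s))).
    by apply: ler_pM => //; lra.
  by rewrite le_eqVlt; apply/predU1P; left; field; rewrite gt_eqF.
have b2 : e / (2 * K) * `|phi s - phi t| <= e / 2 * rate s.
  apply: (@le_trans _ _ (e / (2 * K) * (K * rate s))); first by rewrite ler_pM2l.
  by rewrite le_eqVlt; apply/predU1P; left; field; rewrite gt_eqF.
lra.
Qed.

Lemma wdiff_comp_derive F D phi al be : is_derive (phi t) 1 F D ->
  wdiff A W phi t al be -> wdiff A W (fun s => F (phi s)) t (D * al) (D * be).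
Proof. by move=> dF; apply: wdiff_comp; exact: is_derive_eps. Qed.

Lemma wdiffV phi al be : phi t != 0 -> wdiff A W phi t al be ->
  wdiff A W (fun s => (phi s)^-1) t (- al / phi t ^+ 2) (- be / phi t ^+ 2).
Proof.
move=> p0 H; have dV : is_derive (phi t) 1 (fun x : R => x^-1) (- (phi t) ^- 2).
  have := @is_deriveV R id (phi t) 1 1 p0 (is_derive_id _ _).
  by rewrite /GRing.scale /= mulr1.
by have := wdiff_comp_derive _ _ _ _ _ dV H; apply: eq_wdiff; rewrite mulNr mulrC mulNr.
Qed.

End Wdiff.

(** The argument of P + iq, with values between 0 and $\pi$, when q > 0. *)
Definition angle {R : realType} (P q : R) : R := pi / 2 - atan (P / q).

Lemma wdiff_angle {R : realType} (A : set R) (W P q : R -> R) (t aP bP aq bq : R) :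
  (forall e : R, 0 < e -> exists2 d : R, 0 < d &
    forall s, A s -> `|s - t| < d -> `|W s - W t| < e) ->
  0 < q t -> wdiff A W P t aP bP -> wdiff A W q t aq bq ->
  wdiff A W (fun s => angle (P s) (q s)) t
    ((P t * aq - aP * q t) / (P t ^+ 2 + q t ^+ 2))
    ((P t * bq - bP * q t) / (P t ^+ 2 + q t ^+ 2)).
Proof.
move=> Wc q0 dP dq.
have qn0 : q t != 0 by rewrite gt_eqF.
have := wdiffM Wc _ _ _ _ _ _ dP (wdiffV Wc _ _ _ qn0 dq).
move=> /(wdiff_comp_derive Wc _ _ _ _ _ (is_derive1_atan _)).
move=> /(wdiffB Wc _ _ _ _ _ _ (wdiff_cst (pi / 2))).
have s0 : 0 < P t ^+ 2 + q t ^+ 2.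
  by rewrite ltr_wpDl ?sqr_ge0// exprn_gt0.
have s1 : 1 + (P t / q t) ^+ 2 = (P t ^+ 2 + q t ^+ 2) / q t ^+ 2 by field.
rewrite s1; apply: eq_wdiff; field; rewrite qn0 ?gt_eqF//=;
  by rewrite mulr1 gt_eqF// mulr_gt0// exprn_gt0.
Qed.

(** The square makes the truncation continuously differentiable, so that the chain rule [wdiff_comp]
    applies at r = c as well. *)
Definition relu2 {R : realType} (c r : R) : R := Num.max 0 (c - r) ^+ 2.

Lemma relu2_deriv {R : realType} (c r : R) (e : R) : 0 < e ->
  exists2 d : R, 0 < d & forall h, `|h| < d ->
    `|relu2 c (r + h) - relu2 c r - (- (2 * Num.max 0 (c - r))) * h| <= e * `|h|.
Proof.
move=> e0; exists e => // h he.
apply: (@le_trans _ _ (`|h| * `|h|)); last by rewrite ler_wpM2r// ltW.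
have -> : `|h| * `|h| = h ^+ 2 by rewrite -normrM -expr2 ger0_norm ?sqr_ge0.
rewrite /relu2 ler_norml.
by case: (leP 0 (c - r)) => h1; case: (leP 0 (c - (r + h))) => h2;
  apply/andP; split; nra.
Qed.

(* AM-GM *)
Lemma quad_ge {R : realType} (k m f Q : R) : 0 < k ->
  - (m ^+ 2 / (4 * k) * f ^+ 2) <= m * f * Q + k * Q ^+ 2.
Proof.
move=> k0; rewrite -subr_ge0.
have -> : m * f * Q + k * Q ^+ 2 - - (m ^+ 2 / (4 * k) * f ^+ 2) =
  k * (Q + m * f / (2 * k)) ^+ 2 by field; rewrite gt_eqF.
by rewrite mulr_ge0 ?sqr_ge0// ltW.
Qed.

(** * Three functions controlled by the energy *)

Section Lyapunov.
Context {R : realType} {a s b : R} {W y p q k : R -> R}.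
Let rho := 2 / a - 2.
Let I : set R := `[s, b]%classic.
Hypothesis a0 : 0 < a.
Hypothesis sb : s <= b.
Hypothesis AC : abs_continuous s b W.
Hypothesis Wc : econt I W.
Hypothesis yc : econt I y.
Hypothesis y0 : forall t, I t -> 0 < y t.
Hypothesis dy : forall t, I t -> wdiff I W y t (2 / y t) (-1).
Hypothesis kE : forall t, I t -> k t = - (rho / y t).

Let IE t : s <= t -> t <= b -> I t.
Proof. by move=> h1 h2; rewrite /I /= in_itv/= h1. Qed.

Definition energy : \bar R :=
  (\int[@lebesgue_measure R]_(t in `]s, b[) ((derive1 W t - k t) ^+ 2)%:E)%E.

Ltac econt_tac := repeat first
  [exact: Wc | exact: yc | assumption | exact: econt_cst | apply: econtB | apply: econtD
  | apply: econtM | apply: econtN | (apply: econtV; [|move=> t It])].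

(** With f = W' - k the derivative of ln y is $(2/a)/y^2-f/y$, at least $-(a/8)f^2$ by AM-GM. *)
Lemma ln_gap : ((ln (y s) - ln (y b))%:E <= (a / 8)%:E * energy)%E.
Proof.
apply: (ac_ge s b (a / 8) W (fun t => ln (y t)) (fun t => (y t)^-1 * (2 * (y t)^-1))
  (fun t => (y t)^-1 * -1) k sb) => //; first by rewrite divr_ge0// ltW.
- by econt_tac; rewrite gt_eqF// y0.
- by econt_tac; rewrite gt_eqF// y0.
- move=> t h1 h2; have It := IE t h1 h2; apply: (wdiff_comp_derive (Wc t It)).
    exact/is_derive1_ln/y0.
  exact: dy.
move=> t h1 h2 _; have It := IE t (ltW h1) (ltW h2).
have yt := y0 t It; rewrite kE// /rho; set w := derive1 W t.
have k0 : 0 < 2 / a by rewrite divr_gt0.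
have := quad_ge (2 / a) (- 1) (w - - ((2 / a - 2) / y t)) (y t)^-1 k0.
have -> : (-1) ^+ 2 / (4 * (2 / a)) = a / 8 by field; rewrite gt_eqF.
move=> /le_trans; apply; rewrite le_eqVlt; apply/predU1P; left.
by field; rewrite !gt_eqF.
Qed.

Hypothesis pc : econt I p.
Hypothesis qc : econt I q.
Hypothesis q0 : forall t, I t -> 0 < q t.
Hypothesis dp : forall t, I t ->
  wdiff I W p t (2 * p t / (p t ^+ 2 + q t ^+ 2)) (-1).
Hypothesis dq : forall t, I t ->
  wdiff I W q t (- (2 * q t / (p t ^+ 2 + q t ^+ 2))) 0.

(** With p + iq standing for $g_t(z)-W_t$, P + iq is $g_t(z)-v_t$ for $v=W-ay$, a point that follows
    the Loewner flow at zero energy. *)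
Let P t := p t + a * y t.

Let X0 t : I t -> 0 < p t ^+ 2 + q t ^+ 2.
Proof. by move=> It; rewrite ltr_wpDl ?sqr_ge0// exprn_gt0// q0. Qed.

Let D0 t : I t -> 0 < (p t + a * y t) ^+ 2 + q t ^+ 2.
Proof. by move=> It; rewrite ltr_wpDl ?sqr_ge0// exprn_gt0// q0. Qed.

Let dP t : I t -> wdiff I W P t
  (2 * p t / (p t ^+ 2 + q t ^+ 2) + a * (2 / y t)) (-1 + a * -1).
Proof.
by move=> It; apply: wdiffD; [exact: dp|apply: (wdiffZ (Wc t It)); exact: dy].
Qed.

(** While $r=(P^2+q^2)/y^2$ is below $(a/2)^2$, its zero-energy drift is negative and of order
    $r/y^2$. The factor [V] of the term linear in [f] satisfies $V^2=O(r)$, so the drift absorbs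
    that term. Hence [r] can climb back to the threshold only by spending energy. *)
Lemma relu2_gap : ((relu2 ((a / 2) ^+ 2) ((P s / y s) ^+ 2 + (q s / y s) ^+ 2) -
    relu2 ((a / 2) ^+ 2) ((P b / y b) ^+ 2 + (q b / y b) ^+ 2))%:E <=
  (a * (a / 2) ^+ 2 * ((a / 2) ^+ 2 + (1 + a) ^+ 2))%:E * energy)%E.
Proof.
set c := (a / 2) ^+ 2; have c0 : 0 < c by rewrite exprn_gt0// divr_gt0.
pose r t := (P t / y t) ^+ 2 + (q t / y t) ^+ 2.
pose aP t := 2 * p t / (p t ^+ 2 + q t ^+ 2) + a * (2 / y t).
pose aq t := - (2 * q t / (p t ^+ 2 + q t ^+ 2)).
pose aV t := - (2 / y t) / y t ^+ 2.
pose bV t := - (-1) / y t ^+ 2.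
pose aU t := aP t / y t + P t * aV t.
pose bU t := (-1 + a * -1) / y t + P t * bV t.
pose aT t := aq t / y t + q t * aV t.
pose bT t := 0 / y t + q t * bV t.
have Pc : econt I P by rewrite /P; econt_tac.
have yn0 t : I t -> y t != 0 by move=> It; rewrite gt_eqF ?y0.
have dV t : I t -> wdiff I W (fun t => (y t)^-1) t (aV t) (bV t).
  by move=> It; exact: (wdiffV (Wc t It) _ _ _ (yn0 t It) (dy t It)).
have dU t : I t -> wdiff I W (fun t => P t / y t) t (aU t) (bU t).
  by move=> It; exact: (wdiffM (Wc t It) _ _ _ _ _ _ (dP t It) (dV t It)).
have dT t : I t -> wdiff I W (fun t => q t / y t) t (aT t) (bT t).
  by move=> It; exact: (wdiffM (Wc t It) _ _ _ _ _ _ (dq t It) (dV t It)).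
pose ar t := 2 * (P t / y t * aU t + q t / y t * aT t).
pose br t := 2 * (P t / y t * bU t + q t / y t * bT t).
have dr t : I t -> wdiff I W r t (ar t) (br t).
  move=> It; have := wdiffD _ _ _ _ _ _ (wdiffM (Wc t It) _ _ _ _ _ _ (dU t It) (dU t It))
    (wdiffM (Wc t It) _ _ _ _ _ _ (dT t It) (dT t It)).
  by apply: eq_wdiff; rewrite /ar /br; ring.
pose m t := Num.max 0 (c - r t).
have mc : econt I m.
  apply: (econt_comp r (fun z => Num.max 0 (c - z))) => [|t It].
    by rewrite /r; econt_tac; exact: yn0.
  by apply: continuous_max; [exact: cst_continuous|apply: continuousB;
    [exact: cst_continuous|exact: id]].
apply: (ac_ge s b _ W (fun t => relu2 c (r t)) (fun t => - (2 * m t) * ar t)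
  (fun t => - (2 * m t) * br t) k sb) => //.
- by apply: mulr_ge0; [rewrite mulr_ge0// ltW|rewrite addr_ge0 ?sqr_ge0// ?ltW].
- rewrite /ar /aU /aT /aP /aV /aq; econt_tac; rewrite ?gt_eqF ?X0 ?y0 ?exprn_gt0 ?y0//.
- rewrite /br /bU /bT /bV; econt_tac; rewrite ?gt_eqF ?X0 ?y0 ?exprn_gt0 ?y0//.
- move=> t h1 h2; have It := IE t h1 h2.
  exact: (wdiff_comp (Wc t It) _ _ _ _ _ (relu2_deriv c (r t)) (dr t It)).
move=> t h1 h2 _; have It := IE t (ltW h1) (ltW h2).
set w := derive1 W t; pose f := w - k t; rewrite -/f.
have [yt qt Xt] := And3 (y0 t It) (q0 t It) (X0 t It).
pose V := r t - (1 + a) * (P t / y t).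
have rE : ar t + br t * w = 2 * (f / y t * V) +
    2 * (r t * (2 / a / y t ^+ 2 * (y t * p t / (p t ^+ 2 + q t ^+ 2) - 1))).
  rewrite /V /f /ar /br /aU /bU /aT /bT /aP /aq /aV /bV /r /P kE// /rho.
  by field; rewrite !gt_eqF.
have [m0|m0] := leP (c - r t) 0.
  have -> : m t = 0 by rewrite /m max_l.
  rewrite !(mulr0, oppr0, mul0r) addr0 oppr_le0.
  apply: mulr_ge0; last exact: sqr_ge0.
  by apply: mulr_ge0; [rewrite mulr_ge0// ltW|rewrite addr_ge0 ?sqr_ge0// ?ltW].
have mE : m t = c - r t by rewrite /m max_r// ltW.
have U2 : (P t / y t) ^+ 2 <= r t by rewrite lerDl sqr_ge0.
have r0 : 0 <= r t by rewrite addr_ge0 ?sqr_ge0.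
(* A positive [p] would give P > a y, above the threshold. With p at most 0 the drift of [r] is at
   most $-(4/a)r/y^2$. *)
have pneg : p t <= 0.
  rewrite leNgt; apply/negP => p0.
  have : a <= P t / y t by rewrite ler_pdivlMr// /P lerDr ltW.
  move: U2 m0; rewrite /c; set u := P t / y t => U2 m0 au.
  have : a ^+ 2 <= u ^+ 2 by rewrite !expr2; apply: ler_pM => //; exact: ltW.
  by have : 0 < a ^+ 2 by [rewrite exprn_gt0]; lra.
have VV : V ^+ 2 <= 2 * (c + (1 + a) ^+ 2) * r t.
  rewrite /V; move: (P t / y t) (r t) (1 + a) U2 m0 r0 => u rr a1 U2 m0 r0.
  have h3 : 0 <= (rr + a1 * u) ^+ 2 by exact: sqr_ge0.
  have h4 : 0 <= a1 ^+ 2 * (rr - u ^+ 2) by rewrite mulr_ge0 ?sqr_ge0// subr_ge0.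
  have h5 : 0 <= rr * (c - rr) by rewrite mulr_ge0// ltW.
  have -> : (rr - a1 * u) ^+ 2 = 2 * rr ^+ 2 + 2 * (a1 ^+ 2 * u ^+ 2) - (rr + a1 * u) ^+ 2.
    by ring.
  by rewrite mulrBr in h4; rewrite mulrBr in h5; rewrite expr2; lra.
set K := c + (1 + a) ^+ 2; have K0 : 0 < K by rewrite /K ltr_wpDr ?sqr_ge0.
have main : ar t + br t * w <= a * K / 2 * f ^+ 2.
  rewrite rE.
  have e1 : r t * (2 / a / y t ^+ 2 * (y t * p t / (p t ^+ 2 + q t ^+ 2) - 1)) <=
      - (2 / a / y t ^+ 2 * r t).
    set l := 2 / a / y t ^+ 2.
    have l0 : 0 <= l by rewrite /l !divr_ge0 ?sqr_ge0// ltW.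
    have z0 : y t * p t / (p t ^+ 2 + q t ^+ 2) <= 0.
      by apply: mulr_le0_ge0; [rewrite pmulr_rle0|rewrite invr_ge0 ltW].
    move: z0; set z := _ / _ => z0; have : r t * l * z <= 0.
      by rewrite mulr_ge0_le0// mulr_ge0.
    lra.
  have k0 : 0 < 2 / (a * K) by rewrite divr_gt0// mulr_gt0.
  have := quad_ge (2 / (a * K)) (-2) f (V / y t) k0.
  have -> : (-2) ^+ 2 / (4 * (2 / (a * K))) = a * K / 2.
    by field; rewrite !gt_eqF.
  have : 2 / (a * K) * (V / y t) ^+ 2 <= 2 * (2 / a / y t ^+ 2 * r t).
    have -> : 2 / (a * K) * (V / y t) ^+ 2 = V ^+ 2 / K * (2 / a / y t ^+ 2).
      by field; rewrite !gt_eqF.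
    have -> : 2 * (2 / a / y t ^+ 2 * r t) = (2 * K * r t) / K * (2 / a / y t ^+ 2).
      by field; rewrite !gt_eqF.
    have l0 : 0 <= 2 / a / y t ^+ 2 by rewrite !divr_ge0 ?sqr_ge0// ltW.
    have K1 : 0 <= K^-1 by rewrite invr_ge0 ltW.
    by apply: ler_wpM2r => //; apply: ler_wpM2r => //; exact: VV.
  lra.
have B0 : 0 <= a * K / 2 * f ^+ 2 
  by apply: mulr_ge0; [apply: divr_ge0 => //; apply: mulr_ge0; exact: ltW|exact: sqr_ge0].
have -> : - (2 * m t) * ar t + - (2 * m t) * br t * w =
  - (2 * (m t * (ar t + br t * w))) by ring.
rewrite lerN2 mE.
have : (c - r t) * (ar t + br t * w) <= (c - r t) * (a * K / 2 * f ^+ 2).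
  by rewrite ler_wpM2l// ltW.
have : (c - r t) * (a * K / 2 * f ^+ 2) <= c * (a * K / 2 * f ^+ 2).
  by rewrite ler_wpM2r// lerBlDr lerDl.
lra.
Qed.

(** The bracket is conserved at zero energy, and [sg] is 1 or -1 to bound it from both sides. The
    term with [be] adds a nonnegative drift that can absorb fluctuations. *)
Let psi_ sg be t := sg * (2 / a * (angle (p t - y t) (q t) - pi) +
  2 * angle (P t) (q t)) - be * angle (P t) (q t).

(** The derivative is $m f Q+be(2/a)S$ with $Q=q/D$ and $S=q/(yX)$. AM-GM gives the claim once
    $Q^2\le C_1S$, that is $qyX\le C_1D^2$, which follows from [far]. *)
Lemma angle_gap (sg be r0 : R) : sg ^+ 2 = 1 -> 0 < be -> be <= 1 -> 0 < r0 ->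
  (forall t, I t -> (r0 * y t) ^+ 2 <= P t ^+ 2 + q t ^+ 2) ->
  ((psi_ sg be s - psi_ sg be b)%:E <=
    (9 * (1 + a) ^+ 2 * ((1 + a / r0) ^+ 2 / r0) * a / (8 * be))%:E * energy)%E.
Proof.
move=> sg1 be0 be1 r0p far; pose psi := psi_ sg be.
pose X t := p t ^+ 2 + q t ^+ 2.
pose aP t := 2 * p t / X t + a * (2 / y t).
pose aq t := - (2 * q t / X t).
pose D t := P t ^+ 2 + q t ^+ 2.
pose a1 t := 2 * q t / (y t * X t).
pose a2 t := (P t * aq t - aP t * q t) / D t.
pose b2 t := (1 + a) * q t / D t.
have dth1 t : I t -> wdiff I W (fun s => angle (p s - y s) (q s)) t (a1 t) 0.
  move=> It; have [yt qt Xt] := And3 (y0 t It) (q0 t It) (X0 t It).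
  have D1 : 0 < (p t - y t) ^+ 2 + q t ^+ 2 by rewrite ltr_wpDl ?sqr_ge0// exprn_gt0.
  have := wdiff_angle _ _ _ _ _ _ _ _ _ (Wc t It) qt
    (wdiffB (Wc t It) _ _ _ _ _ _ (dp t It) (dy t It)) (dq t It).
  apply: eq_wdiff; last by field; rewrite gt_eqF.
  by rewrite /a1 /X; field; rewrite !gt_eqF.
have dth2 t : I t -> wdiff I W (fun s => angle (P s) (q s)) t (a2 t) (b2 t).
  move=> It; have Dt := D0 t It.
  have := wdiff_angle _ _ _ _ _ _ _ _ _ (Wc t It) (q0 t It) (dP t It) (dq t It).
  by apply: eq_wdiff => //; rewrite /b2 /D; field; rewrite gt_eqF.
pose al t := sg * (2 / a * a1 t + 2 * a2 t) - be * a2 t.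
pose bt t := sg * (2 * b2 t) - be * b2 t.
have dpsi t : I t -> wdiff I W psi t (al t) (bt t).
  move=> It; have h1 := dth1 t It; have h2 := dth2 t It.
  have := wdiffB (Wc t It) _ _ _ _ _ _
    (wdiffZ (Wc t It) sg _ _ _ (wdiffD _ _ _ _ _ _
      (wdiffZ (Wc t It) (2 / a) _ _ _ (wdiffB (Wc t It) _ _ _ _ _ _ h1 (wdiff_cst pi)))
      (wdiffZ (Wc t It) 2 _ _ _ h2)))
    (wdiffZ (Wc t It) be _ _ _ h2).
  by apply: eq_wdiff; rewrite /al /bt; ring.
have Pc : econt I P by rewrite /P; econt_tac.
have Xn t : I t -> X t != 0 by move=> It; rewrite gt_eqF ?X0.
have Dn t : I t -> D t != 0 by move=> It; rewrite gt_eqF ?D0.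
have yn t : I t -> y t != 0 by move=> It; rewrite gt_eqF ?y0.
have Xc : econt I X by rewrite /X; econt_tac.
have Dc : econt I D by rewrite /D; econt_tac.
set C1 := (1 + a / r0) ^+ 2 / r0.
have C10 : 0 < C1 by rewrite /C1 divr_gt0// exprn_gt0// addr_gt0// divr_gt0.
apply: (ac_ge s b _ W psi al bt k sb) => //.
- apply: divr_ge0; last by rewrite mulr_ge0// ltW.
  apply: mulr_ge0; last exact: ltW.
  by apply: mulr_ge0; [rewrite mulr_ge0 ?sqr_ge0|exact: ltW].
- rewrite /al /a1 /a2 /aP /aq; econt_tac; rewrite ?mulf_neq0 ?Xn ?Dn ?yn//.
- by rewrite /bt /b2; econt_tac; rewrite ?Dn.
- by move=> t h1 h2; apply/dpsi/IE.
move=> t h1 h2 _; have It := IE t (ltW h1) (ltW h2).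
have [yt qt Xt] := And3 (y0 t It) (q0 t It) (X0 t It); have Dt := D0 t It.
set w := derive1 W t; pose f := w - k t; rewrite -/f.
pose Q := q t / D t; pose S := q t / (y t * X t).
pose m := (2 * sg - be) * (1 + a).
(* At [be] = 0 and f = 0 the right side vanishes: this is the conservation law. *)
have -> : al t + bt t * w = m * f * Q + be * (2 / a) * S.
  rewrite /m /f /Q /S /al /bt /a1 /a2 /b2 /aP /aq /X /D /P kE// /rho.
  by field; rewrite !gt_eqF.
have QS : Q ^+ 2 <= C1 * S.
  (* With n the square root of D, one has $q\le n$, $y\le n/r_0$ and $X\le(n+ay)^2$. *)
  have yX : q t * y t * X t <= C1 * D t ^+ 2.
    rewrite /X /D; have := far t It; set Dv := P t ^+ 2 + q t ^+ 2 => hD.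
    pose n := Num.sqrt Dv; have D00 : 0 <= Dv by exact: ltW Dt.
    have n2 : n ^+ 2 = Dv by rewrite sqr_sqrtr.
    have n0 : 0 <= n by exact: sqrtr_ge0.
    have yn' : y t <= n / r0.
      rewrite ler_pdivlMr// mulrC -(@ler_sqr R) ?nnegrE ?n2//.
      by rewrite mulr_ge0// ltW.
    have qn : q t <= n.
      by rewrite -ler_sqr ?nnegrE ?n2 ?(ltW qt)// /Dv lerDr sqr_ge0.
    have Pn : - n <= P t.
      have : `|P t| <= n.
        by rewrite -sqrtr_sqr ler_wsqrtr// /Dv lerDl sqr_ge0.
      by rewrite ler_norml => /andP[].
    have Xn' : p t ^+ 2 + q t ^+ 2 <= (n * (1 + a / r0)) ^+ 2.
      have e1 : p t ^+ 2 + q t ^+ 2 = Dv - 2 * (a * y t) * P t + (a * y t) ^+ 2.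
        by rewrite /Dv /P; ring.
      have ay0 : 0 <= a * y t by rewrite mulr_ge0// ltW.
      have e2 : 0 <= (a * y t) * (P t + n) by rewrite mulr_ge0//; lra.
      have e3 : p t ^+ 2 + q t ^+ 2 <= (n + a * y t) ^+ 2.
        by rewrite e1 -n2 sqrrD mulrDr in e2 *; rewrite mulr2n; lra.
      have z1 : 0 <= n + a * y t by rewrite addr_ge0.
      have z2 : 0 <= n * (1 + a / r0).
        by rewrite mulr_ge0// addr_ge0// divr_ge0//; exact: ltW.
      apply: le_trans e3 _; rewrite ler_sqr ?nnegrE//.
      rewrite mulrDr mulr1 lerD2l.
      have -> : n * (a / r0) = a * (n / r0) by ring.
      by rewrite ler_pM2l.
    have -> : C1 * Dv ^+ 2 = n * (n / r0) * (n * (1 + a / r0)) ^+ 2.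
      by rewrite -n2 /C1; field; rewrite gt_eqF.
    apply: ler_pM => //; [by apply: mulr_ge0; exact: ltW|exact: ltW|].
    by apply: ler_pM => //; exact: ltW.
  have -> : Q ^+ 2 = q t * y t * X t * (q t / (y t * X t * D t ^+ 2)).
    by rewrite /Q; field; rewrite !gt_eqF.
  have -> : C1 * S = C1 * D t ^+ 2 * (q t / (y t * X t * D t ^+ 2)).
    by rewrite /S; field; rewrite !gt_eqF// exprn_gt0.
  rewrite ler_wpM2r// divr_ge0 ?(ltW qt)// ltW// !mulr_gt0// exprn_gt0.
have k0 : 0 < be * (2 / a) / C1 by rewrite divr_gt0// mulr_gt0// divr_gt0.
have := quad_ge (be * (2 / a) / C1) m f Q k0.
have : be * (2 / a) / C1 * Q ^+ 2 <= be * (2 / a) * S.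
  have -> : be * (2 / a) * S = be * (2 / a) / C1 * (C1 * S).
    by field; rewrite !gt_eqF.
  by rewrite ler_wpM2l// ltW.
have : m ^+ 2 / (4 * (be * (2 / a) / C1)) * f ^+ 2 <=
    9 * (1 + a) ^+ 2 * C1 * a / (8 * be) * f ^+ 2.
  rewrite ler_wpM2r ?sqr_ge0//.
  have -> : m ^+ 2 / (4 * (be * (2 / a) / C1)) = m ^+ 2 * (C1 * a / (8 * be)).
    by field; rewrite !gt_eqF.
  have -> : 9 * (1 + a) ^+ 2 * C1 * a / (8 * be) =
    9 * (1 + a) ^+ 2 * (C1 * a / (8 * be)) by field; rewrite !gt_eqF.
  apply: ler_wpM2r; first by apply: divr_ge0; apply: mulr_ge0 => //; exact: ltW.
  (* The 9 comes from $|2sg-be|\le 3$. *)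
  rewrite /m exprMn ler_wpM2r ?sqr_ge0//.
  by have /eqP := sg1; rewrite sqrf_eq1 => /orP[]/eqP ->; nra.
lra.
Qed.

End Lyapunov.

(** * The marked point stays away from the driving function *)

Lemma abs_continuous_econt {R : realType} (a b : R) (f : R -> R) :
  abs_continuous a b f -> econt `[a, b] f.
Proof.
move=> H t; rewrite /= in_itv/= => /andP[at_ tb] e /H[d d0 Hd]; exists d => // s.
rewrite /= in_itv/= => /andP[as_ sb] st.
have key u v : a <= u -> u <= v -> v <= b -> v - u < d -> `|f v - f u| < e.
  move=> au uv vb l; have := Hd 1 (fun=> u) (fun=> v); rewrite !big_ord1; apply => //.
  by apply/trivIsetP => i j _ _; rewrite !ord1 eqxx.
move: st; have [ts|st] := leP t s.
  by rewrite (ger0_norm (_ : 0 <= s - t)) ?subr_ge0// => l; apply: key.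
rewrite distrC (ger0_norm (_ : 0 <= t - s)) ?subr_ge0 ?(ltW st)// => l.
by rewrite distrC; apply: key => //; exact: ltW.
Qed.

(* Picks the scale at which the Euler estimates below beat [e]. *)
Lemma euler_scale {R : realType} (A : set R) (W : R -> R) (t k1 k2 e d1 : R) :
  econt A W -> A t -> 0 < k1 -> 0 < k2 -> 0 < e -> 0 < d1 ->
  exists d m, [/\ 0 < d, d <= d1, m <= d1, k1 * (k2 * d + m) <= e &
    forall s, A s -> `|s - t| < d -> `|W s - W t| <= m].
Proof.
move=> Wc At k10 k20 e0 d10.
have [m [m0 md me]] : exists m, [/\ 0 < m, m <= d1 & k1 * m <= e / 2].
  exists (Num.min d1 (e / (2 * k1))); rewrite lt_min d10 ge_min lexx/=.
  rewrite divr_gt0 ?mulr_gt0//; split => //.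
  apply: (@le_trans _ _ (k1 * (e / (2 * k1)))).
    by rewrite ler_pM2l// ge_min lexx orbT.
  by rewrite le_eqVlt; apply/predU1P; left; field; rewrite gt_eqF.
have [d2 d20 H2] := Wc t At m m0.
exists (Num.min d1 (Num.min d2 (e / (2 * k1 * k2)))), m; split => //.
- by rewrite !lt_min d10 d20 divr_gt0// !mulr_gt0.
- by rewrite ge_min lexx.
- have : k1 * k2 * Num.min d1 (Num.min d2 (e / (2 * k1 * k2))) <= e / 2.
    apply: (@le_trans _ _ (k1 * k2 * (e / (2 * k1 * k2)))).
      by rewrite ler_pM2l ?mulr_gt0// !ge_min lexx !orbT.
    by rewrite le_eqVlt; apply/predU1P; left; field; rewrite !gt_eqF.
  by rewrite mulrDr mulrA; lra.
- by move=> s As; rewrite !lt_min => /and3P[_ l _]; apply/ltW/H2.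
Qed.

Section Positivity.
Context {R : realType} {x0 : R} {T : \bar R} {gamma : R -> R[i]^o}
  {g : R -> R[i]^o -> R[i]^o} {W x : R -> R} {rho : R}.
Hypothesis rho2 : - 2 < rho.
Hypothesis x00 : 0 < x0.
Hypothesis LC : loewner_curve x0 T gamma g W x.
Hypothesis AC : forall a b : R, 0 <= a -> a <= b -> (b%:E < T)%E ->
  abs_continuous a b W.
Let k t := rho / (W t - x t).
Hypothesis fin :
  (\int[@lebesgue_measure R]_(t in times T) ((derive1 W t - k t) ^+ 2)%:E < +oo)%E.

Let y t := x t - W t.
Let a := 2 / (2 + rho).

Let rho0 : 0 < 2 + rho. Proof. by have := rho2; lra. Qed.

Lemma scale_gt0 : 0 < a. Proof. by rewrite divr_gt0. Qed.

Lemma scaleE : 2 / a - 2 = rho.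
Proof. by rewrite /a; field; rewrite gt_eqF. Qed.

Lemma driving_cont b : 0 <= b -> (b%:E < T)%E -> econt `[0, b] W.
Proof. by move=> b0 bT; apply: abs_continuous_econt; exact: AC. Qed.

Lemma energyE s b : (forall t, s <= t -> t <= b -> 0 < y t) ->
  forall t, `[s, b]%classic t -> k t = - ((2 / a - 2) / y t).
Proof.
move=> yp t; rewrite /= in_itv/= => /andP[h1 h2]; have := yp t h1 h2.
by rewrite scaleE /k /y -(opprB (x t)) invrN mulrN.
Qed.

Lemma wdiff_marked c b : 0 < c -> 0 <= b -> (b%:E < T)%E ->
  (forall t, 0 <= t -> t <= b -> c <= y t) ->
  forall t, 0 <= t -> t <= b -> wdiff `[0, b] W y t (2 / y t) (-1).
Proof.
move=> c0 b0 bT yc t t0 tb e e0; have Wc := driving_cont b b0 bT.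
have tI : (`[0, b]%classic : set R) t by rewrite /= in_itv/= t0.
have k1 : 0 < 32 / c ^+ 2 by rewrite divr_gt0// exprn_gt0.
have k2 : 0 < 24 / c by rewrite divr_gt0.
have [d1 [d10 d1c d1c2]] : exists d1, [/\ 0 < d1, d1 <= c / 32 & d1 <= c ^+ 2 / 128].
  exists (Num.min (c / 32) (c ^+ 2 / 128)).
  by rewrite lt_min !ge_min !lexx orbT !divr_gt0// exprn_gt0.
have [d [m [d0 dd1 md1 kd Wm]]] := euler_scale _ W t _ _ e d1 Wc tI k1 k2 e0 d10.
have key u v : 0 <= u -> u <= t -> t <= v -> v <= b -> v - u < d ->
    `|x v - x u - (v - u) * (2 / y t)| <= e * (v - u).
  move=> u0 ut tv vb uv.
  have vT : (v%:E < T)%E by apply: le_lt_trans bT; rewrite lee_fin.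
  have near_t r : u <= r -> r <= v -> `|W r - W t| <= m.
    move=> h1 h2; apply: Wm; first by rewrite /= in_itv/=; lra.
    by rewrite ltr_norml; lra.
  have [||||_ H] := marked_local x00 LC u v c u0 _ vT c0.
  - by lra.
  - by apply: yc; lra.
  - move=> r h1 h2; have := near_t r h1 h2; have := near_t u (lexx _) (le_trans ut tv).
    by rewrite !ler_norml => /andP[? ?] /andP[? ?]; lra.
  - by lra.
  apply: le_trans (H u v t m _ ut tv _ near_t) _ => //.
  apply: ler_wpM2r; first by lra.
  by apply: le_trans kd; rewrite ler_pM2l// lerD2r ler_pM2l// ltW.
exists d => // s; rewrite /= in_itv/= => /andP[s0 sb] st.
rewrite /y mulN1r opprK.
have -> : x s - W s - (x t - W t) - 2 / (x t - W t) * (s - t) + (W s - W t) =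
  x s - x t - (s - t) * (2 / y t) by rewrite /y; ring.
apply: (@le_trans _ _ (e * `|s - t|)); last by rewrite ler_pM2l// lerDl.
move: st; have [ts|/ltW ts] := leP t s.
  by rewrite (ger0_norm (_ : 0 <= s - t)) ?subr_ge0// => l; apply: key.
rewrite distrC (ger0_norm (_ : 0 <= t - s)) ?subr_ge0// -normrN => l.
have -> : - (x s - x t - (s - t) * (2 / y t)) = x t - x s - (t - s) * (2 / y t) by ring.
exact: key.
Qed.

Lemma econt_marked c b : 0 < c -> 0 <= b -> (b%:E < T)%E ->
  (forall t, 0 <= t -> t <= b -> c <= y t) -> econt `[0, b] y.
Proof.
move=> c0 b0 bT yc t tI; have := tI; rewrite /= in_itv/= => /andP[t0 tb].
exact: (wdiff_cont (driving_cont b b0 bT t tI) _ _ _ (wdiff_marked c b c0 b0 bT yc t t0 tb)).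
Qed.

(** [ln_gap] started from $y_0=x_0$ gives the bound $c=x_0e^{-aE/8}$ as long as y is known to be
    positive. Continuation closes the circle: from $y\ge c$ up to some time, [marked_local] gives
    $y\ge c/4$ a little longer, and [ln_gap] improves this to [c] again. *)
Lemma marked_lower : exists2 c, 0 < c & forall t, 0 <= t -> (t%:E < T)%E -> c <= y t.
Proof.
pose E := fine (\int[@lebesgue_measure R]_(t in times T) ((derive1 W t - k t) ^+ 2)%:E).
have E0 : 0 <= E by apply/fine_ge0/integral_ge0 => t _; rewrite lee_fin sqr_ge0.
have y00 : y 0 = x0.
  by rewrite /y (loewner_curve_marked0 LC) (loewner_curve_driving0 LC) subr0.
pose c := expR (ln x0 - a / 8 * E); have c0 : 0 < c by exact: expR_gt0.
(* The bound [d] is only qualitative: the conclusion involves [c] alone. *)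
have up d b : 0 < d -> 0 <= b -> (b%:E < T)%E ->
    (forall t, 0 <= t -> t <= b -> d <= y t) -> c <= y b.
  move=> d0 b0 bT yd; have yp t : 0 <= t -> t <= b -> 0 < y t.
    by move=> h1 h2; exact: lt_le_trans (yd t h1 h2).
  have yb : 0 < y b by apply: yp.
  rewrite -[leRHS]lnK ?posrE// ler_expR.
  have yp' t : `[0, b]%classic t -> 0 < y t.
    by rewrite /= in_itv/= => /andP[]; exact: yp.
  have dy t : `[0, b]%classic t -> wdiff `[0, b] W y t (2 / y t) (-1).
    by rewrite /= in_itv/= => /andP[h1 h2]; exact: wdiff_marked d0 b0 bT yd t h1 h2.
  have H := ln_gap scale_gt0 b0 (AC 0 b (lexx _) b0 bT) (driving_cont b b0 bT)
    (econt_marked d b d0 b0 bT yd) yp' dy (energyE 0 b yp).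
  have : ((ln (y 0) - ln (y b))%:E <= (a / 8)%:E * E%:E)%E.
    apply: le_trans H _; apply: lee_wpmul2l.
      by rewrite lee_fin divr_ge0// ltW// scale_gt0.
    rewrite fineK; last first.
      by rewrite ge0_fin_numE// integral_ge0// => t _; rewrite lee_fin sqr_ge0.
    apply: ge0_integral_mono => [t _|t _||//]; rewrite ?lee_fin ?sqr_ge0//.
    move=> t; rewrite /= in_itv/= => /andP[h1 h2]; split => //.
    by apply: lt_trans bT; rewrite lte_fin.
  by rewrite y00 -EFinM lee_fin; lra.
exists c => // b b0 bT; have Wc := driving_cont b b0 bT.
have step s e : 0 <= s -> s <= e -> e <= b -> (forall r, 0 <= r -> r <= s -> c <= y r) ->
    (forall r, s <= r -> r <= e -> `|W r - W s| <= c / 16) -> e - s <= c ^+ 2 / 128 ->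
    c <= y e.
  move=> s0 se eb yc oW es; have eT : (e%:E < T)%E by apply: le_lt_trans bT; rewrite lee_fin.
  have [h _] := marked_local x00 LC s e c s0 se eT c0 (yc s s0 (lexx _)) oW es.
  apply: (up (c / 4)) => //; [by rewrite divr_gt0|exact: le_trans se|].
  move=> t t0 te; have [ts|st] := leP t s; last exact: h (ltW st) te.
  by have := yc t t0 ts; lra.
have c16 : 0 < c / 16 by rewrite divr_gt0.
have c128 : 0 < c ^+ 2 / 128 by rewrite divr_gt0// exprn_gt0.
suff : forall t, 0 <= t -> t <= b -> c <= y t by apply.
apply: real_induction.
- rewrite y00 -[leRHS]lnK ?posrE// ler_expR lerBlDr lerDl.
  by rewrite mulr_ge0// divr_ge0// ltW// scale_gt0.
- move=> t t0 tb Ht; have tI : `[0, b]%classic t by rewrite /= in_itv/= t0 ltW.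
  have [d d0 Hd] := Wc t tI _ c16.
  exists (Num.min d (c ^+ 2 / 128)) => [|e te]; first by rewrite lt_min d0.
  rewrite -ltrBlDl lt_min => /andP[l1 l2] eb.
  apply: (step t e) => //; [exact: ltW| |exact: ltW].
  move=> r tr re; apply/ltW/Hd; first by rewrite /= in_itv/=; lra.
  by rewrite ger0_norm; lra.
- move=> t t0 tb Ht; have tI : `[0, b]%classic t by rewrite /= in_itv/= tb ltW.
  have c32 : 0 < c / 32 by rewrite divr_gt0.
  have [d d0 Hd] := Wc t tI _ c32.
  have [s [s0 st sd sc]] : exists s, [/\ 0 <= s, s < t, t - s < d & t - s <= c ^+ 2 / 128].
    pose m := Num.min t (Num.min d (c ^+ 2 / 128)) / 2.
    have [m0 m1 m2 m3] : [/\ 0 < m, m < t, m < d & m < c ^+ 2 / 128].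
      rewrite /m; set n := Num.min _ _; have n0 : 0 < n by rewrite !lt_min t0 d0.
      have [h1 h2 h3] : [/\ n <= t, n <= d & n <= c ^+ 2 / 128].
        by rewrite /n !ge_min !lexx !orbT.
      by split; lra.
    by exists (t - m); split; lra.
  have osc r : s <= r -> r <= t -> `|W r - W t| < c / 32.
    move=> sr rt; apply: Hd; first by rewrite /= in_itv/=; lra.
    by rewrite ltr_norml; lra.
  apply: (step s t) => //; [exact: ltW| |].
    by move=> r r0 rs; apply: Ht => //; exact: le_lt_trans st.
  move=> r sr rt; have := osc r sr rt; have := osc s (lexx _) (ltW st).
  by rewrite !ltr_norml ler_norml => /andP[? ?] /andP[? ?]; lra.
Qed.

End Positivity.

(** * The angle functional is small at later tips *)

Lemma wdiff_flow {R : realType} (Z : R -> R[i]) (W : R -> R) (b d : R) :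
  flow Z W 0 b -> econt `[0, b] W -> 0 < d ->
  (forall r, 0 <= r -> r <= b -> d <= Im (Z r)) ->
  let p r := Re (Z r) - W r in let q r := Im (Z r) in
  forall t, 0 <= t -> t <= b ->
    wdiff `[0, b] W p t (2 * p t / (p t ^+ 2 + q t ^+ 2)) (-1) /\
    wdiff `[0, b] W q t (- (2 * q t / (p t ^+ 2 + q t ^+ 2))) 0.
Proof.
move=> F Wc d0 dq p q t t0 tb.
have tI : (`[0, b]%classic : set R) t by rewrite /= in_itv/= t0.
have far r : 0 <= r -> r <= b -> d <= cabs (Z r - (W r)%:C).
  move=> r0 rb; apply: le_trans (dq r r0 rb) _.
  have := Im_le_cabs (Z r - (W r)%:C); rewrite cImB /= subr0.
  by apply: le_trans; exact: ler_norm.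
have k1 : 0 < 2 / d ^+ 2 by rewrite divr_gt0// exprn_gt0.
have k2 : 0 < 6 / d by rewrite divr_gt0.
pose v := 2%:C / (Z t - (W t)%:C) : R[i].
have euler e : 0 < e -> exists2 k, 0 < k & forall s, `[0, b]%classic s -> `|s - t| < k ->
    cabs (Z s - Z t - (s - t)%:C * v) <= e * `|s - t|.
  move=> e0.
  have [k [m [k0 _ _ kd Wm]]] := euler_scale _ W t _ _ e 1 Wc tI k1 k2 e0 ltr01.
  have key u w : 0 <= u -> u <= t -> t <= w -> w <= b -> w - u < k ->
      cabs (Z w - Z u - (w - u)%:C * v) <= e * (w - u).
    move=> u0 ut tw wb uw.
    have near_t r : u <= r -> r <= w -> `|W r - W t| <= m.
      move=> h1 h2; apply: Wm; first by rewrite /= in_itv/=; lra.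
      by rewrite ltr_norml; lra.
    have F' := flowS _ _ _ _ _ _ u0 wb F.
    have far' r : u <= r -> r <= w -> d <= cabs (Z r - (W r)%:C).
      by move=> h1 h2; apply: far; lra.
    apply: le_trans (flow_diff Z W u w d m t F' d0 far' ut tw near_t) _.
    apply: ler_wpM2r; first by lra.
    by apply: le_trans kd; rewrite ler_pM2l// lerD2r ler_pM2l// ltW.
  exists k => // s; rewrite /= in_itv/= => /andP[s0 sb].
  have [ts|/ltW ts] := leP t s.
    by rewrite (ger0_norm (_ : 0 <= s - t)) ?subr_ge0// => l; apply: key.
  rewrite distrC (ger0_norm (_ : 0 <= t - s)) ?subr_ge0// -cabsN => l.
  have -> : - (Z s - Z t - (s - t)%:C * v) = Z t - Z s - (t - s)%:C * v.
    by apply: complexP; rewrite !(cReN, cImN, cReB, cImB, cReM, cImM) /=; ring.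
  exact: key.
have X0 : 0 < p t ^+ 2 + q t ^+ 2.
  by rewrite ltr_wpDl ?sqr_ge0// exprn_gt0// (lt_le_trans d0)// dq.
have vRe : Re v = 2 * p t / (p t ^+ 2 + q t ^+ 2).
  rewrite /v cReM cReV cImV cabs_sqr !(cReB, cImB) /= !subr0 -/(p t) -/(q t).
  by rewrite mul0r subr0 mulrA.
have vIm : Im v = - (2 * q t / (p t ^+ 2 + q t ^+ 2)).
  rewrite /v cImM cReV cImV cabs_sqr !(cReB, cImB) /= !subr0 -/(p t) -/(q t).
  by rewrite mul0r addr0 mulNr mulrN mulrA.
move: v euler vRe vIm => v euler vRe vIm.
split=> e e0; have [k k0 H] := euler e e0; exists k => // s sI st.
  apply: le_trans (_ : _ <= e * `|s - t|) _; last by rewrite ler_pM2l// lerDl.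
  apply: le_trans (H s sI st); apply: le_trans (Re_le_cabs _).
  rewrite le_eqVlt; apply/predU1P; left; congr (`|_|).
  rewrite -vRe !cReB cReM /= /p; ring.
apply: le_trans (_ : _ <= e * `|s - t|) _; last by rewrite ler_pM2l// lerDl.
apply: le_trans (H s sI st); apply: le_trans (Im_le_cabs _).
rewrite le_eqVlt; apply/predU1P; left; congr (`|_|).
by rewrite -vIm !cImB cImM /= /q; ring.
Qed.

Lemma wdiffS {R : realType} (A B : set R) (W phi : R -> R) (t al be : R) :
  A `<=` B -> wdiff B W phi t al be -> wdiff A W phi t al be.
Proof. by move=> AB H e /H[d d0 Hd]; exists d => // s /AB; exact: Hd. Qed.

Lemma atan_near_pi2 {R : realType} (e : R) : 0 < e ->
  exists2 M, 0 < M & forall u, M <= u -> pi / 2 - e <= atan u.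
Proof.
move=> e0; have p0 := pi_gt0 R.
have [k [k0 ke kp]] : exists k : R, [/\ 0 < k, k <= e & k < pi / 2].
  exists (Num.min e (pi / 4)); rewrite lt_min e0 divr_gt0// ge_min lexx; split=> //.
  by apply: le_lt_trans (_ : _ <= pi / 4) _; [rewrite ge_min lexx orbT|lra].
exists (Num.max 1 (tan (pi / 2 - k))) => [|u]; first by rewrite lt_max ltr01.
rewrite ge_max => /andP[_ /le_atan]; rewrite tanK; first by lra.
by rewrite in_itv/=; apply/andP; split; lra.
Qed.

Lemma angle_ge0 {R : realType} (P q : R) : 0 <= angle P q.
Proof. by rewrite subr_ge0 ltW// atan_ltpi2. Qed.

Lemma angle_le_pi {R : realType} (P q : R) : angle P q <= pi.
Proof. by have := atan_gtNpi2 (P / q); rewrite /angle; lra. Qed.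

Section Angle.
Context {R : realType} {x0 : R} {T : \bar R} {gamma : R -> R[i]^o}
  {g : R -> R[i]^o -> R[i]^o} {W x : R -> R} {rho : R}.
Hypothesis rho2 : - 2 < rho.
Hypothesis x00 : 0 < x0.
Hypothesis LC : loewner_curve x0 T gamma g W x.
Hypothesis AC : forall a b : R, 0 <= a -> a <= b -> (b%:E < T)%E ->
  abs_continuous a b W.
Let k t := rho / (W t - x t).
Hypothesis fin :
  (\int[@lebesgue_measure R]_(t in times T) ((derive1 W t - k t) ^+ 2)%:E < +oo)%E.

Let y t := x t - W t.
Let a := 2 / (2 + rho).
Let gmap := @hull_map R g.

(** For $z=\gamma(t)$ the functional [N] is followed from [s] to a time [b] just before t, where
    [tip] makes it nearly 0. Between them [angle_gap] applies, with its hypothesis of distance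
    supplied by [relu2_gap]. The time [s] depends only on how much energy is left, hence not on
    t. *)
Lemma angle_small (del : R) : 0 < del -> exists2 s, times T s &
  forall t, times T t -> s < t ->
  `|2 / a * (angle (Re (gmap s (gamma t)) - x s) (Im (gmap s (gamma t))) - pi) +
    2 * angle (Re (gmap s (gamma t)) - W s + a * y s) (Im (gmap s (gamma t)))| <= del.
Proof.
move=> del0; have a0 : 0 < a := scale_gt0 rho2.
have [c c0 yc] := marked_lower rho2 x00 LC AC fin.
have Wc := driving_cont AC; have p0 := pi_gt0 R.
(* As angles are at most $\pi$, the auxiliary term costs at most half of [del]. *)
have [be [be0 be1 bed]] : exists be : R, [/\ 0 < be, be <= 1 & be * pi <= del / 2].
  move: (@pi R) p0 => w w0.
  exists (Num.min 1 (del / (2 * w))); rewrite lt_min ltr01 divr_gt0 ?mulr_gt0//.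
  rewrite ge_min lexx; split=> //.
  apply: (@le_trans _ _ (del / (2 * w) * w)).
    by rewrite ler_pM2r// ge_min lexx orbT.
  by rewrite le_eqVlt; apply/predU1P; left; field; rewrite gt_eqF.
have r00 : 0 < a / 4 by rewrite divr_gt0.
set c1 := (a / 2) ^+ 2; have c10 : 0 < c1 by rewrite exprn_gt0// divr_gt0.
pose K1 := a * c1 * (c1 + (1 + a) ^+ 2).
have K10 : 0 < K1 by apply: mulr_gt0; [exact: mulr_gt0|apply: ltr_wpDr; rewrite ?sqr_ge0].
pose K2 := 9 * (1 + a) ^+ 2 * ((1 + a / (a / 4)) ^+ 2 / (a / 4)) * a / (8 * be).
have K20 : 0 < K2.
  have h1 : 0 < 1 + a by lra.
  have h2 : 0 < 1 + a / (a / 4) by rewrite addr_gt0// divr_gt0.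
  rewrite /K2; apply: divr_gt0; last exact: mulr_gt0.
  apply: mulr_gt0 => //; apply: mulr_gt0; last by apply: divr_gt0 => //; exact: exprn_gt0.
  by apply: mulr_gt0 => //; exact: exprn_gt0.
(* The remaining energy [ep] must keep the truncated function below $(3c_1/4)^2$ and cost at most
   del/4 in the angle estimate. *)
have [ep [ep0 ep1 ep2]] : exists ep : R,
    [/\ 0 < ep, K1 * ep <= (3 * c1 / 4) ^+ 2 & K2 * ep <= del / 4].
  have h0 : 0 < (3 * c1 / 4) ^+ 2 by rewrite exprn_gt0// divr_gt0// mulr_gt0.
  exists (Num.min ((3 * c1 / 4) ^+ 2 / K1) (del / 4 / K2)).
  have d4 : 0 < del / 4 by rewrite divr_gt0.
  have q1 : 0 < (3 * c1 / 4) ^+ 2 / K1 by exact: divr_gt0.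
  have q2 : 0 < del / 4 / K2 by exact: divr_gt0.
  rewrite lt_min q1 q2; split=> //.
    by rewrite -ler_pdivlMl// mulrC ge_min lexx.
  by rewrite -ler_pdivlMl// [leRHS]mulrC ge_min lexx orbT.
have f0 t : times T t -> (0 <= ((derive1 W t - k t) ^+ 2)%:E)%E.
  by rewrite lee_fin sqr_ge0.
have [s sT tail] := integral_tail T _ ep (loewner_curve_T_gt0 LC) f0 fin ep0.
exists s => // t tT st; have [s0 _] := sT; have [t0 tT'] := tT.
set z := (gamma t : R[i]).
pose p r := Re (gmap r z) - W r; pose q r := Im (gmap r z).
pose P r := p r + a * y r.
have ltT b : b < t -> (b%:E < T)%E by move=> bt; apply: lt_trans tT'; rewrite lte_fin.
have domb b : b < t -> dom (curve_hull gamma b) z by move=> bt; exact: (gamma_dom LC).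
have qp b : 0 <= b -> b < t -> 0 < q b.
  by move=> b0 bt; apply: (gmap_im LC) => //; [exact: ltT|exact: domb].
have yp b : 0 <= b -> b < t -> 0 < y b.
  by move=> b0 bt; apply: lt_le_trans (yc b b0 (ltT b bt)).
have en r b : s <= r -> r <= b -> b < t -> (@energy R r b W k <= ep%:E)%E.
  move=> sr rb bt; apply: le_trans (tail b (le_trans sr rb) (ltT b bt)).
  apply: ge0_integral_mono => [u _|u _||//]; rewrite ?lee_fin ?sqr_ge0//.
  by apply: subset_itv; rewrite bnd_simp.
have sub r b : 0 <= r -> `[r, b]%classic `<=` (`[0, b]%classic : set R).
  by move=> r0; apply: subset_itv; rewrite bnd_simp.
have setup r b : 0 <= r -> r <= b -> b < t ->
    [/\ abs_continuous r b W, econt `[r, b] W, econt `[r, b] y, econt `[r, b] p &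
    econt `[r, b] q] /\ [/\ (forall u, `[r, b]%classic u -> 0 < y u),
    (forall u, `[r, b]%classic u -> wdiff `[r, b] W y u (2 / y u) (-1)),
    (forall u, `[r, b]%classic u -> 0 < q u),
    (forall u, `[r, b]%classic u ->
      wdiff `[r, b] W p u (2 * p u / (p u ^+ 2 + q u ^+ 2)) (-1)) &
    (forall u, `[r, b]%classic u ->
      wdiff `[r, b] W q u (- (2 * q u / (p u ^+ 2 + q u ^+ 2))) 0)].
  move=> r0 rb bt; have b0 := le_trans r0 rb; have bT := ltT b bt.
  have WcI : econt `[r, b] W by apply: econtS (Wc b b0 bT); exact: sub.
  have inI u : `[r, b]%classic u -> 0 <= u /\ u <= b.
    by move=> /(sub r b r0); rewrite /= in_itv/= => /andP[].
  have ycb u : 0 <= u -> u <= b -> c <= y u.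
    by move=> u0 ub; apply: yc => //; exact/ltT/(le_lt_trans ub).
  have dy u : `[r, b]%classic u -> wdiff `[r, b] W y u (2 / y u) (-1).
    move=> /inI[u0 ub]; apply: wdiffS (sub r b r0) _.
    exact: (wdiff_marked x00 LC AC c b c0 b0 bT ycb).
  have qb u : 0 <= u -> u <= b -> q b <= q u.
    by move=> u0 ub; exact: (gmap_im_le LC u b z u0 ub bT (domb b bt)).
  have dpq u : `[r, b]%classic u -> _ := fun uI => wdiff_flow (gmap ^~ z) W b (q b)
    (gmap_flow LC b z b0 bT (domb b bt)) (Wc b b0 bT) (qp b b0 bt) qb u (inI u uI).1 (inI u uI).2.
  have dp u : `[r, b]%classic u ->
      wdiff `[r, b] W p u (2 * p u / (p u ^+ 2 + q u ^+ 2)) (-1).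
    by move=> /dpq[h _]; exact: wdiffS (sub r b r0) h.
  have dq u : `[r, b]%classic u ->
      wdiff `[r, b] W q u (- (2 * q u / (p u ^+ 2 + q u ^+ 2))) 0.
    by move=> /dpq[_ h]; exact: wdiffS (sub r b r0) h.
  split; split => //.
  - exact: AC.
  - by move=> u uI; exact: wdiff_cont (WcI u uI) _ _ _ (dy u uI).
  - by move=> u uI; exact: wdiff_cont (WcI u uI) _ _ _ (dp u uI).
  - by move=> u uI; exact: wdiff_cont (WcI u uI) _ _ _ (dq u uI).
  - by move=> u /inI[u0 ub]; apply: yp => //; exact: le_lt_trans bt.
  - by move=> u /inI[u0 ub]; apply: qp => //; exact: le_lt_trans bt.
have kE r b : 0 <= r -> r <= b -> b < t ->
    forall u, `[r, b]%classic u -> k u = - ((2 / a - 2) / y u).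
  move=> r0 rb bt; apply: (energyE rho2) => u ru ub; apply: yp; first exact: le_trans ru.
  exact: le_lt_trans bt.
have near_tip eta lo : 0 < eta -> 0 <= lo -> lo < t ->
    exists b, [/\ lo <= b, b < t, `|p b| <= eta & q b <= eta].
  move=> eta0 lo0 lot; have [d d0 H] := tip LC Wc t eta tT eta0.
  have [b [lob bt db]] : exists b, [/\ lo <= b, b < t & t - d < b].
    exists (Num.max lo (t - d / 2)); rewrite le_max lexx gt_max lot/=.
    by rewrite lt_max; split; [|lra|apply/orP; right; lra].
  exists b; split => //.
    have := Re_le_cabs (gmap b z - (W b)%:C); rewrite cReB => /le_trans; apply.
    by apply: H => //; exact: le_trans lob.
  have := Im_le_cabs (gmap b z - (W b)%:C); rewrite cImB subr0 => h.
  apply: le_trans (ler_norm _) _; apply: le_trans h _.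
  by apply: H => //; exact: le_trans lob.
have gap1 r b : s <= r -> r <= b -> b < t ->
    relu2 c1 ((P r / y r) ^+ 2 + (q r / y r) ^+ 2) -
    relu2 c1 ((P b / y b) ^+ 2 + (q b / y b) ^+ 2) <= K1 * ep.
  move=> sr rb bt; have r0 := le_trans (ltW s0) sr.
  have [[h1 h2 h3 h4 h5] [h6 h7 h8 h9 h10]] := setup r b r0 rb bt.
  have := relu2_gap a0 rb h1 h2 h3 h6 h7 (kE r b r0 rb bt) h4 h5 h8 h9 h10.
  rewrite -lee_fin (EFinM K1) => /le_trans; apply.
  by apply: (@lee_wpmul2l _ K1%:E); [rewrite lee_fin ltW|exact: en].
(* Near the tip P is at least ay/2, so the truncated function vanishes. Going back in time it stays
   below $(3c_1/4)^2$, which leaves $(P^2+q^2)/y^2\ge c_1/4=(a/4)^2$. *)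
have far r : s <= r -> r < t -> (a / 4 * y r) ^+ 2 <= P r ^+ 2 + q r ^+ 2.
  move=> sr rt; have r0 := le_trans (ltW s0) sr.
  have eta0 : 0 < a * c / 2 by rewrite divr_gt0// mulr_gt0.
  have [b [rb bt pb qb]] := near_tip _ r eta0 r0 rt.
  have b0 := le_trans r0 rb.
  have cb : c <= y b by apply: yc => //; exact: ltT.
  have big : c1 <= (P b / y b) ^+ 2 + (q b / y b) ^+ 2.
    apply: (@le_trans _ _ ((P b / y b) ^+ 2)); last by rewrite lerDl sqr_ge0.
    have h : a / 2 <= P b / y b.
      rewrite ler_pdivlMr ?yp// /P; move: pb; rewrite ler_norml => /andP[h1 h2].
      have : a * c <= a * y b by rewrite ler_pM2l.
      lra.
    by rewrite /c1 !expr2; apply: ler_pM => //; rewrite ltW// divr_gt0.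
  have := gap1 r b sr rb bt.
  have -> : relu2 c1 ((P b / y b) ^+ 2 + (q b / y b) ^+ 2) = 0.
    by rewrite /relu2 max_l ?subr_le0// expr0n.
  rewrite subr0 => h; have {}h := le_trans h ep1.
  set v := (P r / y r) ^+ 2 + (q r / y r) ^+ 2 in h.
  have vc : c1 / 4 <= v.
    have h1 : c1 - v <= Num.max 0 (c1 - v) by rewrite le_max lexx orbT.
    have h2 : Num.max 0 (c1 - v) <= 3 * c1 / 4.
      rewrite -(@ler_sqr R) ?nnegrE ?le_max ?lexx//.
      by rewrite divr_ge0// mulr_ge0// ltW.
    lra.
  have yr := yp r r0 rt.
  have -> : P r ^+ 2 + q r ^+ 2 = v * y r ^+ 2 by rewrite /v; field; rewrite gt_eqF.
  have -> : (a / 4 * y r) ^+ 2 = c1 / 4 * y r ^+ 2 by rewrite /c1; field.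
  by rewrite ler_wpM2r// sqr_ge0.
pose N r := 2 / a * (angle (p r - y r) (q r) - pi) + 2 * angle (P r) (q r).
have gap2 sg b : sg ^+ 2 = 1 -> s <= b -> b < t ->
    sg * N s - be * angle (P s) (q s) - (sg * N b - be * angle (P b) (q b)) <= del / 4.
  move=> sg1 sb bt; have s0' := ltW s0.
  have [[h1 h2 h3 h4 h5] [h6 h7 h8 h9 h10]] := setup s b s0' sb bt.
  have farI u : `[s, b]%classic u -> (a / 4 * y u) ^+ 2 <= P u ^+ 2 + q u ^+ 2.
    by rewrite /= in_itv/= => /andP[su ub]; apply: far => //; exact: le_lt_trans bt.
  have := angle_gap a0 sb h1 h2 h3 h6 h7 (kE s b s0' sb bt) h4 h5 h8 h9 h10
    sg be (a / 4) sg1 be0 be1 r00 farI.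
  rewrite -lee_fin => /le_trans; apply.
  apply: (@le_trans _ _ (K2 * ep)%:E); last by rewrite lee_fin.
  by rewrite (EFinM K2); apply: (@lee_wpmul2l _ K2%:E); [rewrite lee_fin ltW|exact: en].
(* Close to the tip $g_b(z)-x_b$ points almost to the left and $g_b(z)-v_b$ almost to the right, as
   y is at least [c] and p, q are tiny. *)
have [b [sb bt Nb]] : exists b, [/\ s <= b, b < t & `|N b| <= del / 4].
  pose e := del / (4 * (2 / a + 2)).
  have a20 : 0 < 2 / a by rewrite divr_gt0.
  have e0 : 0 < e by rewrite /e divr_gt0// mulr_gt0// addr_gt0.
  have eE : 2 / a * e + 2 * e = del / 4.
    by rewrite /e; field; rewrite !gt_eqF// addr_gt0// mulr_gt0.
  have [M M0 HM] := atan_near_pi2 e e0.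
  have [eta [eta0 etac etaac]] : exists eta, [/\ 0 < eta, (M + 1) * eta <= c &
      (M + 1) * eta <= a * c].
    have M10 : 0 < M + 1 by lra.
    exists (Num.min c (a * c) / (M + 1)).
    have m0 : 0 < Num.min c (a * c) by rewrite lt_min c0 mulr_gt0.
    rewrite divr_gt0// mulrCA divff ?gt_eqF// mulr1 !ge_min !lexx orbT.
    by [].
  have [b [sb bt pb qb]] := near_tip eta s eta0 (ltW s0) st.
  have b0 := le_trans (ltW s0) sb.
  have cb : c <= y b by apply: yc => //; exact: ltT.
  have acb : a * c <= a * y b by rewrite ler_pM2l.
  have qb0 := qp b b0 bt.
  have Mq : M * q b <= M * eta by rewrite ler_pM2l.
  move: pb; rewrite ler_norml => /andP[pb1 pb2].
  exists b; split => //.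
  have th1 : `|angle (p b - y b) (q b) - pi| <= e.
    have : M <= (y b - p b) / q b by rewrite ler_pdivlMr//; lra.
    move=> /HM; rewrite -(opprB (p b)) mulNr atanN => h.
    have := angle_le_pi (p b - y b) (q b); rewrite ler_norml /angle => h'.
    by apply/andP; split; lra.
  have th2 : `|angle (P b) (q b)| <= e.
    have : M <= P b / q b by rewrite ler_pdivlMr// /P; lra.
    move=> /HM h; rewrite ger0_norm ?angle_ge0// /angle; lra.
  apply: le_trans (ler_normD _ _) _; rewrite (normrM (2 / a)) (normrM 2 (angle _ _)) (gtr0_norm a20) (ger0_norm (ler0n R 2)).
  by rewrite -eE lerD// ler_pM2l.
have th2 := angle_ge0 (P s) (q s); have th2' := angle_le_pi (P s) (q s).
have th2b := angle_ge0 (P b) (q b).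
have be_th : be * angle (P s) (q s) <= del / 2.
  by apply: le_trans bed; rewrite ler_pM2l.
have be_thb : 0 <= be * angle (P b) (q b) by rewrite mulr_ge0// ltW.
have -> : Re (gmap s z) - x s = p s - y s by rewrite /p /y; ring.
rewrite -/(q s) -/(p s) -/(P s) -/(N s).
(* The budget is del/4 for N at [b], del/4 for the energy and del/2 for the auxiliary angle. *)
have := gap2 1 b (expr1n _ _) sb bt.
have := gap2 (-1) b (etrans (sqrrN 1) (expr1n _ _)) sb bt.
move: Nb; rewrite !ler_norml !mul1r !mulN1r => /andP[n1 n2] g1 g2.
by apply/andP; split; lra.
Qed.
End Angle.

(** * Arguments of far points and the conclusion *)

Lemma angle_gt0 {R : realType} (P q : R) : 0 < angle P q.
Proof. by rewrite subr_gt0 atan_ltpi2. Qed.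

Lemma angle_lt_pi {R : realType} (P q : R) : angle P q < pi.
Proof. by have := atan_gtNpi2 (P / q); rewrite /angle; lra. Qed.

Lemma angle_polar {R : realType} (z : R[i]) : 0 < Im z ->
  Re z = cabs z * cos (angle (Re z) (Im z)) /\
  Im z = cabs z * sin (angle (Re z) (Im z)).
Proof.
move=> q0; set P := Re z; set q := Im z in q0 *.
have -> : cos (angle P q) = P / q * cos (atan (P / q)).
  rewrite /angle cosB cos_pihalf sin_pihalf mul0r add0r mul1r.
  rewrite -[X in X * cos _]atanK /tan divfK// gt_eqF// cos_atan invr_gt0 sqrtr_gt0.
  by rewrite ltr_pwDl// sqr_ge0.
have -> : sin (angle P q) = cos (atan (P / q)).
  by rewrite /angle sinB cos_pihalf sin_pihalf mul0r subr0 mul1r.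
have z0 : 0 < cabs z by rewrite cabs_gt0; apply/eqP => E; move: q0; rewrite /q E ltxx.
have -> : cos (atan (P / q)) = q / cabs z.
  rewrite cos_atan -[RHS]invf_div; congr (_^-1).
  have -> : 1 + (P / q) ^+ 2 = (cabs z / q) ^+ 2.
    by rewrite [RHS]expr_div_n cabs_sqr -/P -/q; field; rewrite gt_eqF.
  by rewrite sqrtr_sqr ger0_norm// divr_ge0 ?cabs_ge0// ltW.
by split; field; rewrite ?gt_eqF.
Qed.

Lemma angle_near {R : realType} (z z' : R[i]) (M del : R) :
  0 < Im z -> 0 < Im z' -> 0 < del -> del < pi -> cabs (z' - z) <= M ->
  M < cabs z -> M <= sin del * cabs z' ->
  `|angle (Re z') (Im z') - angle (Re z) (Im z)| <= del.
Proof.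
move=> q0 q0' del0 dpi zM Mz Mz'.
have [zR zI] := angle_polar z q0; have [zR' zI'] := angle_polar z' q0'.
have [a0 a1 b0 b1] : [/\ 0 < angle (Re z) (Im z), angle (Re z) (Im z) < pi,
    0 < angle (Re z') (Im z') & angle (Re z') (Im z') < pi].
  by rewrite !angle_gt0 !angle_lt_pi.
set th := angle (Re z) (Im z) in zR zI a0 a1 *.
set th' := angle (Re z') (Im z') in zR' zI' b0 b1 *.
have M0 : 0 <= M := le_trans (cabs_ge0 _) zM.
have r0 : 0 < cabs z := le_lt_trans M0 Mz.
have r0' : 0 < cabs z'.
  by rewrite cabs_gt0; apply/eqP => E; move: q0'; rewrite E ltxx.
set f := th' - th.
set r := cabs z in zR zI r0 Mz; set r' := cabs z' in zR' zI' r0' Mz'.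
pose u := Re (z' - z); pose v := Im (z' - z).
have uv : u ^+ 2 + v ^+ 2 <= M ^+ 2.
  by rewrite -cabs_sqr ler_sqr ?nnegrE ?cabs_ge0.
have rE : Re z ^+ 2 + Im z ^+ 2 = r ^+ 2 by rewrite -cabs_sqr.
have uvr : (u ^+ 2 + v ^+ 2) * r ^+ 2 <= M ^+ 2 * r ^+ 2 by rewrite ler_wpM2r ?sqr_ge0.
have Es : r * r' * sin f = v * Re z - u * Im z.
  rewrite /f sinB /u /v cImB cReB.
  have -> : r * r' * (sin th' * cos th - cos th' * sin th) =
    (r' * sin th') * (r * cos th) - (r' * cos th') * (r * sin th) by ring.
  by rewrite -zR -zI -zR' -zI'; ring.
have Ec : r * r' * cos f = r ^+ 2 + (u * Re z + v * Im z).
  rewrite /f cosB /u /v cImB cReB -rE.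
  have -> : r * r' * (cos th' * cos th + sin th' * sin th) =
    (r' * cos th') * (r * cos th) + (r' * sin th') * (r * sin th) by ring.
  by rewrite -zR -zI -zR' -zI'; ring.
have sin_le : sin f ^+ 2 <= sin del ^+ 2.
  have h1 : (r * r' * sin f) ^+ 2 <= M ^+ 2 * r ^+ 2.
    apply: le_trans uvr; rewrite Es -rE -subr_ge0.
    have -> : (u ^+ 2 + v ^+ 2) * (Re z ^+ 2 + Im z ^+ 2) - (v * Re z - u * Im z) ^+ 2 =
      (u * Re z + v * Im z) ^+ 2 by ring.
    exact: sqr_ge0.
  have h2 : M ^+ 2 <= (sin del * r') ^+ 2.
    by rewrite ler_sqr ?nnegrE//; exact: le_trans Mz'.
  have rr0 : 0 < (r * r') ^+ 2 by rewrite exprn_gt0// mulr_gt0.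
  rewrite -(ler_pM2l rr0) -exprMn; apply: le_trans h1 _.
  have -> : (r * r') ^+ 2 * sin del ^+ 2 = (sin del * r') ^+ 2 * r ^+ 2 by ring.
  by rewrite ler_wpM2r ?sqr_ge0.
have cos0 : 0 < cos f.
  have rr0 : 0 < r * r' by rewrite mulr_gt0.
  rewrite -(pmulr_rgt0 _ rr0) Ec.
  have : `|u * Re z + v * Im z| <= M * r.
    have h : 0 <= M * r by rewrite mulr_ge0// ltW.
    rewrite -(@ler_sqr R) ?nnegrE// real_normK ?num_real// exprMn.
    apply: le_trans uvr; rewrite -rE -subr_ge0.
    have -> : (u ^+ 2 + v ^+ 2) * (Re z ^+ 2 + Im z ^+ 2) - (u * Re z + v * Im z) ^+ 2 =
      (v * Re z - u * Im z) ^+ 2 by ring.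
    exact: sqr_ge0.
  have : M * r < r * r by rewrite ltr_pM2r.
  by rewrite ler_norml expr2 => h1 /andP[h2 _]; lra.
have cos_ge : cos del <= cos f.
  rewrite leNgt; apply/negP => h.
  have : cos f ^+ 2 < cos del ^+ 2.
    by rewrite ltr_sqr ?nnegrE//; [exact: ltW|exact/ltW/(lt_trans cos0)].
  by have := cos2Dsin2 f; have := cos2Dsin2 del; lra.
rewrite leNgt; apply/negP => h.
have fpi : `|f| <= pi by rewrite ler_norml /f; apply/andP; split; lra.
have : cos `|f| < cos del.
  rewrite ltr_cos ?in_itv/= ?normr_ge0 ?fpi//; apply/andP; split; exact: ltW.
have -> : cos `|f| = cos f.
  by have [_|_] := ger0P f; rewrite ?cosN.
by rewrite ltNge cos_ge.
Qed.

Theorem proposition16 (R : realType) (rho x0 : R) (T : \bar R)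
    (gamma : R -> R[i]^o) (g : R -> R[i]^o -> R[i]^o) (W x : R -> R)
    (hrho : - 2 < rho) (hx0 : 0 < x0)
    (hgamma : class_XC x0 T gamma g W x)
    (henergy : (rho_loewner_energy rho T W x < +oo)%E)
    (am ap : R) (ham : 0 < am) (hm : am < (2 + rho) / (4 + rho))
    (hp : (2 + rho) / (4 + rho) < ap) (hap : ap < 1) :
  exists2 r : R, 0 < r &
    (gamma @` times T) `\` ball (0 : R[i]^o) r%:C `<=` cone am ap.
Proof.
have LC := class_XC_curve hgamma.
move: henergy; rewrite /rho_loewner_energy; case: asboolP => // AC fin2.
set En := (\int[@lebesgue_measure R]_(t in times T) _)%E in fin2.
have fin : (En < +oo)%E.
  have En0 : (0 <= En)%E by apply: integral_ge0 => t _; rewrite lee_fin sqr_ge0.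
  move: fin2 En0; case: En => [e| |]//; first by move=> _ _; exact: ltry.
  by rewrite gt0_muley ?lte_fin ?invr_gt0// ltxx.
have pi0 := pi_gt0 R.
have r4 : 0 < 4 + rho by lra.
have r2 : 0 < 2 + rho by lra.
set al := (2 + rho) / (4 + rho) in hm hp.
have alE : al * (4 + rho) = 2 + rho by rewrite /al divfK// gt_eqF.
have [eta [eta0 eta1 eta2]] : exists eta, [/\ 0 < eta, eta <= ap - al & eta <= al - am].
  exists (Num.min (ap - al) (al - am)); rewrite lt_min !subr_gt0 hm hp.
  by rewrite !ge_min !lexx orbT.
(* Here 5 + rho is 1 + (2 + rho) + 2: the error in [N] plus those of the two angles with their
   weights. *)
have [del [del0 dpi delE]] : exists del : R,
    [/\ 0 < del, del < pi & (5 + rho) * del < eta * (4 + rho) * pi].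
  have r5 : 0 < 5 + rho by lra.
  move: (@pi R) pi0 => w w0.
  have n0 : 0 < eta * (4 + rho) * w by rewrite !mulr_gt0.
  exists (Num.min (w / 2) (eta * (4 + rho) * w / (2 * (5 + rho)))).
  rewrite lt_min !divr_gt0 ?mulr_gt0//; split => //.
    by apply: le_lt_trans (_ : _ <= w / 2) _; [rewrite ge_min lexx|lra].
  apply: le_lt_trans (_ : _ <= eta * (4 + rho) * w / 2) _; last by lra.
  apply: (@le_trans _ _ ((5 + rho) * (eta * (4 + rho) * w / (2 * (5 + rho))))).
    by rewrite ler_pM2l// ge_min lexx orbT.
  by rewrite le_eqVlt; apply/predU1P; left; field; rewrite gt_eqF.
have sd0 : 0 < sin del by apply: sin_gt0_pi; rewrite del0.
have [s sT small] := angle_small hrho hx0 LC AC fin del del0.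
have [s0 sT'] := sT.
have [B B0 HB] := hull_bound LC s (ltW s0) sT'.
have mo := gmap_map LC s (ltW s0) sT'.
have [Mx HMx] := map_expansion _ _ _ mo 1 ltr01.
pose a := 2 / (2 + rho); pose v := W s - a * (x s - W s).
pose M := 1 + `|x s| + `|v|.
have M1 : 1 <= M by rewrite /M -addrA lerDl addr_ge0.
(* [B] discards the curve up to time [s], [Mx] makes the expansion of $g_s$ valid, 1 + 2s gives
   $|g_s(z)-z|\le 1$, and the last two terms are what [angle_near] asks for. *)
pose Rr := B + `|Mx| + 1 + (1 + 2 * s) + M + M / sin del.
have Msd : 0 <= M / sin del by rewrite divr_ge0 ?ltW//; lra.
exists Rr; first by rewrite /Rr; have := normr_ge0 Mx; lra.
move=> _ [[t tT <-] nb]; set z := (gamma t : R[i]).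
have zR : Rr <= cabs z.
  rewrite leNgt; apply/negP => h; apply: nb.
  by rewrite /ball /= sub0r normrN normE ltcR.
have Mx0 := normr_ge0 Mx; have Mx1 := ler_norm Mx.
have st : s < t.
  rewrite ltNge; apply/negP => ts.
  have : curve_hull gamma s z by exists t => //; rewrite /= in_itv/= ts andbT; case: tT.
  by move=> /HB; move: zR; rewrite /Rr; lra.
have zI : 0 < Im z := gamma_im LC t tT.
have dz := gamma_dom LC s t st tT.
have ZI : 0 < Im (hull_map s z) := gmap_im LC s z (ltW s0) sT' dz.
have := small t tT st; rewrite -/z; set Z := hull_map s z => N.
have Zz : cabs (Z - z) <= 1.
  have z0 : 0 < cabs z by move: zR; rewrite /Rr; lra.
  have Mz : Mx < cabs z by move: zR; rewrite /Rr; lra.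
  have := HMx z dz Mz; rewrite -/Z => h.
  have := cabsD (Z - (z + (2 * s)%:C / z)) ((2 * s)%:C / z).
  have -> : Z - (z + (2 * s)%:C / z) + (2 * s)%:C / z = Z - z by ring.
  rewrite cabsM cabsV cabs_real ger0_norm ?mulr_ge0 ?(ltW s0)//.
  have : 1 / cabs z + 2 * s / cabs z <= 1.
    by rewrite -mulrDl ler_pdivrMr// mul1r; move: zR; rewrite /Rr; lra.
  lra.
have near c : `|c| <= M - 1 ->
    `|angle (Re Z - c) (Im Z) - angle (Re z) (Im z)| <= del.
  move=> cM.
  have E : cabs (Z - c%:C - z) <= M.
    have := cabsB (Z - z) c%:C; rewrite cabs_real.
    have -> : Z - z - c%:C = Z - c%:C - z by ring.
    lra.
  have -> : Re Z - c = Re (Z - c%:C) by rewrite cReB.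
  have ZcI : Im Z = Im (Z - c%:C) by rewrite cImB subr0.
  rewrite {1}ZcI; apply: (angle_near _ _ M) => //; first by rewrite -ZcI.
    by move: zR; rewrite /Rr; lra.
  have := cabs_trans (Z - c%:C) z 0; rewrite !subr0 (cabsC z) => h.
  have h2 : M / sin del <= cabs (Z - c%:C) by move: zR; rewrite /Rr; lra.
  by rewrite mulrC -ler_pdivrMr.
have n1 : `|angle (Re Z - x s) (Im Z) - angle (Re z) (Im z)| <= del.
  by apply: near; rewrite /M; have := normr_ge0 v; lra.
have n2 : `|angle (Re Z - W s + a * (x s - W s)) (Im Z) - angle (Re z) (Im z)| <= del.
  have -> : Re Z - W s + a * (x s - W s) = Re Z - v by rewrite /v; ring.
  by apply: near; rewrite /M; have := normr_ge0 (x s); lra.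
have [zRe zIm] := angle_polar z zI.
set th := angle (Re z) (Im z) in n1 n2 zRe zIm.
have th0 : 0 < th by exact: angle_gt0.
have aE : 2 / (2 / (2 + rho)) = 2 + rho by field; rewrite gt_eqF.
move: N; rewrite aE; move: n1 n2; set th1 := angle _ _; set th2 := angle _ _.
move=> n1 n2 N.
(* Replacing both angles in [N] by the argument of z turns it into $(4+\rho)\theta-(2+\rho)\pi$. *)
have key : `|(4 + rho) * th - (2 + rho) * pi| <= (5 + rho) * del.
  have m1 : (2 + rho) * `|th1 - th| <= (2 + rho) * del by rewrite ler_pM2l.
  have -> : (4 + rho) * th - (2 + rho) * pi =
    (2 + rho) * (th1 - pi) + 2 * th2 - ((2 + rho) * (th1 - th) + 2 * (th2 - th)) by ring.
  apply: le_trans (ler_normB _ _) _.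
  have := ler_normD ((2 + rho) * (th1 - th)) (2 * (th2 - th)).
  rewrite !(normrM, gtr0_norm r2) (gtr0_norm (ltr0n R 2)); lra.
have {}key := le_lt_trans key delE.
move: key; rewrite ltr_norml -alE => /andP[k1 k2].
exists (cabs z), th; split.
- by rewrite cabs_gt0; apply/eqP => E; move: zI; rewrite E ltxx.
- rewrite -(ltr_pM2l r4).
  have : eta * (4 + rho) * pi <= (al - am) * (4 + rho) * pi by rewrite !ler_pM2r.
  lra.
- rewrite -(ltr_pM2l r4).
  have : eta * (4 + rho) * pi <= (ap - al) * (4 + rho) * pi by rewrite !ler_pM2r.
  lra.
by apply: complexP; rewrite ?(cReM, cImM) /= mul0r ?subr0 ?addr0.
Qed.
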